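(* Let $G=(V,E)$ be a finite simple connected undirected graph and let $w\colon E\to\mathbb{R}_{>0}$ be a positive weight function. Then $(G,w)$ is weighted-stable if and only if $(G,w)$ belongs to the smallest class $\mathcal{C}$ of positively weighted graphs such that: (1) the graph with a single vertex (and no edges) is in $\mathcal{C}$; (2) (weight-preserving copying) if $(H,w_H)\in\mathcal{C}$ and $u$ is a vertex of $H$, then the weighted graph obtained by adding a new vertex $u'$, joining $u'$ to every neighbor $t$ of $u$ in $H$ by an edge of weight $w_H(tu)$, and either not adding the edge $uu'$ or adding the edge $uu'$ with an arbitrary positive weight, is in $\mathcal{C}$; (3) (gluing at a vertex) if $(H_1,w_1),(H_2,w_2)\in\mathcal{C}$ are vertex-disjoint, $v_1\in V(H_1)$, $v_2\in V(H_2)$, then the weighted graph obtained from their disjoint union by identifying $v_1$ with $v_2$ (all edge weights kept) is in $\mathcal{C}$; (4) (rescaling at a vertex) if $(H,w_H)\in\mathcal{C}$, $v\in V(H)$ and $c>0$, then the weighted graph obtained by multiplying the weights of all edges incident to $v$ by $c$ is in $\mathcal{C}$.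
   Context: Let $\mathbb{H}=\{z\in\mathbb{C}:\Im z>0\}$. A polynomial $P(x_1,\dots,x_n)$ with real coefficients is real stable if $P(z_1,\dots,z_n)\neq 0$ for all $z_1,\dots,z_n\in\mathbb{H}$. For a finite simple connected graph $G=(V,E)$ with a weight function $w\colon E\to\mathbb{R}$, with a variable $x_v$ for each vertex $v$, the weighted vertex spanning tree polynomial is $P_{G,w}=\sum_{T\in S(G)}\prod_{e\in E(T)}w(e)\prod_{v\in V}x_v^{\deg_T(v)-1}$, where $S(G)$ is the set of spanning trees of $G$ and $\deg_T(v)$ is the degree of $v$ in $T$. The weighted graph $(G,w)$ is called weighted-stable if $P_{G,w}$ is real stable. *)

(* Defs.v *)
From HB Require Import structures.
From mathcomp Require Import all_boot all_order all_algebra.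
From mathcomp Require Import complex mpoly.
(* mpoly and the classical layer loaded by reals declare clashing notations. *)
From mathcomp Require Import -(notations) reals.

Set Implicit Arguments.
Unset Strict Implicit.
Unset Printing Implicit Defensive.

Import Order.TTheory GRing.Theory Num.Theory.
Local Open Scope ring_scope.

Definition real_stable (R : realType) (n : nat) (p : {mpoly R[n]}) : Prop :=
  forall z : 'I_n -> R[i], (forall i, 0 < complex.Im (z i)) ->
    (map_mpoly (real_complex R) p).@[z] != 0.

(* An edge is the two-element set of its endpoints, so edges are undirected and
   there are neither loops nor multiple edges. *)
Record sgraph := SGraph {
  vertex :> finType;
  edges : {set {set vertex}};
  edges_card : forall e, e \in edges -> #|e| = 2%N
}.

Section EdgeSets.
Variables (V : finType) (F : {set {set V}}).

Definition edge_rel : rel V := fun x y => [set x; y] \in F.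

Definition connected_edges : bool :=
  (0 < #|V|)%N && [forall x, forall y, connect edge_rel x y].

(* A simple cycle has at most #|V| vertices; the bound 2 < k discards the
   back-and-forth walk along a single edge. *)
Definition acyclic_edges : bool :=
  [forall k : 'I_#|V|.+1, forall c : k.-tuple V,
     (2 < k)%N ==> ~~ ucycleb edge_rel c].

Definition edge_degree (v : V) : nat := #|[set e in F | v \in e]|.

End EdgeSets.

Definition connected_graph (G : sgraph) : bool := connected_edges (edges G).

(* A spanning tree, whose vertex set is that of G, is given by its edges. *)
Definition spanning_trees (G : sgraph) : {set {set {set G}}} :=
  [set T : {set {set G}} |
    [&& T \subset edges G, connected_edges T & acyclic_edges T]].

(* A weight function is a function on all sets of vertices, of which only the
   values on edges matter. *)
Definition weighting (R : realType) (G : sgraph) := {set G} -> R.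

Definition positive_weighting (R : realType) (G : sgraph)
    (w : weighting R G) : Prop :=
  forall e, e \in edges G -> 0 < w e.

(* The variable of v has index enum_rank v. Every degree is positive in a tree
   with at least two vertices. For the one-vertex tree the truncated predecessor
   gives the polynomial 1 where the formula would read x^-1. *)
Definition tree_poly (R : realType) (G : sgraph) (w : weighting R G) :
    {mpoly R[#|G|]} :=
  \sum_(T in spanning_trees G)
    (\prod_(e in T) w e) *:
      \prod_(v : G) 'X_(enum_rank v) ^+ (edge_degree T v).-1.

Definition weighted_stable (R : realType) (G : sgraph)
    (w : weighting R G) : Prop :=
  real_stable (tree_poly w).

Lemma single_card (e : {set unit}) : e \in set0 -> #|e| = 2%N.
Proof. by rewrite inE. Qed.

Definition single_graph : sgraph := SGraph single_card.

Section Copying.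
Variables (R : realType) (H : sgraph) (w : weighting R H) (u : H).
Variable twin : bool.
Variable c : R.

(* None is the new vertex u'; the boolean says whether u u' is an edge. *)
Definition copy_edges : {set {set option H}} :=
  [set Some @: (e : {set H}) | e in edges H]
  :|: [set [set None; Some t] | t : H & edge_rel (edges H) u t]
  :|: (if twin then [set [set None; Some u]] else set0).

Lemma copy_card e : e \in copy_edges -> #|e| = 2%N.
Proof.
rewrite /copy_edges !inE => /orP[/orP[]|].
- by case/imsetP=> f /edges_card f2 ->; rewrite card_imset // => x y [].
- by case/imsetP=> t _ ->; rewrite cards2.
- by case: twin; rewrite !inE // => /eqP ->; rewrite cards2.
Qed.

Definition copy_graph : sgraph := SGraph copy_card.

(* On {u', t} with t a neighbour of u, the preimage under Some is {t}. *)
Definition copy_weight : weighting R copy_graph :=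
  fun e : {set option H} =>
    if None \notin e then w (Some @^-1: e)
    else if Some u \in e then c
    else w (u |: Some @^-1: e).

End Copying.

Arguments copy_weight {R H} w u twin c _.

Section Gluing.
Variables (R : realType) (H1 H2 : sgraph).
Variables (w1 : weighting R H1) (w2 : weighting R H2) (v1 : H1) (v2 : H2).

Definition glue_vertex : finType := (H1 + {x : H2 | x != v2})%type.

Definition glue_inl (x : H1) : glue_vertex := inl x.

Definition glue_inr (x : H2) : glue_vertex :=
  if insub x is Some y then inr y else inl v1.

Lemma glue_inl_inj : injective glue_inl.
Proof. by move=> x y []. Qed.

Lemma glue_inr_inj : injective glue_inr.
Proof.
move=> x y; rewrite /glue_inr.
case: insubP => [a _ <-|/negPn/eqP ->]; case: insubP => [b _ <-|/negPn/eqP ->] //.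
by case=> ->.
Qed.

Definition glue_edges : {set {set glue_vertex}} :=
  [set glue_inl @: (e : {set H1}) | e in edges H1]
  :|: [set glue_inr @: (e : {set H2}) | e in edges H2].

Lemma glue_card e : e \in glue_edges -> #|e| = 2%N.
Proof.
rewrite /glue_edges inE => /orP[] /imsetP[f /edges_card f2 ->].
  by rewrite card_imset //; exact: glue_inl_inj.
by rewrite card_imset //; exact: glue_inr_inj.
Qed.

Definition glue_graph : sgraph := SGraph glue_card.

(* No edge comes from both sides, as the two images share only one vertex. *)
Definition glue_weight : weighting R glue_graph :=
  fun e : {set glue_vertex} =>
    if e \in [set glue_inl @: (f : {set H1}) | f in edges H1]
    then w1 (glue_inl @^-1: e)
    else w2 (glue_inr @^-1: e).

End Gluing.

Arguments glue_weight {R H1 H2} w1 w2 v1 v2 _.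

Definition rescale_weight (R : realType) (H : sgraph) (w : weighting R H)
    (v : H) (c : R) : weighting R H :=
  fun e => if v \in e then c * w e else w e.

(* Isomorphism of weighted graphs; weights are compared on edges only. *)
Definition weighted_iso (R : realType) (G H : sgraph) (wG : weighting R G)
    (wH : weighting R H) (f : G -> H) : Prop :=
  [/\ bijective f,
      edges H = [set f @: (e : {set G}) | e in edges G]
    & forall e, e \in edges G -> wH (f @: e) = wG e].

(* The operations are defined on specific vertex types, hence the closure under
   isomorphism. The class contains disconnected graphs, since copying an
   isolated vertex is allowed. *)
Inductive stable_class (R : realType) : forall G : sgraph, weighting R G -> Prop :=
| class_single (w : weighting R single_graph) :
    stable_class w
| class_copy (H : sgraph) (w : weighting R H) (u : H) (twin : bool) (c : R) :
    stable_class w -> 0 < c -> stable_class (copy_weight w u twin c)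
| class_glue (H1 H2 : sgraph) (w1 : weighting R H1) (w2 : weighting R H2)
    (v1 : H1) (v2 : H2) :
    stable_class w1 -> stable_class w2 ->
    stable_class (glue_weight w1 w2 v1 v2)
| class_rescale (H : sgraph) (w : weighting R H) (v : H) (c : R) :
    stable_class w -> 0 < c -> stable_class (rescale_weight w v c)
| class_iso (G H : sgraph) (wG : weighting R G) (wH : weighting R H)
    (f : G -> H) :
    weighted_iso wG wH f -> stable_class wG -> stable_class wH.

(* Main.v *)
Require Import Defs.
From HB Require Import structures.
From mathcomp Require Import all_boot all_order all_algebra.
From mathcomp Require Import perm complex mpoly.
From mathcomp Require Import -(notations) reals.
From mathcomp Require Import ring zify.

Set Implicit Arguments.
Unset Strict Implicit.
Unset Printing Implicit Defensive.

Import Order.TTheory GRing.Theory Num.Theory.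
Local Open Scope ring_scope.

(* By the matrix-tree theorem, [x_r P(x)] is the principal minor at [r] of a weighted
   Laplacian, so stability is nonvanishing of Laplacian minors on the upper half
   plane. If the vertex [a] is a scaled twin of [b], or is pendant at [b], then
   adding [a] multiplies the minor by a linear form with nonnegative coefficients
   and replaces [x_b] by [x_b + mu x_a]; gluing multiplies minors. This gives
   stability of the whole class.

   Conversely, a stable connected graph is dismantled by such steps. Remove a
   vertex [v] that is not a cut vertex: by Hurwitz, the rest [U] is stable, hence
   inductively reducible, and its minors factor into linear forms. Write
   [D1 x_v + D2 x_v^2 + ...] for the minor as a polynomial in [x_v], where [D1] is
   [sum_t W v t x_t] times these forms. Stability makes [D2 / D1] map the upper
   half plane to the closed lower one, so its real poles are simple; thus on the
   hyperplane [sum_t W v t x_t = 0], [D2] is a constant multiple of the product of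
   the forms. The factor of proportionality is the energy [sum_t W v t x_t phi_t]
   of the electrical potential [phi] driven by the weights at [v]. As it does not
   depend on [x], its derivative vanishes, which forces the Laplacian of [phi^2]
   to be proportional to the weights at [v], and so [phi] takes only two values.
   The level sets form a split of [U], with a cut matrix of rank one, in the middle
   of which [v] sits. Such splits around every [v] yield a twin or pendant pair. *)

(** * Laplacian minors *)

(** On the hyperplane [sum_t W v t x_t = 0] the extra linear factor of [D1] vanishes too, so simple
    poles make [D2] vanish there to at least the order of the product of the forms; both have degree
    at most [#|U| - 2], and only a constant quotient remains. Once the Laplacian of [phi] and that
    of [phi ^ 2] are both proportional to the weights at [v], some [phi ^ 2 + lam phi] is harmonic,
    hence constant, and [phi] is a root of a fixed quadratic. The level set depends on the point
    chosen in the hyperplane, whereas genericity concerns a list of forms fixed beforehand; so the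
    point has to avoid the cut minors of all subsets at once. One side of a split together with one
    vertex of the other side is again connected and smaller. A twin or pendant pair found there
    lifts only if it avoids that added vertex, so the induction has to produce pairs avoiding any
    prescribed vertex. *)

Section Determinants.
Variables (A : comNzRingType) (n : nat).
Implicit Types (M N : 'M[A]_n) (c v : 'I_n -> A).

Lemma det_adj_apply M c v k :
  (forall i, \sum_j M i j * c j = v i) ->
  \det M * c k = \sum_i \adj M k i * v i.
Proof.
move=> Mc; pose C : 'cV[A]_n := \col_i c i.
have /(congr1 (fun B : 'cV[A]_n => B k 0)) :
    \adj M *m (M *m C) = \det M *: C.
  by rewrite mulmxA mul_adj_mx mul_scalar_mx.
rewrite !mxE => <-; apply: eq_bigr => i _; congr (_ * _).
by rewrite -Mc mxE; apply: eq_bigr => j _; rewrite !mxE.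
Qed.

(** Zero divisors are allowed, so the kernel vector must have an entry equal to 1, not merely a
    nonzero one. *)
Lemma det_right_null M c k :
  (forall i, \sum_j M i j * c j = 0) -> c k = 1 -> \det M = 0.
Proof.
move=> Mc ck; have := @det_adj_apply M c (fun=> 0) k Mc.
by rewrite ck mulr1 => ->; apply: big1 => i _; rewrite mulr0.
Qed.

Lemma det_left_null M c k :
  (forall j, \sum_i c i * M i j = 0) -> c k = 1 -> \det M = 0.
Proof.
move=> Mc ck; rewrite -det_tr; apply: (det_right_null _ ck) => i.
by rewrite -[RHS](Mc i); apply: eq_bigr => j _; rewrite mxE mulrC.
Qed.

(** In the Leibniz sum only permutations fixing [Z] pointwise survive, and these never read an entry
    of a row outside [Z] in a column of [Z]; such entries may differ. *)
Lemma det_unit_rows (Z : {set 'I_n}) M N :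
    (forall i j, i \in Z -> M i j = (i == j)%:R) ->
    (forall i j, i \in Z -> N i j = (i == j)%:R) ->
    (forall i j, i \notin Z -> j \notin Z -> M i j = N i j) ->
  \det M = \det N.
Proof.
move=> MZ NZ MN; apply: eq_bigr => s _.
have [/forallP sZ|] := boolP [forall i, (i \in Z) ==> (s i == i)]; last first.
  rewrite negb_forall => /existsP[k]; rewrite negb_imply => /andP[kZ sk].
  by rewrite (bigD1 k) //= MZ // [k == _]eq_sym (negPf sk) mul0r mulr0
             (bigD1 k) //= NZ // [k == _]eq_sym (negPf sk) mul0r mulr0.
congr (_ * _); apply: eq_bigr => i _.
have [iZ|iZ] := boolP (i \in Z); first by rewrite MZ ?NZ.
apply: MN => //; apply: contra iZ => siZ.
have /implyP/(_ siZ)/eqP/perm_inj si := sZ (s i).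
by rewrite -si.
Qed.

Definition set_row M (i : 'I_n) v : 'M[A]_n :=
  \matrix_(t, j) if t == i then v j else M t j.

Lemma det_set_row_lin M i a b v w :
  \det (set_row M i (fun j => a * v j + b * w j)) =
  a * \det (set_row M i v) + b * \det (set_row M i w).
Proof.
apply: (determinant_multilinear (i0 := i)).
- by apply/rowP => j; rewrite !mxE eqxx.
- by apply/matrixP => t j; rewrite !mxE eq_sym (negPf (neq_lift _ _)).
- by apply/matrixP => t j; rewrite !mxE eq_sym (negPf (neq_lift _ _)).
Qed.

Lemma det_set_row_scale M i a v :
  \det (set_row M i (fun j => a * v j)) = a * \det (set_row M i v).
Proof.
have := det_set_row_lin M i a 0 v v; rewrite mul0r addr0 => <-.
by congr (\det _); apply/matrixP => t j; rewrite !mxE mul0r addr0.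
Qed.

Lemma det_set_row_self M i v a w :
  (forall j, v j = \sum_(t | t != i) w t * M t j + a * M i j) ->
  \det (set_row M i v) = a * \det M.
Proof.
move=> vE; have E0 : set_row M i (fun j => M i j) = M.
  by apply/matrixP => t j; rewrite mxE; case: eqP => // ->.
have := det_set_row_lin M i 1 (- a) v (fun j => M i j).
rewrite E0 mul1r mulNr => /eqP; rewrite -subr_eq0; move=> /eqP H.
apply/eqP; rewrite -subr_eq0; apply/eqP; move: H.
(* This row is a combination of the other rows, whose coefficients give a left null vector. *)
suff -> : \det (set_row M i (fun j => 1 * v j + - a * M i j)) = 0.
  by rewrite sub0r => /eqP; rewrite oppr_eq0 => /eqP.
apply: (@det_left_null _ (fun t => if t == i then 1 else - w t) i); last by rewrite eqxx.
move=> j; rewrite (bigD1 i) //= eqxx !mxE eqxx !mul1r vE mulNr addrK -big_split /=.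
by rewrite big1 // => t /negPf ti; rewrite !mxE ti mulNr subrr.
Qed.

Lemma adj_set_row M i j :
  \adj M j i = \det (set_row M i (fun k => (k == j)%:R)).
Proof.
rewrite (expand_det_row _ i) (bigD1 j) //= !mxE !eqxx mul1r big1 ?addr0.
  rewrite /cofactor; congr (_ * \det _).
  by apply/matrixP => a b; rewrite !mxE eq_sym (negPf (neq_lift _ _)).
by move=> k kj; rewrite !mxE eqxx (negPf kj) mul0r.
Qed.

Lemma det_unit_rows_but (i : 'I_n) M :
  (forall t j, t != i -> M t j = (t == j)%:R) -> \det M = M i i.
Proof.
move=> Mi; rewrite (expand_det_col _ i) (bigD1 i) //= [X in _ + X]big1 ?addr0.
  rewrite /cofactor addnn -signr_odd odd_double expr0 mul1r.
  suff -> : row' i (col' i M) = 1%:M by rewrite det1 mulr1.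
  by apply/matrixP => a b; rewrite !mxE Mi ?(inj_eq (lift_inj (h := i))) // eq_sym neq_lift.
by move=> t ti; rewrite Mi // (negPf ti) mul0r.
Qed.

End Determinants.

(** * Weighted Laplacians: change of root, twins, deletion, gluing *)

Section Laplacian.
Variables (A : comNzRingType) (n : nat).
Implicit Types (U Z : {set 'I_n}) (x c : 'I_n -> A) (W : 'I_n -> 'I_n -> A).

(* The row [t] of the Laplacian of the weights [x t * W t u * x u], divided by
   [x t]. *)
Definition lap W U x (t j : 'I_n) : A :=
  (t == j)%:R * (\sum_(u in U) W t u * x u) - (j \in U)%:R * (W t j * x j).

Definition lapmx W Z U x : 'M[A]_n :=
  \matrix_(t, j) if t \in Z then lap W U x t j else (t == j)%:R.

(* The principal minor of [U] at [r], as a determinant of the fixed size [n]. For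
   the whole vertex set it is [x r] times the spanning tree polynomial. *)
Definition tdet W U r x : A := \det (lapmx W (U :\ r) U x).

Lemma sum_delta (i : 'I_n) c : \sum_j (i == j)%:R * c j = c i.
Proof.
rewrite (bigD1 i) //= eqxx mul1r big1 ?addr0 // => j ji.
by rewrite eq_sym (negPf ji) mul0r.
Qed.

Lemma lap_apply W U x t c :
  \sum_j lap W U x t j * c j = \sum_(u in U) W t u * x u * (c t - c u).
Proof.
under eq_bigr do rewrite mulrBl.
rewrite sumrB.
under eq_bigr do rewrite -mulrA.
rewrite sum_delta mulr_suml [X in _ - X](bigID (mem U)) /= [X in _ - (_ + X)]big1 ?addr0.
  by rewrite -sumrB; apply: eq_bigr => u -> ; rewrite mul1r mulrBr.
by move=> u /negPf ->; rewrite !mul0r.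
Qed.

Lemma lap_ones W U x t : t \in U ->
  \sum_j lap W U x t j * (j \in U)%:R = 0.
Proof. by move=> tU; rewrite lap_apply big1 // => u uU; rewrite tU uU subrr mulr0. Qed.

(** Multiplying row [t] by [x t] restores the symmetric Laplacian, whose columns sum to zero like
    its rows. *)
Lemma lap_left W U x j : (forall t u, W t u = W u t) ->
  \sum_(t in U) x t * lap W U x t j = 0.
Proof.
move=> Wsym; under eq_bigr do rewrite mulrBr; rewrite sumrB.
have [jU|jU] := boolP (j \in U); last first.
  rewrite !big1 ?subr0 // => t tU; first by rewrite mul0r mulr0.
  by case: eqP => [tj|]; [rewrite -tj tU in jU | rewrite mul0r mulr0].
rewrite (bigD1 j) //= eqxx mul1r mulr_sumr [X in _ + X - _]big1 ?addr0; last first.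
  by move=> t /andP[_ /negPf ->]; rewrite mul0r mulr0.
by rewrite -sumrB big1 // => t tU; rewrite (Wsym t j); ring.
Qed.

Lemma lapmx_ones W Z U x t : t \in Z -> Z \subset U ->
  \sum_j lapmx W Z U x t j * (j \in U)%:R = 0.
Proof.
move=> tZ ZU; rewrite -[RHS](lap_ones W x (subsetP ZU t tZ)).
by apply: eq_bigr => j _; rewrite mxE tZ.
Qed.

Lemma tdet_ext W W' U r x x' :
    (forall t u, t \in U -> u \in U -> W t u = W' t u) ->
    (forall t, t \in U -> x t = x' t) ->
  tdet W U r x = tdet W' U r x'.
Proof.
move=> WW xx; congr (\det _); apply/matrixP => t j; rewrite !mxE.
case: ifP => // /setD1P[_ tU]; congr (_ * _ - _).
  by apply: eq_bigr => u uU; rewrite WW ?xx.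
by case: (boolP (j \in U)) => jU; rewrite ?mul0r // WW ?xx.
Qed.

(** Changing [j] alters the replaced row by a difference of two unit vectors, which the indicator of
    [U] annihilates as it does the Laplacian rows; so all cofactors of row [i] are equal. *)
Lemma lapmx_adj W U x i j : i \in U -> j \in U ->
  \adj (lapmx W U U x) j i = tdet W U i x.
Proof.
move=> iU jU; rewrite adj_set_row.
have -> : tdet W U i x =
          \det (set_row (lapmx W U U x) i (fun k => (k == i)%:R)).
  congr (\det _); apply/matrixP => t k; rewrite !mxE in_setD1.
  by case: eqP => //= ->; rewrite eq_sym.
apply/eqP; rewrite -subr_eq0 -[\det _ as X in X - _]mul1r -mulN1r -det_set_row_lin.
apply/eqP; apply: (@det_right_null _ _ _ (fun k => (k \in U)%:R) i); last by rewrite iU.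
move=> t; have [ti|ti] := eqVneq t i.
  rewrite (eq_bigr (fun k => (j == k)%:R * (k \in U)%:R - (i == k)%:R * (k \in U)%:R)).
    by rewrite sumrB !sum_delta iU jU subrr.
  by move=> k _; rewrite !mxE ti eqxx mul1r mulN1r mulrBl (eq_sym k j) (eq_sym k i).
have [tU|tU] := boolP (t \in U).
  rewrite -[RHS](lapmx_ones W x tU (subxx _)).
  by apply: eq_bigr => k _; rewrite mxE (negPf ti).
rewrite -[RHS](_ : (t \in U)%:R = 0 :> A); last by rewrite (negPf tU).
rewrite -[in RHS](sum_delta t (fun k => (k \in U)%:R)).
by apply: eq_bigr => k _; rewrite !mxE (negPf ti) (negPf tU).
Qed.

Lemma det_swap_rows (M : 'M[A]_n) (i j : 'I_n) : i != j ->
  \det (xrow i j M) = - \det M.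
Proof. by move=> ij; rewrite xrowE det_mulmx det_perm odd_tperm ij mulN1r. Qed.

(** The relation [lap_left] trades row [u] for a multiple of row [v] in the minor at [v]; a row swap
    then turns the result into a cofactor of row [u]. *)
Lemma tdet_root W U x u v : (forall t s, W t s = W s t) -> u \in U -> v \in U ->
  x u * tdet W U v x = x v * tdet W U u x.
Proof.
move=> Wsym uU vU; have [->//|uv] := eqVneq u v.
pose T := lapmx W (U :\ v) U x.
rewrite -(lapmx_adj W x uU vU) adj_set_row.
have E1 : \det (set_row T u (fun j => - x v * lap W U x v j)) = x u * \det T.
  apply: (@det_set_row_self _ _ _ _ _ _ (fun t => if t \in U :\ v then x t else 0)).
  move=> j; have := lap_left U x j Wsym.
  rewrite (bigD1 v) //= (bigD1 u) /= ?uU // => /eqP; rewrite addr_eq0 => /eqP E.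
  rewrite mulNr E opprK !mxE !inE uv uU addrC; congr (_ + _).
  rewrite [RHS](bigID (mem (U :\ v))) /= [X in _ + X]big1 ?addr0; last first.
    by move=> t /andP[_ /negPf->]; rewrite mul0r.
  apply: eq_big => t; first by rewrite !inE; case: (t \in U); case: (t == v); case: (t == u).
  by case/andP=> /andP[tU tv] tu; rewrite !mxE !inE tv tU.
rewrite /tdet -E1 det_set_row_scale mulNr -mulrN -(det_swap_rows _ uv).
congr (_ * \det _); apply/matrixP => t j; rewrite !mxE permE /= !inE.
have [_|tu] := eqVneq t u.
  by rewrite /= [v == u]eq_sym (negPf uv) eqxx /= eq_sym.
have [->|tv] := eqVneq t v; first by rewrite eqxx vU.
by rewrite (negPf tu) tv.
Qed.

(** Two elementary operations merge [a] into [b]. The root differs from [b] so that the row of [b]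
    is available. *)
Lemma tdet_step W U a b r (mu : A) x : (forall t s, W t s = W s t) ->
    a \notin U -> b \in U -> r \in U -> r != b ->
    (forall t, t \in U -> t != b -> W t a = mu * W t b) ->
  tdet W (a |: U) r x =
  (mu * (\sum_(t in U | t != b) W b t * x t) + W a b * (x b + mu * x a))
    * tdet W U r (fun t => if t == b then x b + mu * x a else x t).
Proof.
move=> Wsym aU bU rU rb dep; set F := _ + _.
have ab : a != b by apply: contraNneq aU => ->.
have ra : r != a by apply: contraNneq aU => <-.
have sumaU (f : 'I_n -> A) : \sum_(u in a |: U) f u = f a + \sum_(u in U) f u.
  by rewrite big_setU1.
pose T := lapmx W ((a |: U) :\ r) (a |: U) x.
pose T' := set_row T a (fun j => (j == a)%:R - (j == b)%:R).
(* Row [a] minus [mu] times row [b] is [F] times the difference of the unit vectors at [a] and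
   [b]. *)
have FE : F * \det T' = \det T.
  rewrite -det_set_row_scale -[RHS]mul1r.
  apply: (@det_set_row_self _ _ _ _ _ _ (fun t => if t == b then - mu else 0)) => j.
  rewrite (bigD1 b) 1?eq_sym //= eqxx [X in _ + X + _]big1 ?addr0 => [|t /andP[_ /negPf ->]]; last by rewrite mul0r.
  rewrite !mxE !inE eqxx [b == a]eq_sym (negPf ab) bU ![_ == r]eq_sym (negPf rb) (negPf ra) /= /lap !sumaU.
  have Sa : \sum_(u in U) W a u * x u
          = W a b * x b + mu * \sum_(t in U | t != b) W b t * x t.
    rewrite (bigD1 b) //=; congr (_ + _); rewrite mulr_sumr.
    by apply: eq_bigr => t /andP[tU tb]; rewrite Wsym dep // (Wsym t b) mulrA.
  have Sb : \sum_(u in U) W b u * x u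
          = W b b * x b + \sum_(t in U | t != b) W b t * x t.
    by rewrite (bigD1 b).
  rewrite Sa Sb.
  rewrite /F (Wsym b a) !inE; set S := \sum_(t in U | t != b) _.
  have [->|ja] := eqVneq j a.
    rewrite ?eqxx ?[b == a]eq_sym ?(negPf ab) ?(Wsym b a) /=; ring.
  have [->|jb] := eqVneq j b.
    rewrite ?eqxx ?(negPf ab) ?bU /=; ring.
  rewrite ?[_ == j]eq_sym ?(negPf ja) ?(negPf jb) /=.
  have [jU|jU] := boolP (j \in U); last by rewrite /=; ring.
  by rewrite (Wsym a j) (dep j) // (Wsym j b) /=; ring.
rewrite /tdet -/T -FE; congr (_ * _).
(* Right multiplication by [E] adds column [a] to column [b]: row [a] becomes a unit row, and column
   [b] collects [x b + mu * x a]. *)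
pose E : 'M[A]_n := \matrix_(k, j) ((k == j)%:R + ((k == a) && (j == b))%:R).
have detE : \det E = 1.
  rewrite (@det_unit_rows_but _ _ a) => [|t j /negPf ta].
    by rewrite mxE !eqxx (negPf ab) addr0.
  by rewrite mxE ta addr0.
rewrite -[LHS]mulr1 -detE -det_mulmx.
have T'E t j : (T' *m E) t j = T' t j + (j == b)%:R * T' t a.
  rewrite mxE; under eq_bigr do rewrite [E _ _]mxE mulrDr.
  rewrite big_split /=; congr (_ + _).
    under eq_bigr do rewrite eq_sym mulrC; exact: sum_delta.
  under eq_bigr do rewrite -mulnb natrM mulrCA eq_sym.
  by rewrite sum_delta mulrC.
apply: (@det_unit_rows _ _ (~: (U :\ r))) => t j; rewrite !inE.
- rewrite T'E !mxE !inE eqxx.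
  have [->|ta] := eqVneq t a.
    by move=> _; rewrite (negPf ab) subr0 mulr1 subrK eq_sym.
  by rewrite /= => /negPf ->; rewrite mulr0 addr0.
- by move=> /negPf tU; rewrite mxE !inE tU.
rewrite !negbK => /andP[tr tU] /andP[jr jU].
rewrite T'E !mxE !inE tr tU /=.
have ta : t != a by apply: contraNneq aU => <-.
have ja : j != a by apply: contraNneq aU => <-.
rewrite (negPf ta) /= /lap !sumaU !inE jU eqxx (negPf ta) orbT mul0r sub0r !mul1r.
have St : \sum_(u in U) W t u * x u
        = W t b * x b + \sum_(i in U | i != b) W t i * x i by rewrite (bigD1 b).
rewrite St [X in _ = _ * X - _](bigD1 b) //= eqxx.
have -> : \sum_(i in U | i != b) W t i * (if i == b then x b + mu * x a else x i)
   = \sum_(i in U | i != b) W t i * x i.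
  by apply: eq_bigr => i /andP[_ /negPf->].
have [->|jb] := eqVneq j b.
  have [->|tb] := eqVneq t b; first by rewrite /=; ring.
  by rewrite (dep t) //=; ring.
have [tj|tj] := eqVneq t j; last by rewrite /=; ring.
by rewrite -tj in jb *; rewrite (dep t) // /=; ring.
Qed.

(** With [x v = 0] the column of [v] vanishes in the rows of [U], so [v] contributes only its
    diagonal entry; the product [N *m E] displays this triangular shape. *)
Lemma tdet_del W U u v x : v \notin U -> u \in U -> x v = 0 ->
  tdet W (v |: U) u x = (\sum_(t in U) W v t * x t) * tdet W U u x.
Proof.
move=> vU uU xv.
pose M := lapmx W ((v |: U) :\ u) (v |: U) x; pose N := lapmx W (U :\ u) U x.
have uv : u != v by apply: contraNneq vU => <-.
have sumvU t : \sum_(s in v |: U) W t s * x s = \sum_(s in U) W t s * x s.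
  by rewrite big_setU1 //= xv mulr0 add0r.
have Mvv : M v v = \sum_(t in U) W v t * x t.
  by rewrite !mxE !inE eqxx eq_sym uv /= /lap eqxx sumvU !inE eqxx xv !mulr0 subr0 mul1r.
pose E : 'M[A]_n := \matrix_(k, j) if k == v then M v j else (k == j)%:R.
have <- : \det E = \sum_(t in U) W v t * x t.
  rewrite (@det_unit_rows_but _ _ v) => [|t j /negPf tv]; last by rewrite mxE tv.
  by rewrite mxE eqxx.
rewrite mulrC -det_mulmx; congr (\det _); apply/matrixP => t j.
rewrite -/M -/N [in RHS]mxE.
rewrite (eq_bigr (fun k => (j == k)%:R * N t k + (v == k)%:R * (N t k * (M v j - (v == j)%:R)))).
  rewrite big_split /= !sum_delta.
  have [->|tv] := eqVneq t v.
    rewrite [N v _]mxE [N v v]mxE !inE (negPf vU) andbF eqxx mul1r.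
    by rewrite addrCA subrr addr0.
  have -> : N t v = 0.
    rewrite mxE; case: ifP => _; last by rewrite (negPf tv).
    by rewrite /lap (negPf tv) (negPf vU) !mul0r subr0.
  rewrite mul0r addr0 !mxE !inE (negPf tv) /=; case: ifP => // _.
  rewrite /lap sumvU !inE.
  have [->|_] /= := eqVneq j v; last by [].
  by rewrite xv mulr0 mulr0 (negPf vU) mul0r.
move=> k _; rewrite [E _ _]mxE.
have [->|kv] := eqVneq k v.
  by rewrite mul1r [j == v]eq_sym; ring.
by rewrite mul0r addr0 mulrC eq_sym.
Qed.

(** Rooted at the common vertex, the Laplacian is block diagonal. Each factor pads the block of the
    other with unit rows, so the product of the two matrices is the whole one. *)
Lemma tdet_glue W U1 U2 r x : U1 :&: U2 = [set r] ->
    (forall t u, t \in U1 :\ r -> u \in U2 :\ r -> W t u = 0 /\ W u t = 0) ->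
  tdet W (U1 :|: U2) r x = tdet W U1 r x * tdet W U2 r x.
Proof.
move=> U12 W0; rewrite /tdet -det_mulmx; congr (\det _); apply/matrixP => t j.
rewrite [in RHS]mxE.
have r12 : (r \in U1) && (r \in U2) by rewrite -in_setI U12 set11.
have{r12} [r1 r2] := andP r12.
have disj k : k != r -> k \in U1 -> k \in U2 -> False.
  move=> kr k1 k2; have : k \in U1 :&: U2 by rewrite inE k1.
  by rewrite U12 inE (negPf kr).
have [t1|t1] := boolP (t \in U1 :\ r).
  have [tr tU1] := setD1P t1.
  have W0t u : u \in U2 -> u \notin U1 -> W t u = 0.
    move=> u2 u1; have := W0 t u t1; rewrite !inE u2 andbT; case=> //.
    by apply: contraNneq u1 => ->.
  rewrite (eq_bigr (fun k => (j == k)%:R * lap W U1 x t k)); last first.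
    move=> k _; rewrite !mxE t1 mulrC !inE.
    have [/andP[kr k2]|_] := boolP ((k != r) && (k \in U2)); last by rewrite eq_sym.
    have k1 : k \notin U1 by apply/negP => k1; exact: disj kr k1 k2.
    have -> : lap W U1 x t k = 0; last by rewrite !mulr0.
    rewrite /lap (negPf k1) mul0r subr0.
    by have [tk|] := eqVneq t k; [rewrite -tk tU1 in k1 | rewrite mul0r].
  rewrite sum_delta mxE !inE tr tU1 /= /lap !inE; congr (_ * _ - _).
    rewrite (bigID (mem U1)) /= [X in _ + X]big1 ?addr0.
      by apply: eq_bigl => u; rewrite !inE; case: (u \in U1); rewrite ?andbF.
    move=> u /andP[]; rewrite !inE; case: (boolP (u \in U1)) => //= u1 u2 _.
    by rewrite W0t // mul0r.
  case: (boolP (j \in U1)) => //= j1; case: (boolP (j \in U2)) => //= j2.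
  by rewrite W0t // !(mul0r, mulr0).
rewrite (eq_bigr (fun k => (t == k)%:R * lapmx W (U2 :\ r) U2 x k j)); last first.
  by move=> k _; rewrite [X in X * _]mxE (negPf t1).
rewrite sum_delta !mxE; move: t1; rewrite !inE.
have [//|tr] /= := eqVneq t r; move=> t1; rewrite (negPf t1) /=.
case: ifP => // t2.
have W0t u : u \in U1 -> u \notin U2 -> W t u = 0.
  move=> u1 u2; have := W0 u t; rewrite !inE u1 tr t2 andbT; case=> //.
  by apply: contraNneq u2 => ->.
rewrite /lap !inE; congr (_ * _ - _).
  rewrite (bigID (mem U2)) /= [X in _ + X]big1 ?addr0.
    by apply: eq_bigl => u; rewrite !inE; case: (u \in U2); rewrite ?andbF ?orbT.
  move=> u /andP[]; rewrite !inE => u12 u2; rewrite W0t ?mul0r //.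
  by move: u12; rewrite (negPf u2) orbF.
case: (boolP (j \in U2)) => //= j2; first by rewrite orbT.
by rewrite orbF; case: (boolP (j \in U1)) => //= j1; rewrite W0t // !(mul0r, mulr0).
Qed.

End Laplacian.

Lemma tdet_morph (A B : comNzRingType) (h : {rmorphism A -> B}) n
    (W : 'I_n -> 'I_n -> A) U r (x : 'I_n -> A) :
  h (tdet W U r x) = tdet (fun t u => h (W t u)) U r (fun t => h (x t)).
Proof.
rewrite /tdet -det_map_mx; congr (\det _); apply/matrixP => t j; rewrite !mxE.
case: ifP => _; last by rewrite rmorph_nat.
rewrite /lap rmorphB !rmorphM !rmorph_nat rmorph_sum; congr (_ * _ - _).
by apply: eq_bigr => u _; rewrite rmorphM.
Qed.

(** Listing the image of [f] before its complement makes the matrix block upper triangular with an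
    identity corner. *)
Lemma det_mxsub_inj (A : comNzRingType) m n (f : 'I_m -> 'I_n) (M : 'M[A]_n) :
    injective f ->
    (forall i j, i \notin codom f -> M i j = (i == j)%:R) ->
  \det M = \det (mxsub f f M).
Proof.
move=> f_inj Mf.
have [k [kE nE]] : exists k, k = #|[predC codom f]| /\ n = (m + k)%N.
  exists #|[predC codom f]|; split=> //.
  have := cardC (mem (codom f)); rewrite card_codom // !card_ord => E.
  apply: etrans (esym E) _.
  by congr (_ + _)%N; apply: eq_card.
subst n.
pose e (i : 'I_(m + k)) : 'I_(m + k) :=
  match split i with inl a => f a | inr b => enum_val (cast_ord kE b) end.
have e_inj : injective e.
  have ND a b : f a <> enum_val (cast_ord kE b).
    by move=> E; have := enum_valP (cast_ord kE b); rewrite -E inE /= codom_f.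
  move=> p q; rewrite /e -{2}[p]splitK -{2}[q]splitK.
  case: (split p) => a; case: (split q) => b.
  - by move=> /f_inj ->.
  - by move=> /ND.
  - by move=> /esym/ND.
  - by move=> /enum_val_inj/cast_ord_inj ->.
pose s := perm e_inj; pose M' := row_perm s (col_perm s M).
have -> : \det M = \det M'.
  rewrite /M' row_permE col_permE !det_mulmx !det_perm odd_permV mulrCA.
  by rewrite -expr2 sqrr_sign mulr1.
have el a : s (lshift k a) = f a by rewrite permE /e -[lshift k a]/(unsplit (inl a)) unsplitK.
have er b : s (rshift m b) = enum_val (cast_ord kE b).
  by rewrite permE /e -[rshift m b]/(unsplit (inr b)) unsplitK.
have eC b : s (rshift m b) \notin codom f.
  by rewrite er; have := enum_valP (cast_ord kE b); rewrite inE.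
rewrite -[M']submxK.
have -> : dlsubmx M' = 0.
  apply/matrixP => b a; rewrite !mxE Mf ?eC //.
  by rewrite (inj_eq (@perm_inj _ s)) eq_sym eq_lrshift.
have -> : drsubmx M' = 1%:M.
  by apply/matrixP => b b'; rewrite !mxE Mf ?eC // (inj_eq (@perm_inj _ s)) eq_rshift.
rewrite det_ublock det1 mulr1; congr (\det _).
by apply/matrixP => a a'; rewrite !mxE !el.
Qed.

Lemma tdet_inj (A : comNzRingType) m n (f : 'I_m -> 'I_n)
    (W : 'I_n -> 'I_n -> A) (U : {set 'I_m}) r (x : 'I_n -> A) : injective f ->
  tdet W (f @: U) (f r) x = tdet (fun t u => W (f t) (f u)) U r (x \o f).
Proof.
move=> f_inj; have memf t (Z : {set 'I_m}) : (f t \in f @: Z) = (t \in Z).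
  by rewrite mem_imset.
rewrite /tdet (det_mxsub_inj f_inj) => [|i j fi]; last first.
  rewrite mxE ifN //; apply: contra fi => /setD1P[_ /imsetP[t _ ->]].
  exact: codom_f.
congr (\det _); apply/matrixP => t j; rewrite !mxE !in_setD1 !memf !(inj_eq f_inj).
case: ifP => // _; rewrite /lap memf (inj_eq f_inj); congr (_ * _ - _).
by rewrite big_imset //= => a b _ _; exact: f_inj.
Qed.
(** * The matrix-tree theorem *)

Section RootedMaps.
Variables (V : finType) (r : V).
Implicit Types (q : {ffun V -> V}) (t u : V).

(* Spanning trees are encoded by their parent maps towards [r], with [q r = r]. *)
Definition rooted q := (q r == r) && [forall t, fconnect q t r].

Definition parent_edge q t : {set V} := [set t; q t].

Definition parent_edges q : {set {set V}} := parent_edge q @: [set~ r].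

Lemma rooted_ex q t : rooted q -> exists k, iter k q t == r.
Proof.
by case/andP=> _ /forallP/(_ t)/iter_findex <-; exists (findex q t r).
Qed.

Definition depth q (qr : rooted q) t := ex_minn (rooted_ex t qr).

Lemma depth_parent q (qr : rooted q) t : t != r ->
  (depth qr (q t) < depth qr t)%N.
Proof.
move=> tr; rewrite /depth; case: (ex_minnP (rooted_ex t qr)) => m itm _.
case: ex_minnP => k _ kmin; case: m itm => [/= /eqP tr'|m]; first by rewrite tr' eqxx in tr.
by rewrite iterSr => /kmin.
Qed.

Lemma rooted_ind q (P : V -> Prop) : rooted q ->
  P r -> (forall t, t != r -> P (q t) -> P t) -> forall t, P t.
Proof.
move=> qr Pr IH t; have [k] := rooted_ex t qr.
elim: k t => [|k IHk] t; first by move=> /= /eqP ->.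
by rewrite iterSr => /IHk; have [->|/IH] := eqVneq t r.
Qed.

Lemma parent_neq q t : rooted q -> t != r -> q t != t.
Proof.
by move=> qr tr; apply/eqP => qt; have := depth_parent qr tr; rewrite qt ltnn.
Qed.

(** Two distinct vertices with a common parent edge would be each other's parents, which the strict
    decrease of [depth] excludes. *)
Lemma parent_edge_eq q t u : rooted q -> t != r -> u \in [set~ r] ->
  [set t; q t] = parent_edge q u -> t = u.
Proof.
rewrite !inE => qr tr ur E.
have : t \in parent_edge q u by rewrite -E set21.
rewrite !inE => /orP[/eqP//|/eqP tu].
have : u \in [set t; q t] by rewrite E set21.
rewrite !inE => /orP[/eqP//|/eqP ut].
have := depth_parent qr ur; rewrite -tu => tu'.
by have := ltn_trans (depth_parent qr tr); rewrite -ut => /(_ _ tu'); rewrite ltnn.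
Qed.

Lemma parent_edge_inj q : rooted q -> {in [set~ r] &, injective (parent_edge q)}.
Proof. by move=> qr t u; rewrite inE in_set1 => tr ur; exact: parent_edge_eq. Qed.

Lemma mem_parent_edges q t u :
  [set t; u] \in parent_edges q -> (t != r /\ q t = u) \/ (u != r /\ q u = t).
Proof.
case/imsetP => s; rewrite !inE => sr E.
have st : s \in [set t; u] by rewrite E set21.
have tE : t \in parent_edge q s by rewrite -E set21.
have uE : u \in parent_edge q s by rewrite -E set22.
have qst : q s \in [set t; u] by rewrite E set22.
move: st tE uE qst; rewrite !inE.
case/orP=> /eqP sE; subst s.
  move=> _ uE qst; left; split=> //.
  by case/orP: uE => /eqP; [move=> ut; move: qst; rewrite ut orbb => /eqP | ].
move=> tE _ qst; right; split=> //.
by case/orP: tE => /eqP; [move=> tu; move: qst; rewrite -tu orbb => /eqP | ].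
Qed.

(** By induction from the root along [q']: if [q] used the edge from [t] to [q' t] in the other
    direction, [t] would be its own grandparent under [q']. *)
Lemma parent_edges_inj q q' : rooted q -> rooted q' ->
  parent_edges q = parent_edges q' -> q = q'.
Proof.
move=> qr qr' E; apply/ffunP; apply: (rooted_ind qr').
  by have /andP[/eqP-> _] := qr; have /andP[/eqP-> _] := qr'.
move=> t tr IH.
have : [set t; q' t] \in parent_edges q.
  by rewrite E; apply/imsetP; exists t; rewrite ?inE.
case/mem_parent_edges => -[] // q'tr qq't.
have := ltn_trans (depth_parent qr' q'tr) (depth_parent qr' tr).
by rewrite -IH qq't ltnn.
Qed.

Lemma edge_rel_sym (F : {set {set V}}) : ssrbool.symmetric (edge_rel F).
Proof. by move=> x y; rewrite /edge_rel setUC. Qed.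

Lemma parent_edges_connected q : rooted q -> connected_edges (parent_edges q).
Proof.
move=> qr; apply/andP; split; first by apply/card_gt0P; exists r.
have xr x : connect (edge_rel (parent_edges q)) x r.
  move: x; apply: (rooted_ind qr) => [|t tr]; first exact: connect0.
  apply: connect_trans; apply: connect1; apply/imsetP; exists t => //.
  by rewrite !inE.
apply/forallP => x; apply/forallP => y; apply: connect_trans (xr x) _.
by rewrite (sym_connect_sym (edge_rel_sym _)).
Qed.

(** On a cycle, both neighbours of a vertex of maximal depth would have to be its parent, although
    they are distinct. *)
Lemma parent_edges_acyclic q : rooted q -> acyclic_edges (parent_edges q).
Proof.
move=> qr; apply/forallP => k; apply/forallP => c; apply/implyP => k2.
apply/negP => /andP[cc uc].
have sc : (2 < size c)%N by rewrite size_tuple.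
have [x0 x0c] : exists x0, x0 \in (c : seq V).
  by case: (tval c) sc => // x0 s _; exists x0; rewrite mem_head.
have [x xc xmax] : exists2 x, x \in (c : seq V) &
    forall y, y \in (c : seq V) -> (depth qr y <= depth qr x)%N.
  by case: (@arg_maxnP _ x0 (mem c) (depth qr) x0c) => x; exists x.
have nbr y : y \in (c : seq V) -> [set x; y] \in parent_edges q -> q x = y.
  move=> yc /mem_parent_edges[] [] // yr qyx.
  by have := depth_parent qr yr; rewrite qyx ltnNge xmax.
have [i s rotE] := rot_to xc.
have memc y : (y \in (c : seq V)) = (y \in x :: s) by rewrite -rotE mem_rot.
move: cc uc sc; rewrite -(rot_cycle i) -(rot_uniq i) -(size_rot i) rotE.
case: s memc {rotE} => [|y [|z s]] memc //= /andP[xy].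
rewrite rcons_path => /and3P[_ _ lx] /and4P[_ yzs _ _] _.
have yE : q x = y by apply: nbr; rewrite // memc !inE eqxx orbT.
have lE : q x = last z s.
  apply: nbr; first by rewrite memc in_cons [_ \in y :: _]in_cons mem_last !orbT.
  by rewrite setUC; exact: lx.
by move: yzs; rewrite -yE lE mem_last.
Qed.

(** The parent is a neighbour closer to the root; an edge of [F] left over would close the tree path
    between its ends to a cycle. *)
Lemma spanning_tree_parent (F : {set {set V}}) :
    (forall e, e \in F -> #|e| = 2%N) ->
    connected_edges F -> acyclic_edges F ->
  exists2 q, rooted q & parent_edges q = F.
Proof.
move=> F2 /andP[_ /forallP Fc] Fa; set e := edge_rel F in Fc.
(* Walks are tuples, so that the distance to the root is the least index satisfying a boolean
   predicate. *)
have dex t : exists k, [exists p : k.-tuple V, path e t p && (last t p == r)].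
  have /forallP/(_ r)/connectP[p ep rE] := Fc t.
  by exists (size p); apply/existsP; exists (in_tuple p); rewrite ep -rE eqxx.
pose d t := ex_minn (dex t).
have dS t : t != r -> exists s, e t s && (d s < d t)%N.
  move=> tr; rewrite {2}/d; case: ex_minnP => m /existsP[p /andP[ep lp]] _.
  case: m p ep lp => [|m] p; first by rewrite (tuple0 p) /= (negPf tr).
  case/tupleP: p => s p /=.
  move=> /andP[es ep] lp; exists s; rewrite es /d; case: ex_minnP => k _ kmin.
  by apply: kmin; apply/existsP; exists p; rewrite ep.
pose q : {ffun V -> V} :=
  [ffun t => if t == r then r else odflt r [pick s | e t s && (d s < d t)%N]].
have qP t : t != r -> e t (q t) && (d (q t) < d t)%N.
  move=> tr; rewrite ffunE (negPf tr); case: pickP => [s //|none].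
  by have [s] := dS t tr; rewrite none.
have q_r : q r = r by rewrite ffunE eqxx.
have qr : rooted q.
  apply/andP; split; first by rewrite q_r.
  apply/forallP => t; have [m] := ubnP (d t); elim: m t => // m IH t dm.
  have [->|tr] := eqVneq t r; first exact: connect0.
  have /andP[_ dq] := qP t tr.
  apply: connect_trans (IH (q t) (leq_trans dq dm)); exact: fconnect1.
exists q => //.
have qF : parent_edges q \subset F.
  by apply/subsetP => _ /imsetP[t + ->]; rewrite !inE => /qP/andP[].
apply/eqP; rewrite eqEsubset qF /=; apply/subsetP => f fF.
have /eqP/cards2P[x [y [xy fE]]] := F2 f fF.
apply/negPn/negP => fq.
have /andP[_ /forallP/(_ x)/forallP/(_ y)/connectP[p0 ep0 yE0]] := parent_edges_connected qr.
case/shortenP: ep0 yE0 => p ep up _ yE.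
have p2 : (1 < size p)%N.
  case: p ep up yE => [|z [|//]] /=; first by move=> _ _ yx; rewrite yx eqxx in xy.
  by rewrite andbT /edge_rel => xz _ yz; move: fq; rewrite fE yz xz.
have cV : (size (x :: p) < #|V|.+1)%N.
  by rewrite ltnS -(card_uniqP up) max_card.
have /forallP/(_ (Ordinal cV))/forallP/(_ (in_tuple (x :: p)))/implyP/(_ p2) := Fa.
case/negP; apply/andP; split=> //=.
rewrite rcons_path -yE /edge_rel setUC -fE fF andbT.
by apply: sub_path ep => a b; exact: (subsetP qF).
Qed.

Lemma parent_edges_degree q u : rooted q ->
  edge_degree (parent_edges q) u = ((u != r) + #|[set t | (t != r) && (q t == u)]|)%N.
Proof.
move=> qr; pose D := [set t in [set~ r] | u \in parent_edge q t].
have -> : edge_degree (parent_edges q) u = #|D|.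
  rewrite -(card_in_imset (f := parent_edge q) (D := mem D)); last first.
    move=> a b; rewrite !inE => /andP[ar _] /andP[br _].
    by apply: parent_edge_inj; rewrite ?inE.
  apply: eq_card => e; rewrite !inE; apply/andP/imsetP.
    by case=> /imsetP[t tr ->] ut; exists t => //; rewrite in_set tr.
  case=> t; rewrite in_set => /andP[tr ut] ->; split=> //.
  by apply/imsetP; exists t.
rewrite (cardsD1 u); congr (_ + _)%N.
  by rewrite !inE eqxx andbT.
apply: eq_card => t; rewrite !inE [u == t]eq_sym [u == q t]eq_sym.
have [->|tu] /= := eqVneq t u; last by [].
by symmetry; apply/negbTE; apply/negP => /andP[/(parent_neq qr)/negPf->].
Qed.

Lemma rooted_child q : rooted q -> (1 < #|V|)%N ->
  (0 < #|[set t | (t != r) && (q t == r)]|)%N.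
Proof.
move=> qr V1; apply/card_gt0P.
have [t tr] : exists t, t != r.
  by apply/existsP; apply: contraLR V1; rewrite negb_exists -leqNgt => /forallP V1;
     rewrite -(cards1 r) -cardsT subset_leq_card //; apply/subsetP => t _;
     rewrite inE; exact: (negbNE (V1 t)).
move: t tr; apply: (rooted_ind qr) => [|t tr IH _]; first by rewrite eqxx.
have [qt|/IH//] := eqVneq (q t) r.
by exists t; rewrite inE tr qt eqxx.
Qed.

End RootedMaps.
Lemma rootedP (V : finType) (r : V) (q : {ffun V -> V}) :
  reflect (q r = r /\ forall t, exists k, iter k q t = r) (rooted r q).
Proof.
apply: (iffP idP) => [qr|[q_r qk]].
  split=> [|t]; first by have /andP[/eqP] := qr.
  by have [k /eqP kE] := rooted_ex t qr; exists k.
apply/andP; split; first exact/eqP.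
by apply/forallP => t; have [k <-] := qk t; exact: fconnect_iter.
Qed.

Lemma rooted_step (V : finType) (r : V) (q : {ffun V -> V}) t : t != r ->
  fconnect q t r = fconnect q (q t) r.
Proof.
move=> tr; apply/idP/idP; last exact: connect_trans (fconnect1 _ _).
move=> /iter_findex; case: findex => [/= tE|k]; first by rewrite tE eqxx in tr.
by rewrite iterSr => <-; exact: fconnect_iter.
Qed.

(** * Expansion of a minor over parent maps *)

Section FunctionalExpansion.
Variables (A : comNzRingType) (n : nat) (r : 'I_n).

Definition incidence (p : {ffun 'I_n -> 'I_n}) : 'M[A]_n :=
  \matrix_(t, j) ((t == j)%:R - (t != r)%:R * (p t == j)%:R).

(** If some vertex never reaches [r], the indicator of all such vertices is in the kernel. Otherwise
    a permutation sending every [t] to [t] or [p t] is the identity, by induction from the root. *)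
Lemma det_incidence (p : {ffun 'I_n -> 'I_n}) : p r = r ->
  \det (incidence p) = (rooted r p)%:R.
Proof.
move=> p_r; have [pr|pr] := boolP (rooted r p); last first.
  move: pr; rewrite /rooted p_r eqxx /= negb_forall => /existsP[t tr].
  apply: (@det_right_null _ _ _ (fun j => (~~ fconnect p j r)%:R) t); last by rewrite tr.
  move=> s; under eq_bigr do rewrite mxE mulrBl -mulrA.
  rewrite sumrB -mulr_sumr !sum_delta.
  have [->|sr] := eqVneq s r; first by rewrite connect0 /= mul0r subr0.
  by rewrite (rooted_step _ sr) mul1r subrr.
rewrite /determinant (bigD1 (1%g : 'S_n)) //= odd_perm1 expr0 mul1r [X in _ + X]big1 ?addr0.
  rewrite big1 // => t _; rewrite mxE perm1 eqxx.
  have [->|tr] := eqVneq t r; first by rewrite mul0r subr0.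
  by rewrite (negPf (parent_neq pr tr)) mulr0 subr0.
move=> s s1; have [t] : exists t, ~~ ((s t == t) || ((t != r) && (p t == s t))).
  apply/existsP; rewrite -negb_forall; apply: contra s1 => /forallP sP.
  apply/eqP/permP => t; rewrite perm1; move: t; apply: (rooted_ind pr).
    by have := sP r; rewrite eqxx orbF => /eqP.
  move=> t tr spt; have /orP[/eqP//|/andP[_ /eqP pt]] := sP t.
  by move: spt; rewrite pt => /perm_inj.
rewrite negb_or eq_sym => /andP[/negPf st /nandP tP].
rewrite (bigD1 t) //= mxE st sub0r.
suff -> : (t != r)%:R * (p t == s t)%:R = 0 :> A by rewrite oppr0 mul0r mulr0.
by case: tP => /negPf ->; rewrite ?mul0r ?mulr0.
Qed.

(** Row [t] is the sum over possible parents [u] of [W t u * x u] times an incidence row; expanding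
    all rows at once gives a sum over maps, of which only the rooted ones survive. *)
Lemma tdet_functional (W : 'I_n -> 'I_n -> A) x :
  tdet W setT r x = \sum_(p : {ffun 'I_n -> 'I_n} | rooted r p)
                      \prod_(t | t != r) (W t (p t) * x (p t)).
Proof.
pose c t u : A := if t == r then (u == r)%:R else W t u * x u.
have MtE t j : lapmx W (setT :\ r) setT x t j =
    \sum_u c t u * ((t == j)%:R - (t != r)%:R * (u == j)%:R).
  rewrite mxE !inE /c; have [->|tr] /= := eqVneq t r.
    under eq_bigr do rewrite mul0r subr0.
    by rewrite -mulr_suml (bigD1 r) //= eqxx big1 ?addr0 ?mul1r // => u /negPf ->.
  under eq_bigr do rewrite mul1r mulrBr.
  rewrite sumrB -mulr_suml mulrC /lap !inE mul1r; congr (_ * _ - _).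
    by apply: eq_bigl => u; rewrite inE.
  rewrite (bigD1 j) //= eqxx mulr1 big1 ?addr0 // => u /negPf ->.
  by rewrite mulr0.
rewrite /tdet /determinant.
under eq_bigr => s _ do under eq_bigr => t _ do rewrite MtE.
under eq_bigr => s _ do rewrite bigA_distr_bigA mulr_sumr.
rewrite exchange_big /= [RHS]big_mkcond /=; apply: eq_bigr => p _.
under eq_bigr => s _ do rewrite big_split mulrCA.
rewrite -mulr_sumr.
have [p_r|p_r] := eqVneq (p r) r; last first.
  rewrite (bigD1 r) //= {1}/c eqxx (negPf p_r) !mul0r.
  by rewrite /rooted (negPf p_r).
transitivity ((\prod_t c t (p t)) * \det (incidence p)).
  congr (_ * _); apply: eq_bigr => s _; congr (_ * _).
  by apply: eq_bigr => t _; rewrite mxE.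
rewrite det_incidence //; case: (rooted r p); last by rewrite mulr0.
rewrite mulr1 (bigD1 r) //= {1}/c eqxx p_r eqxx mul1r.
by apply: eq_bigr => t /negPf tr; rewrite /c tr.
Qed.

End FunctionalExpansion.

(** * The spanning tree polynomial as a Laplacian minor *)

Section MatrixTree.
Variables (R : realType) (G : sgraph) (w : weighting R G).

Definition adj_weight (x y : G) : R :=
  if [set x; y] \in edges G then w [set x; y] else 0.

Definition ord_weight (i j : 'I_#|G|) : R := adj_weight (enum_val i) (enum_val j).

Lemma adj_weight_sym x y : adj_weight x y = adj_weight y x.
Proof. by rewrite /adj_weight setUC. Qed.

Lemma ord_weight_sym i j : ord_weight i j = ord_weight j i.
Proof. exact: adj_weight_sym. Qed.

Lemma tdet_vertices (v : G) (x : 'I_#|G| -> R[i]) :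
  tdet (fun i j => (ord_weight i j)%:C%C) setT (enum_rank v) x =
  \sum_(q : {ffun G -> G} | rooted v q)
     \prod_(t | t != v) ((adj_weight t (q t))%:C%C * x (enum_rank (q t))).
Proof.
rewrite tdet_functional.
pose f (q : {ffun G -> G}) : {ffun 'I_#|G| -> 'I_#|G|} :=
  [ffun i => enum_rank (q (enum_val i))].
pose g (p : {ffun 'I_#|G| -> 'I_#|G|}) : {ffun G -> G} :=
  [ffun t => enum_val (p (enum_rank t))].
have fg : cancel f g by move=> q; apply/ffunP => t; rewrite !ffunE !enum_rankK.
have gf : cancel g f by move=> p; apply/ffunP => t; rewrite !ffunE !enum_valK.
rewrite (reindex f) /=; last by exists g => ? _; [exact: fg | exact: gf].
have iterf q k i : iter k (f q) i = enum_rank (iter k q (enum_val i)).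
  by elim: k => [|k IH] /=; rewrite ?enum_valK // IH ffunE enum_rankK.
apply: eq_big => [q|q _].
  apply/rootedP/rootedP => -[fr fk]; split.
  - by move: fr; rewrite ffunE enum_rankK => /enum_rank_inj.
  - move=> t; have [k] := fk (enum_rank t).
    by rewrite iterf enum_rankK => /enum_rank_inj; exists k.
  - by rewrite ffunE enum_rankK fr.
  - by move=> i; have [k kE] := fk (enum_val i); exists k; rewrite iterf kE.
rewrite (reindex (@enum_rank G)) /=; last first.
  by exists (@enum_val _ _) => ? _; [exact: enum_rankK | exact: enum_valK].
apply: eq_big => [t|t _]; first by rewrite (inj_eq enum_rank_inj).
by rewrite ffunE enum_rankK /ord_weight !enum_rankK.
Qed.

Lemma tree_poly_eval (x : 'I_#|G| -> R[i]) :
  (map_mpoly (real_complex R) (tree_poly w)).@[x] =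
  \sum_(T in spanning_trees G) (\prod_(e in T) (w e)%:C%C) *
     \prod_(v : G) x (enum_rank v) ^+ (edge_degree T v).-1.
Proof.
rewrite /tree_poly (rmorph_sum (map_mpoly (real_complex R))) rmorph_sum /=.
apply: eq_bigr => T _; rewrite map_mpolyZ mevalZ; congr (_ * _).
  by rewrite (rmorph_prod (real_complex R)).
rewrite (rmorph_prod (map_mpoly (real_complex R))) rmorph_prod /=.
apply: eq_bigr => v _.
rewrite (rmorphXn (map_mpoly (real_complex R))) rmorphXn /=.
by rewrite map_mpolyX mevalXU.
Qed.

(** A vertex other than the root has one more edge than children. Grouping the factors by parent
    thus produces the exponents [deg - 1], with one factor [x v] in excess at the root. *)
Lemma matrix_tree (v : G) (x : 'I_#|G| -> R[i]) : (1 < #|G|)%N ->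
  x (enum_rank v) * (map_mpoly (real_complex R) (tree_poly w)).@[x] =
  tdet (fun i j => (ord_weight i j)%:C%C) setT (enum_rank v) x.
Proof.
move=> G1; rewrite tdet_vertices tree_poly_eval mulr_sumr.
pose good (q : {ffun G -> G}) :=
  rooted v q && [forall t, (t != v) ==> ([set t; q t] \in edges G)].
have goodE : spanning_trees G = [set parent_edges v q | q in good].
  apply/setP => T; rewrite inE; apply/and3P/imsetP => [[TG Tc Ta]|].
    have [q qr qT] := @spanning_tree_parent _ v T
      (fun e eT => edges_card (subsetP TG e eT)) Tc Ta.
    exists q => //; apply/andP; split=> //.
    apply/forallP => t; apply/implyP => tv; apply: (subsetP TG).
    by rewrite -qT; apply/imsetP; exists t; rewrite ?inE.
  case=> q /andP[qr /forallP qG ->]; split.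
  - by apply/subsetP => e /imsetP[t + ->]; rewrite !inE => tv; have /implyP := qG t; exact.
  - exact: parent_edges_connected.
  - exact: parent_edges_acyclic.
rewrite goodE big_imset /=; last first.
  by move=> q q' /andP[qr _] /andP[qr' _]; exact: parent_edges_inj qr qr'.
rewrite [RHS](bigID good) /= [X in _ = _ + X]big1 ?addr0; last first.
  move=> q /andP[qr]; rewrite negb_and qr /= negb_forall => /existsP[t].
  rewrite negb_imply => /andP[tv tG].
  by rewrite (bigD1 t) //= /adj_weight (negPf tG) !mul0r.
apply: eq_big => [q|q]; first by rewrite unfold_in /good andbA andbb.
move=> /andP[qr /forallP qG].
rewrite big_split /= big_imset /=; last exact: parent_edge_inj.
rewrite mulrCA; congr (_ * _).
  apply: eq_big => [t|t]; first by rewrite !inE.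
  by rewrite !inE => tv; rewrite /adj_weight (implyP (qG t) tv).
rewrite [RHS](partition_big q predT) //= [in LHS](bigD1 v) //= [RHS](bigD1 v) //= mulrA.
congr (_ * _).
  (* The root has a child as there are two vertices, so the truncated predecessor loses nothing. *)
  rewrite parent_edges_degree // eqxx add0n -exprS prednK ?rooted_child //.
  rewrite -prodr_const; apply: eq_big => [t|t]; first by rewrite inE.
  by rewrite inE => /andP[_ /eqP->].
apply: eq_bigr => u uv; rewrite parent_edges_degree // uv add1n /=.
rewrite -prodr_const; apply: eq_big => [t|t]; first by rewrite inE.
by rewrite inE => /andP[_ /eqP->].
Qed.

End MatrixTree.

(** * Reducible weights *)

Section Splits.
Variables (R : realFieldType) (V : finType) (W : V -> V -> R).
Hypothesis W_sym : forall x y, W x y = W y x.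
Hypothesis W_ge0 : forall x y, 0 <= W x y.
Implicit Types (U X A C : {set V}).

(** Connectedness is expressed through cuts: adding, deleting and merging vertices then requires
    crossing edges, never paths. *)
Definition conn U := U != set0 /\
  forall X, X \subset U -> X != set0 -> X != U ->
    exists x y, [/\ x \in X, y \in U, y \notin X & W x y != 0].

(* With [mu = 0] this says that [a] is pendant at [b] or isolated in [U]. *)
Definition dep U a b mu := forall t, t \in U -> t != a -> t != b -> W t a = mu * W t b.

(* A vertex attached to [U] with the weights [beta] sits in the middle of the
   split [A | U :\: A], whose cut matrix has rank one. *)
Definition midsplit U (beta : V -> R) := exists A theta eta,
  [/\ A \subset U, A != set0, A != U, 0 <= eta &
      (forall t u, t \in A -> u \in U :\: A -> W t u = beta t * theta u) /\
      (forall u, u \in U :\: A -> beta u = eta * theta u)].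

Inductive reducible : {set V} -> Prop :=
| reducible1 r : reducible [set r]
| reducibleS U a b mu : reducible U -> a \notin U -> b \in U -> 0 <= mu ->
    dep U a b mu -> (exists2 t, t \in U & W t a != 0) -> reducible (a |: U).

Lemma conn_flip U : U != set0 ->
  (forall X, X \subset U -> X != set0 -> X != U ->
     (exists x y, [/\ x \in X, y \in U, y \notin X & W x y != 0]) \/
     (exists x y, [/\ x \in U :\: X, y \in U, y \in X & W x y != 0])) -> conn U.
Proof.
move=> U0 H; split=> // X XU X0 XnU; case: (H X XU X0 XnU) => // -[x [y [xX yU yX Wxy]]].
by exists y, x; move: xX; rewrite inE W_sym => /andP[].
Qed.

Lemma conn1 r : conn [set r].
Proof.
split; first by apply/set0Pn; exists r; rewrite inE.
by move=> X; rewrite subset1 => /orP[/eqP->|/eqP->]; rewrite eqxx.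
Qed.

Lemma conn_grow C x y : conn C -> x \in C -> W x y != 0 -> conn (y |: C).
Proof.
move=> [C0 Cc] xC Wxy; apply: conn_flip => [|X XC X0 XnC].
  by apply/set0Pn; exists y; rewrite setU11.
have [XC0|XC0] := eqVneq (X :&: C) set0.
  have [z zX] := set0Pn _ X0.
  have zy : z = y.
    have := subsetP XC z zX; rewrite !inE => /orP[/eqP//|zC].
    by have : z \in X :&: C; [rewrite inE zX | rewrite XC0 inE].
  left; exists y, x; rewrite -{1}zy zX !inE xC orbT W_sym; split=> //.
  by apply/negP => xX; have : x \in X :&: C; [rewrite inE xX | rewrite XC0 inE].
have [XCC|XCC] := eqVneq (X :&: C) C.
  have CX : C \subset X by rewrite -XCC subsetIl.
  have yX : y \notin X.
    apply: contra XnC => yX; rewrite eqEsubset XC /=.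
    by apply/subsetP => z; rewrite !inE => /orP[/eqP->//|/(subsetP CX)].
  by left; exists x, y; rewrite (subsetP CX) // setU11.
have [a [b [aXC bC bXC Wab]]] := Cc _ (subsetIr X C) XC0 XCC.
left; exists a, b; move: aXC bXC; rewrite !inE bC andbT orbT => /andP[-> _] ->.
by split.
Qed.

(** Adding adjacent vertices keeps [C] connected until a single vertex of [U] is missing; that one
    is deleted. *)
Lemma conn_del_outside C U : conn C -> conn U -> C \proper U ->
  exists v, [/\ v \in U, v \notin C & conn (U :\ v)].
Proof.
move=> Cc Uc; have [m] := ubnP (#|U| - #|C|)%N; elim: m C Cc => // m IH C Cc Um CU.
have CnU : C != U by apply: contraTneq CU => ->; rewrite properxx.
have [x [y [xC yU yC Wxy]]] := Uc.2 C (proper_sub CU) Cc.1 CnU.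
have yCU : y |: C \subset U by rewrite subUset sub1set yU proper_sub.
have yCc := conn_grow Cc xC Wxy.
have [yCE|yCE] := eqVneq (y |: C) U.
  by exists y; rewrite yU yC -yCE setU1K.
have yCp : y |: C \proper U by rewrite properEneq yCE.
have [|//|v [vU vyC vc]] := IH _ yCc.
  rewrite -ltnS; apply: leq_trans Um; rewrite ltnS cardsU1 yC add1n.
  by apply: ltn_sub2l; rewrite ?proper_card.
by exists v; split=> //; apply: contra vyC; rewrite !inE orbC => ->.
Qed.

Lemma conn_del_avoid U z : conn U -> z \in U -> (1 < #|U|)%N ->
  exists v, [/\ v \in U, v != z & conn (U :\ v)].
Proof.
move=> Uc zU U1; have zp : [set z] \proper U.
  by rewrite properEcard sub1set zU cards1.
have [v [vU vz vc]] := conn_del_outside (conn1 z) Uc zp.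
by exists v; rewrite -in_set1.
Qed.

(** Every neighbour of [a] in [U] other than [b] is a neighbour of [b], so [b] can replace [a] in
    any crossing edge. *)
Lemma conn_del_dep U a b mu : conn U -> a \in U -> b \in U -> a != b ->
  dep U a b mu -> conn (U :\ a).
Proof.
move=> [U0 Uc] aU bU ab d; have nz t : t \in U -> t != a -> t != b -> W a t != 0 -> W b t != 0.
  move=> tU ta tb; rewrite W_sym (d t) // => H; rewrite W_sym.
  by apply: contraNneq H => ->; rewrite mulr0.
split=> [|X XU X0 XnU]; first by apply/set0Pn; exists b; rewrite !inE eq_sym ab.
have XUa t : t \in X -> t != a /\ t \in U by move/(subsetP XU); rewrite !inE => /andP[].
have aX : a \notin X by apply/negP => /XUa[]; rewrite eqxx.
have [bX|bX] := boolP (b \in X).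
  have [||| x [y [xX yU yX Wxy]]] := Uc (a |: X).
  - by apply/subsetP => t; rewrite !inE => /orP[/eqP->//|/XUa[]].
  - by apply/set0Pn; exists a; rewrite setU11.
  - by apply: contra XnU => /eqP <-; rewrite setU1K.
  move: yX xX; rewrite !inE negb_or => /andP[ya yX] /orP[/eqP xa|xX].
    exists b, y; split=> //; first by rewrite !inE ya.
    by apply: nz => //; [apply: contraNneq yX => -> | rewrite -xa].
  by exists x, y; rewrite !inE ya.
have [||| x [y [xX yU yX Wxy]]] := Uc X.
- by apply/subsetP => t /XUa[].
- by [].
- by apply: contraNneq bX => ->.
have [ya|ya] := eqVneq y a; last by exists x, y; rewrite !inE ya.
exists x, b; rewrite !inE [b == a]eq_sym ab; split=> //.
have [xa xU] := XUa x xX; rewrite W_sym; apply: nz => //.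
  by apply: contraNneq bX => <-.
by rewrite W_sym -ya.
Qed.

Section MidSplit.
Variables (U : {set V}) (v : V) (A : {set V}) (theta : V -> R) (eta : R).
Hypotheses (vU : v \notin U) (Uc : conn U) (vUc : conn (v |: U)).
Hypotheses (AU : A \subset U) (A0 : A != set0) (AnU : A != U) (eta0 : 0 <= eta).
Hypothesis rk : forall t u, t \in A -> u \in U :\: A -> W t u = W v t * theta u.
Hypothesis prop : forall u, u \in U :\: A -> W v u = eta * theta u.

Lemma midsplit_edge : exists a b,
  [/\ a \in A, b \in U :\: A, 0 < W v a & 0 < theta b].
Proof.
have [a [b [aA bU bA Wab]]] := Uc.2 A AU A0 AnU.
have bB : b \in U :\: A by rewrite inE bA.
have va : 0 < W v a.
  by rewrite lt_def W_ge0 andbT; apply: contraNneq Wab => va; rewrite rk // va mul0r.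
exists a, b; split=> //; rewrite -(pmulr_rgt0 _ va) -rk //.
by rewrite lt_def W_ge0 Wab.
Qed.

(** A vertex of [A] with an edge to [v] or to the other side has a nonzero weight to [v], hence an
    edge to [b], which stands in for all of them. *)
Lemma midsplit_conn_left b : b \in U :\: A -> theta b != 0 -> conn (b |: A).
Proof.
move=> bB thb; have [bU bA] := setDP bB.
have side X : X \subset A -> X != set0 ->
    exists x y, [/\ x \in X, y \in b |: A, y \notin X & W x y != 0].
  move=> XA X0; have [||| x [y [xX + yX Wxy]]] := vUc.2 X.
  - by apply/subsetP => t /(subsetP XA)/(subsetP AU); rewrite !inE orbC => ->.
  - by [].
  - by apply: contraNneq vU => XE; apply: (subsetP AU); apply: (subsetP XA); rewrite XE setU11.
  have xA := subsetP XA x xX.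
  have via : W v x != 0 -> exists x y, [/\ x \in X, y \in b |: A, y \notin X & W x y != 0].
    move=> vx; exists x, b; rewrite setU11 rk // mulf_neq0 //; split=> //.
    by apply: contra bA => /(subsetP XA).
  rewrite !inE => /orP[/eqP yv|yU]; first by apply: via; rewrite W_sym -yv.
  have [yA|yA] := boolP (y \in A); first by exists x, y; rewrite !inE yA orbT.
  by apply: via; apply: contraNneq Wxy => vx; rewrite rk ?vx ?mul0r // inE yA.
apply: conn_flip => [|X XbA X0 XnbA]; first by apply/set0Pn; exists b; rewrite setU11.
have [bX|bX] := boolP (b \in X); [right|left].
  have [|| x [y [xX yA yX Wxy]]] := side ((b |: A) :\: X).
  - apply/subsetP => t; rewrite !inE => /andP[tX /orP[/eqP tb|//]].
    by rewrite tb bX in tX.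
  - by rewrite setD_eq0; apply: contra XnbA => bAX; rewrite eqEsubset XbA.
  by exists x, y; move: yX; rewrite in_setD yA andbT negbK.
apply: side => //; apply/subsetP => t tX; have := subsetP XbA t tX.
by rewrite !inE => /orP[/eqP tb|//]; rewrite tb in tX; rewrite tX in bX.
Qed.

Lemma midsplit_conn_right a : a \in A -> W v a != 0 -> conn (a |: (U :\: A)).
Proof.
move=> aA va; set B := U :\: A.
have Bnz u : u \in B -> theta u != 0 -> W u a != 0.
  by move=> uB thu; rewrite W_sym rk // mulf_neq0.
have side X : X \subset B -> X != set0 ->
    exists x y, [/\ x \in X, y \in a |: B, y \notin X & W x y != 0].
  move=> XB X0; have [||| x [y [xX + yX Wxy]]] := vUc.2 X.
  - by apply/subsetP => t /(subsetP XB); rewrite !inE => /andP[_ ->]; rewrite orbT.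
  - by [].
  - apply: contraNneq vU => XE; have : v \in B by apply: (subsetP XB); rewrite XE setU11.
    by rewrite inE => /andP[].
  have xB := subsetP XB x xX.
  have via : theta x != 0 -> exists x y, [/\ x \in X, y \in a |: B, y \notin X & W x y != 0].
    move=> thx; exists x, a; rewrite setU11 Bnz //; split=> //.
    by apply/negP => /(subsetP XB); rewrite inE aA.
  rewrite !inE => /orP[/eqP yv|yU].
    by apply: via; apply: contraNneq Wxy => thx; rewrite yv W_sym prop // thx mulr0.
  have [yA|yA] := boolP (y \in A); last by exists x, y; rewrite !inE yA yU orbT.
  by apply: via; apply: contraNneq Wxy => thx; rewrite W_sym rk // thx mulr0.
apply: conn_flip => [|X XaB X0 XnaB]; first by apply/set0Pn; exists a; rewrite setU11.
have [aX|aX] := boolP (a \in X); [right|left].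
  have [|| x [y [xX yB yX Wxy]]] := side ((a |: B) :\: X).
  - apply/subsetP => t; rewrite in_setD in_setU1 => /andP[tX /orP[/eqP ta|//]].
    by rewrite ta aX in tX.
  - by rewrite setD_eq0; apply: contra XnaB => aBX; rewrite eqEsubset XaB.
  by exists x, y; move: yX; rewrite in_setD yB andbT negbK.
apply: side => //; apply/subsetP => t tX; have := subsetP XaB t tX.
by rewrite in_setU1 => /orP[/eqP ta|//]; rewrite ta in tX; rewrite tX in aX.
Qed.

(** The cut rows of [a] and [b] are multiples of one vector, so the relation read at the single
    vertex [s] extends to [v] and to the whole other side. *)
Lemma midsplit_dep_left a b s mu : a \in A -> b \in A ->
    s \in U :\: A -> theta s != 0 ->
  dep (s |: A) a b mu -> dep (v |: U) a b mu.
Proof.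
move=> aA bA sB ths d; have [sU sA] := setDP sB.
have vE : W v a = mu * W v b.
  apply: (mulIf ths); rewrite -mulrA -(rk aA sB) -(rk bA sB) (W_sym a) (W_sym b) d ?setU11 //.
    by apply: contraNneq sA => ->.
  by apply: contraNneq sA => ->.
move=> t; rewrite in_setU1 => /orP[/eqP-> _ _ //|tU] ta tb.
have [tA|tA] := boolP (t \in A); first by apply: d => //; rewrite !inE tA orbT.
have tB : t \in U :\: A by rewrite inE tA.
by rewrite (W_sym t a) (W_sym t b) (rk aA tB) (rk bA tB) vE mulrA.
Qed.

Lemma midsplit_dep_right a b s mu : a \in U :\: A -> b \in U :\: A ->
    s \in A -> W v s != 0 ->
  dep (s |: (U :\: A)) a b mu -> dep (v |: U) a b mu.
Proof.
move=> aB bB sA vs d.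
have sne t : t \in U :\: A -> s != t by case/setDP => _; apply: contraNneq => <-.
have thE : theta a = mu * theta b.
  by apply: (mulfI vs); rewrite mulrCA -(rk sA aB) -(rk sA bB) d ?setU11 // sne.
move=> t; rewrite in_setU1 => /orP[/eqP->|tU] ta tb.
  by rewrite (prop aB) (prop bB) thE mulrCA.
have [tA|tA] := boolP (t \in A); first by rewrite (rk tA aB) (rk tA bB) thE mulrCA.
by apply: d => //; rewrite !inE tA tU orbT.
Qed.

(** A side reduced to one vertex contains no pair, but then [v] itself is a scaled twin of that
    vertex or pendant at it. *)
Lemma midsplit_single_left a : A = [set a] -> W v a != 0 ->
  dep (v |: U) v a (eta / W v a).
Proof.
move=> AE va t; rewrite in_setU1 => /orP[/eqP->|tU]; first by rewrite eqxx.
move=> _ ta; have tB : t \in U :\: A by rewrite AE !inE ta.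
have aA : a \in A by rewrite AE inE.
by rewrite (W_sym t v) (prop tB) (W_sym t a) (rk aA tB) mulrA divfK.
Qed.

Lemma midsplit_single_right b : U :\: A = [set b] -> theta b != 0 ->
  dep (v |: U) v b (theta b)^-1.
Proof.
move=> BE thb t; rewrite in_setU1 => /orP[/eqP->|tU]; first by rewrite eqxx.
move=> _ tb; have bB : b \in U :\: A by rewrite BE inE.
have tA : t \in A.
  by apply: contraNT tb => tA; rewrite -in_set1 -BE inE tA.
by rewrite (W_sym t v) (rk tA bB) mulrC mulfK.
Qed.

End MidSplit.

(** Abstracted from stability: [good] has to pass to connected deletions and to supply splits. *)
Lemma reducible_of_midsplits (good : {set V} -> Prop) :
    (forall U v, v \notin U -> conn U -> conn (v |: U) -> good (v |: U) -> good U) ->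
    (forall U v, v \notin U -> conn U -> conn (v |: U) -> good (v |: U) ->
       (1 < #|U|)%N -> reducible U -> midsplit U (W v)) ->
  forall U, conn U -> good U -> reducible U.
Proof.
move=> good_del good_mid.
have good_sub C U : conn C -> conn U -> C \subset U -> good U -> good C.
  move=> Cc; have [m] := ubnP #|U|; elim: m U => // m IH U Um Uc CU gU.
  have [->//|CnU] := eqVneq C U.
  have Cp : C \proper U by rewrite properEneq CnU.
  have [v [vU vC vc]] := conn_del_outside Cc Uc Cp.
  apply: (IH (U :\ v)) => //.
  - by move: Um; rewrite (cardsD1 v U) vU.
  - by rewrite subsetD1 CU.
  by apply: (good_del _ v); rewrite ?setD1K // !inE eqxx.
(* The added clause lets a pair avoid any given [z]: a pair lifts from one side of a split only if
   it avoids the vertex representing the other side. *)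
suff main U : conn U -> good U -> reducible U /\ ((2 < #|U|)%N -> forall z, z \in U ->
    exists a b mu, [/\ a \in U :\ z, b \in U :\ z, a != b, 0 <= mu & dep U a b mu]).
  by move=> U Uc gU; case: (main U Uc gU).
have [m] := ubnP #|U|; elim: m U => // m IH U Um Uc gU.
have pairs : (2 < #|U|)%N -> forall z, z \in U ->
    exists a b mu, [/\ a \in U :\ z, b \in U :\ z, a != b, 0 <= mu & dep U a b mu].
  move=> U2 z zU; have [v [vU vz vc]] := conn_del_avoid Uc zU (ltnW U2).
  set U0 := U :\ v in vc; have UE : v |: U0 = U by rewrite setD1K.
  have vU0 : v \notin U0 by rewrite !inE eqxx.
  have cU : #|U| = #|U0|.+1 by rewrite -UE cardsU1 vU0.
  have U0m : (#|U0| < m)%N by rewrite cU in Um.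
  have Uc' := Uc; have gU' := gU; rewrite -UE in Uc' gU'.
  have gU0 := good_del _ _ vU0 vc Uc' gU'.
  have [|A [th [eta [AU A0 AnU eta0 [rk prop]]]]] :=
    good_mid U0 v vU0 vc Uc' gU' _ (IH U0 U0m vc gU0).1.
    by rewrite cU in U2.
  have [a [b [aA bB va thb]]] := midsplit_edge vc AU A0 AnU rk.
  have va0 := lt0r_neq0 va; have thb0 := lt0r_neq0 thb.
  have [bU0 bA] := setDP bB; have aU0 := subsetP AU a aA.
  have inU t : t \in U0 -> t \in U by rewrite inE => /andP[].
  (* The pair is sought on the side without [z], completed by one vertex of the side of [z]. *)
  have [zA|zA] := boolP (z \in A).
    have [B1|B1] := eqVneq (U0 :\: A) [set b].
      have bz : b != z by apply: contraNneq bA => ->.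
      have vb : v != b by apply: contraNneq vU0 => ->.
      exists v, b, (th b)^-1; rewrite !inE vz vU bz (inU b) // invr_ge0 ltW //.
      split=> //; by have := midsplit_single_right rk B1 thb0; rewrite UE.
    have cc := midsplit_conn_right vU0 Uc' rk prop aA va0.
    have sub : a |: (U0 :\: A) \subset U.
      by rewrite subUset sub1set inU //=; apply/subsetP => t /setDP[/inU].
    have pr : (#|a |: (U0 :\: A)| <= #|U0|)%N.
      by apply: subset_leq_card; rewrite subUset sub1set aU0 subsetDl.
    have aB : a \notin U0 :\: A by rewrite inE aA.
    have [|| x [y [mu [xB yB xy mu0 d]]]] := (IH _ (leq_ltn_trans pr U0m) cc (good_sub _ _ cc Uc sub gU)).2 _ a.
    - rewrite cardsU1 aB add1n ltnS ltnNge; apply: contra B1 => B1.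
      by rewrite eq_sym eqEcard sub1set bB cards1.
    - by rewrite setU11.
    move: xB yB; rewrite setU1K // => xB yB.
    exists x, y, mu; rewrite !inE; split=> //.
    - by have [xU xA] := setDP xB; rewrite inU // andbT; apply: contraNneq xA => ->.
    - by have [yU yA] := setDP yB; rewrite inU // andbT; apply: contraNneq yA => ->.
    by have := midsplit_dep_right rk prop xB yB aA va0 d; rewrite UE.
  have [A1|A1] := eqVneq A [set a].
    have az : a != z by apply: contraNneq zA => <-.
    have va' : v != a by apply: contraNneq vU0 => ->.
    exists v, a, (eta / W v a); rewrite !inE vz vU az (inU a) // divr_ge0 // ?ltW //.
    split=> //; by have := midsplit_single_left rk prop A1 va0; rewrite UE.
  have cc := midsplit_conn_left vU0 Uc' AU rk bB thb0.
  have sub : b |: A \subset U.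
    by rewrite subUset sub1set inU //=; apply/subsetP => t /(subsetP AU)/inU.
  have pr : (#|b |: A| <= #|U0|)%N.
    by apply: subset_leq_card; rewrite subUset sub1set bU0 AU.
  have [|| x [y [mu [xB yB xy mu0 d]]]] := (IH _ (leq_ltn_trans pr U0m) cc (good_sub _ _ cc Uc sub gU)).2 _ b.
  - rewrite cardsU1 bA add1n ltnS ltnNge; apply: contra A1 => A1.
    by rewrite eq_sym eqEcard sub1set aA cards1.
  - by rewrite setU11.
  move: xB yB; rewrite setU1K // => xA yA.
  exists x, y, mu; rewrite !inE; split=> //.
  - by rewrite (inU _ (subsetP AU x xA)) andbT; apply: contraNneq zA => <-.
  - by rewrite (inU _ (subsetP AU y yA)) andbT; apply: contraNneq zA => <-.
  by have := midsplit_dep_left rk xA yA bB thb0 d; rewrite UE.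
split=> //.
have step a b mu : a \in U -> b \in U -> a != b -> 0 <= mu -> dep U a b mu -> reducible U.
  move=> aU bU ab mu0 d; have ac := conn_del_dep Uc aU bU ab d.
  have UE : a |: (U :\ a) = U by rewrite setD1K.
  have aUa : a \notin U :\ a by rewrite !inE eqxx.
  rewrite -UE; apply: (@reducibleS _ a b mu) => //.
  - apply: (IH (U :\ a) _ ac _).1.
      by move: Um; rewrite (cardsD1 a U) aU.
    by apply: (good_del _ a); rewrite ?UE.
  - by rewrite !inE eq_sym ab.
  - by move=> t /setD1P[_]; exact: d.
  have [||| x [y [xX yU yX Wxy]]] := Uc.2 (U :\ a).
  - by rewrite subsetDl.
  - exact: ac.1.
  - by apply: contraNneq aUa => ->.
  exists x => //; suff <- : y = a by [].
  by apply/eqP; move: yX; rewrite !inE yU andbT negbK.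
have [U2|U2] := ltnP 2 #|U|.
  have [z zU] := set0Pn _ Uc.1.
  have [a [b [mu [/setD1P[_ aU] /setD1P[_ bU] ab mu0 d]]]] := pairs U2 z zU.
  exact: step aU bU ab mu0 d.
have [U1|U1] := leqP #|U| 1.
  have /cards1P[r ->] : #|U| == 1%N by rewrite eqn_leq U1 card_gt0 Uc.1.
  exact: reducible1.
have /eqP/cards2P[a [b [ab UE]]] : #|U| = 2%N by apply/eqP; rewrite eqn_leq U2.
apply: (step a b 0) => //; rewrite ?UE ?set21 ?set22 //.
by move=> t; rewrite !inE => /orP[]/eqP->; rewrite eqxx.
Qed.

End Splits.

(** * Factorisation of the minors of reducible sets into linear forms *)

Section Factorization.
Variables (R : realFieldType) (n : nat) (W : 'I_n -> 'I_n -> R).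
Hypothesis W_sym : forall i j, W i j = W j i.
Hypothesis W_ge0 : forall i j, 0 <= W i j.
Implicit Types (U : {set 'I_n}).

(* The identity is stated over every [R]-algebra, since it is used for real,
   complex and polynomial values of [x]. *)
Definition factored U := exists (C : R) (ls : seq {ffun 'I_n -> R}),
  [/\ C != 0, (size ls).+2 = #|U|,
      forall l, l \in ls -> [/\ forall t, 0 <= l t, exists2 t, t \in U & l t != 0
                              & midsplit W U l]
    & forall (A : comNzRingType) (h : {rmorphism R -> A}) (x : 'I_n -> A) u,
        u \in U -> tdet (fun i j => h (W i j)) U u x =
                   h C * x u * \prod_(l <- ls) \sum_(t in U) h (l t) * x t].

Lemma factored_root U (C : R) (ls : seq {ffun 'I_n -> R}) u0 : u0 \in U ->
    (forall (A : comNzRingType) (h : {rmorphism R -> A}) (x : 'I_n -> A),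
        tdet (fun i j => h (W i j)) U u0 x =
        h C * x u0 * \prod_(l <- ls) \sum_(t in U) h (l t) * x t) ->
  forall (A : comNzRingType) (h : {rmorphism R -> A}) (x : 'I_n -> A) u,
    u \in U -> tdet (fun i j => h (W i j)) U u x =
               h C * x u * \prod_(l <- ls) \sum_(t in U) h (l t) * x t.
Proof.
move=> u0U H A h x u uU.
(* Perturbing [x u0] to a monic polynomial makes it cancellable over any ring. *)
pose hp : {rmorphism R -> {poly A}} := polyC \o h.
pose xp t : {poly A} := (x t)%:P + (t == u0)%:R * 'X.
have E := tdet_root xp (fun i j => congr1 hp (W_sym i j)) uU u0U.
rewrite H in E.
have reg : GRing.lreg (xp u0).
  rewrite /xp eqxx mul1r addrC; apply: monic_lreg.
  by have := monicXsubC (- x u0); rewrite polyCN opprK.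
have E' : tdet (fun i j => hp (W i j)) U u xp =
          hp C * xp u * \prod_(l <- ls) \sum_(t in U) hp (l t) * xp t.
  by apply: reg; rewrite -E; ring.
pose ev : {rmorphism {poly A} -> A} := horner_eval 0.
have evx t : ev (xp t) = x t.
  by rewrite /ev /= /horner_eval /xp hornerD hornerC hornerM hornerX mulr0 addr0.
have evh y : ev (hp y) = h y by rewrite /ev /= /horner_eval /hp /= hornerC.
have := congr1 ev E'; rewrite tdet_morph !rmorphM /= evx rmorph_prod.
have -> : tdet (fun i j => ev (hp (W i j))) U u (fun t => ev (xp t)) =
          tdet (fun i j => h (W i j)) U u x.
  by apply: tdet_ext => *; rewrite ?evx ?evh.
rewrite evh => ->; congr (_ * _); apply: eq_bigr => l _.
by rewrite rmorph_sum; apply: eq_bigr => t _; rewrite rmorphM /= evx evh.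
Qed.

Lemma factored_pair a b : a != b -> W a b != 0 -> factored (a |: [set b]).
Proof.
move=> ab Wab; exists (W a b), [::]; split=> //.
  by rewrite cardsU1 cards1 inE ab.
have bab : b \in a |: [set b] by rewrite !inE eqxx orbT.
apply: (factored_root bab) => A h x; rewrite big_nil mulr1.
rewrite /tdet (@det_unit_rows_but _ _ a) => [|t j ta]; last first.
  by rewrite mxE !inE (negPf ta) /= andNb.
rewrite mxE !inE eqxx ab /= /lap setU11 eqxx big_setU1 ?inE //= big_set1.
by rewrite !mul1r; ring.
Qed.

(** By [tdet_step] the old forms are read at [x b + mu * x a], whence [up]; the new linear factor is
    [l0], with the weights at [a] on [U] and [mu * W a b] at [a] itself. *)
Lemma factored_step U a b mu : factored U -> a \notin U -> b \in U -> 0 <= mu ->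
  dep W U a b mu -> (exists2 t, t \in U & W t a != 0) -> factored (a |: U).
Proof.
move=> [C [ls [C0 sls lsP detE]]] aU bU mu0 d [t0 t0U Wt0].
have tna t : t \in U -> t != a by apply: contraTneq => ->.
have d' t : t \in U -> t != b -> W t a = mu * W t b.
  by move=> tU; apply: d => //; exact: tna.
pose l0 : {ffun 'I_n -> R} :=
  [ffun t => if t == a then mu * W a b else if t \in U then W a t else 0].
pose up (l : {ffun 'I_n -> R}) : {ffun 'I_n -> R} :=
  [ffun t => if t == a then mu * l b else l t].
have l0U t : t \in U -> l0 t = W a t by move=> tU; rewrite ffunE (negPf (tna t tU)) tU.
have l0a : l0 a = mu * W a b by rewrite ffunE eqxx.
have upU l t : t \in U -> up l t = l t by move=> tU; rewrite ffunE (negPf (tna t tU)).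
have upa l : up l a = mu * l b by rewrite ffunE eqxx.
exists C, (l0 :: map up ls); split=> //.
- by rewrite /= size_map sls cardsU1 aU.
- move=> l; rewrite inE => /orP[/eqP->|/mapP[k kls ->]].
    split.
    + by move=> t; rewrite ffunE; do 2?case: ifP => // _; rewrite ?mulr_ge0.
    + by exists t0; [rewrite inE t0U orbT | rewrite l0U // W_sym].
    have UE : (a |: U) :\: U = [set a].
      by apply/setP => t; rewrite !inE; case: eqP => [->|]; rewrite ?aU //= andNb.
    (* The new form sits in the split of [U] against [a]. *)
    exists U, (fun=> 1), (mu * W a b); rewrite UE; split=> //.
    + by rewrite subsetUr.
    + by apply/set0Pn; exists b.
    + by apply: contraNneq aU => ->; rewrite setU11.
    + by rewrite mulr_ge0.
    split=> [t u tU|u]; rewrite inE => /eqP ->; rewrite mulr1 //.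
    by rewrite l0U // W_sym.
  have [k0 [t tU kt] [A [th [eta [AU A0 AnU eta0 [rk prop]]]]]] := lsP k kls.
  split.
  + by move=> s; rewrite ffunE; case: ifP; rewrite ?mulr_ge0.
  + by exists t; [rewrite inE tU orbT | rewrite upU].
  have aA : a \notin A by apply: contra aU; exact: (subsetP AU).
  (* In an old split [a] joins the side of [b], with [mu] times the data of [b]. *)
  have [bA|bA] := boolP (b \in A).
    have UE : (a |: U) :\: (a |: A) = U :\: A.
      apply/setP => s; rewrite !inE; have [->|//] := eqVneq s a.
      by rewrite (negPf aU) andbF.
    exists (a |: A), th, eta; rewrite UE; split=> //.
    + by rewrite setUS.
    + by apply/set0Pn; exists a; rewrite setU11.
    + by apply: contraNneq AnU => E; rewrite -(setU1K aA) E setU1K.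
    split=> [s u|u uB]; last by rewrite upU ?prop //; case/setDP: uB.
    rewrite in_setU1 => sA uB; have [uU uA] := setDP uB.
    have ub : u != b by apply: contraNneq uA => ->.
    case/orP: sA => [/eqP->|sA]; last by rewrite upU ?rk // (subsetP AU).
    by rewrite upa W_sym d' // W_sym rk // mulrA.
  have bB : b \in U :\: A by rewrite inE bA.
  have UE u : u \in (a |: U) :\: A -> u = a \/ u \in U :\: A.
    by rewrite !inE => /andP[-> /orP[/eqP->|->]]; [left | right].
  exists A, (fun u => if u == a then mu * th b else th u), eta; split=> //.
  + by apply: subset_trans AU _; rewrite subsetUr.
  + by apply: contraNneq aA => ->; rewrite setU11.
  split=> [s u sA /UE[->|uB]|u /UE[->|uB]].
  + have sU := subsetP AU s sA; rewrite eqxx upU // d' ?(rk _ _ sA bB) 1?mulrCA //.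
    by apply: contraNneq bA => <-.
  + have [uU _] := setDP uB; rewrite (negPf (tna u uU)) upU ?rk //.
    exact: (subsetP AU).
  + by rewrite eqxx upa prop // mulrCA.
  have [uU _] := setDP uB; by rewrite (negPf (tna u uU)) upU ?prop.
have [u0 u0U u0b] : exists2 u0, u0 \in U & u0 != b.
  have : (0 < #|U :\ b|)%N by move: sls; rewrite (cardsD1 b) bU; case: #|_|.
  by case/card_gt0P => u; rewrite !inE => /andP[ub uU]; exists u.
apply: (@factored_root _ _ _ u0) => [|A h x]; first by rewrite inE u0U orbT.
rewrite (@tdet_step _ _ _ U a b u0 (h mu)) //; last first.
- by move=> t tU tb; rewrite d' // rmorphM.
- by move=> i j; rewrite W_sym.
rewrite detE // (negPf u0b) big_cons big_map /=.
have -> : \sum_(t in a |: U) h (l0 t) * x t =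
   h mu * (\sum_(t in U | t != b) h (W b t) * x t) + h (W a b) * (x b + h mu * x a).
  rewrite big_setU1 //= l0a (bigD1 b) //= l0U // rmorphM.
  have -> : \sum_(t in U | t != b) h (l0 t) * x t =
            h mu * \sum_(t in U | t != b) h (W b t) * x t.
    rewrite mulr_sumr; apply: eq_bigr => t /andP[tU tb].
    by rewrite l0U // W_sym d' // W_sym rmorphM mulrA.
  by ring.
have E (l : {ffun 'I_n -> R}) : \sum_(t in U) h (l t) * (if t == b then x b + h mu * x a else x t) =
           \sum_(t in a |: U) h (up l t) * x t.
  rewrite big_setU1 //= upa [in RHS](bigD1 b) //= (bigD1 b) //= eqxx upU // rmorphM.
  have -> : \sum_(t in U | t != b) h (l t) * (if t == b then x b + h mu * x a else x t)
          = \sum_(t in U | t != b) h (up l t) * x t.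
    by apply: eq_bigr => t /andP[tU /negPf tb]; rewrite tb upU.
  by ring.
rewrite (eq_bigr _ (fun l _ => E l)).
by ring.
Qed.

Lemma reducible_factored U : reducible W U -> (1 < #|U|)%N -> factored U.
Proof.
elim=> [r|{}U a b mu rU IH aU bU mu0 d [t tU Wta] _]; first by rewrite cards1.
have [U1|U1] := ltnP 1 #|U|; first by apply: factored_step (IH U1) aU bU mu0 d _; exists t.
have UE : U = [set b].
  by apply/esym/eqP; rewrite eqEcard sub1set bU cards1.
move: tU aU; rewrite UE !inE => /eqP tb ab; apply: factored_pair => //.
by rewrite W_sym -tb.
Qed.

End Factorization.

(** * Stability of Laplacian minors *)

Section ComplexPolynomials.
Variable R : realType.
Local Notation C := (R[i])%type.
Local Notation Im := (@complex.Im R).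
Local Notation Re := (@complex.Re R).
Implicit Types (p q : {poly C}) (z s t : C).

Lemma small_mul_eq0 (F : numFieldType) (c K : F) : 0 <= c -> 0 <= K ->
  (forall eps, 0 < eps -> eps <= 1 -> c <= K * eps) -> c = 0.
Proof.
move=> c0 K0 H; apply/eqP; apply: contraT => cn0.
have c_gt0 : 0 < c by rewrite lt_def cn0.
have Kc : 0 < K + c by rewrite ltr_wpDl.
have := H (c / (K + c)); rewrite divr_gt0 // ler_pdivrMr // mul1r lerDr.
move=> /(_ isT K0); rewrite mulrA ler_pdivlMr // mulrC ler_pM2r //.
by rewrite gerDl => /(lt_le_trans c_gt0); rewrite ltxx.
Qed.

Lemma poly_lipschitz0 (F : numFieldType) (p : {poly F}) : exists2 M, 0 <= M &
  forall x, `|x| <= 1 -> `|p.[x] - p.[0]| <= M * `|x|.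
Proof.
elim/poly_ind: p => [|p c [M M0 IH]].
  by exists 0 => // x _; rewrite !horner0 subrr normr0 mul0r.
exists (M + `|p.[0]|); first by rewrite addr_ge0.
move=> x x1; rewrite !hornerD !hornerC !hornerM !hornerX mulr0 add0r addrK.
rewrite normrM ler_wpM2r // -{1}[p.[x]](subrK p.[0]).
apply: le_trans (ler_normD _ _) _; rewrite lerD2r.
by apply: le_trans (IH x x1) _; rewrite -[leRHS]mulr1 ler_wpM2l.
Qed.

(** For positive [rho] the ratio of coefficient [m] to coefficient 0 is, up to sign, an elementary
    symmetric function of the inverse roots; [2 ^+ size rs] bounds its number of terms. *)
Lemma coef_roots_bound (F : numFieldType) (rs : seq F) (rho : F) : 0 <= rho ->
    (forall r, r \in rs -> rho <= `|r|) ->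
  forall m, `|(\prod_(r <- rs) ('X - r%:P))`_m| * rho ^+ m <=
            2 ^+ size rs * `|(\prod_(r <- rs) ('X - r%:P))`_0|.
Proof.
move=> rho0; elim: rs => [|r rs IH] rsP m.
  rewrite big_nil expr0 mul1r !coef1 /= normr1.
  by case: m => [|m]; rewrite /= ?normr1 ?expr0 ?mulr1 // normr0 mul0r ler01.
have rr : rho <= `|r| by apply: rsP; rewrite inE eqxx.
have {}IH := IH (fun x xrs => rsP x (@mem_behead _ (r :: rs) x xrs)).
rewrite big_cons; set q := \prod_(_ <- _) _ in IH *.
have c0 : (('X - r%:P) * q)`_0 = - r * q`_0.
  by rewrite mulrBl coefB coefXM coefCM /= sub0r mulNr.
rewrite c0 normrM normrN /=; set Q := 2 ^+ size rs * `|q`_0|.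
have Q0 : 0 <= Q by rewrite mulr_ge0 // exprn_ge0.
have goal2 : 2 ^+ (size rs).+1 * (`|r| * `|q`_0|) = `|r| * Q + `|r| * Q.
  by rewrite exprS /Q; ring.
rewrite goal2; case: m => [|m].
  rewrite expr0 mulr1 c0 normrM normrN.
  have : `|r| * (`|q`_0| * rho ^+ 0) <= `|r| * Q by rewrite ler_wpM2l.
  by rewrite expr0 mulr1 => /le_trans; apply; rewrite lerDl mulr_ge0.
rewrite mulrBl coefB coefXM coefCM /=.
apply: le_trans (_ : (`|q`_m| + `|r| * `|q`_m.+1|) * rho ^+ m.+1 <= _).
  by rewrite ler_wpM2r ?exprn_ge0 // -normrM ler_normB.
rewrite mulrDl -mulrA lerD ?ler_wpM2l //.
rewrite exprSr mulrA mulrC; apply: le_trans (_ : `|r| * (`|q`_m| * rho ^+ m) <= _).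
  by rewrite ler_wpM2r // mulr_ge0 // exprn_ge0.
by rewrite ler_wpM2l.
Qed.

(** For [s] in the upper half plane all roots in [t] have modulus above [rho], so the coefficient of
    [t ^ 0] controls the others by [coef_roots_bound]. It tends to 0 as [s] does along the imaginary
    axis, and so do they. *)
Lemma hurwitz (g : {poly {poly C}}) (rho : C) : 0 < rho ->
    (forall s t, 0 < Im s -> `|t| <= rho ->
       (map_poly (horner_eval s) g).[t] != 0) ->
    (g`_0).[0] = 0 -> forall m, (g`_m).[0] = 0.
Proof.
move=> rho0 gn0 g00 m.
pose G s := map_poly (horner_eval s) g.
have GE s k : (G s)`_k = (g`_k).[s] by rewrite coef_map.
pose N := size g.
have bound s : 0 < Im s -> `|(g`_m).[s]| * rho ^+ m <= 2 ^+ N * `|(g`_0).[s]|.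
  move=> s0; rewrite -!GE.
  have [rs Gs] := closed_field_poly_normal (G s).
  have Gn0 : G s != 0.
    apply/eqP => Gs0; have := gn0 s 0 s0; rewrite normr0 -/(G s) Gs0 horner0 eqxx.
    by move=> /(_ (ltW rho0)).
  have lc : lead_coef (G s) != 0 by rewrite lead_coef_eq0.
  have rsP r : r \in rs -> rho <= `|r|.
    move=> rrs; rewrite real_leNgt ?normr_real ?gtr0_real //; apply/negP => /ltW rr.
    have := gn0 s r s0 rr; rewrite -/(G s) Gs hornerZ.
    have /rootP -> : root (\prod_(z <- rs) ('X - z%:P)) r by rewrite root_prod_XsubC.
    by rewrite mulr0 eqxx.
  have srs : (size rs <= N)%N.
    have := size_poly N (fun i => (G s)`_i).
    have : size (G s) = (size rs).+1 by rewrite Gs size_scale // size_prod_XsubC.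
    have : (size (G s) <= N)%N by apply: size_poly.
    by move=> + E; rewrite E => /ltnW.
  rewrite Gs !coefZ !normrM -mulrA [leRHS]mulrCA ler_wpM2l //.
  apply: le_trans (coef_roots_bound (ltW rho0) rsP m) _.
  by rewrite ler_wpM2r // ler_eXn2l ?ltr1n.
have [M M0 HM] := poly_lipschitz0 g`_m.
have [M' M'0 HM'] := poly_lipschitz0 g`_0.
suff : `|(g`_m).[0]| * rho ^+ m = 0.
  by move/eqP; rewrite mulf_eq0 expf_eq0 (gt_eqF rho0) andbF orbF normr_eq0 => /eqP.
apply: (@small_mul_eq0 _ _ (2 ^+ N * M' + M * rho ^+ m)).
- by rewrite mulr_ge0 // exprn_ge0 // ltW.
- by rewrite addr_ge0 // mulr_ge0 ?exprn_ge0 // ltW.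
move=> eps eps0 eps1.
have epsE : eps = (Re eps)%:C%C by rewrite RRe_real // gtr0_real.
have eps0' : 0 < Re eps by move: eps0; rewrite ltcE => /andP[].
pose s : C := Complex 0 (Re eps).
have s0 : 0 < Im s by [].
have ns : `|s| = eps.
  by rewrite normc_def /= expr0n add0r sqrtr_sqr gtr0_norm // epsE.
have E1 : `|(g`_m).[0]| <= `|(g`_m).[s]| + M * eps.
  have := HM s; rewrite ns => /(_ eps1) H.
  rewrite -[X in `|X| <= _](subrK (g`_m).[s]) addrC.
  by apply: le_trans (ler_normD _ _) _; rewrite lerD2l distrC.
have E2 : `|(g`_0).[s]| <= M' * eps.
  by have := HM' s; rewrite ns g00 subr0; exact.
apply: le_trans (_ : (`|(g`_m).[s]| + M * eps) * rho ^+ m <= _).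
  by rewrite ler_wpM2r // exprn_ge0 // ltW.
rewrite mulrDl mulrDl lerD //; last by rewrite mulrAC.
apply: le_trans (bound s s0) _; rewrite -mulrA ler_wpM2l // exprn_ge0 //.
Qed.

(** The ratio of the two coefficients is the sum of [-1/r] over the roots, all with [Im r <= 0];
    multiplying by the conjugate instead of dividing also covers the root 0. *)
Lemma Im_coef_ratio p : (forall s, 0 < Im s -> p.[s] != 0) ->
  Im (p`_1 * (p`_0)^*%C) <= 0.
Proof.
move=> pn0; have [rs pE] := closed_field_poly_normal p.
have rsP r : r \in rs -> Im r <= 0.
  move=> rrs; rewrite leNgt; apply/negP => /pn0; rewrite pE hornerZ.
  have /rootP -> : root (\prod_(z <- rs) ('X - z%:P)) r by rewrite root_prod_XsubC.
  by rewrite mulr0 eqxx.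
suff : Im ((\prod_(z <- rs) ('X - z%:P))`_1 * ((\prod_(z <- rs) ('X - z%:P))`_0)^*%C) <= 0.
  rewrite pE !coefZ; move: (_`_1) (_`_0) (lead_coef p) => [a b] [c d] [e f] /=.
  set X := _ + _; set Y := (_ + _ : R) => X0.
  have -> : Y = (e ^+ 2 + f ^+ 2) * X by rewrite /X /Y; ring.
  by rewrite mulr_ge0_le0 // addr_ge0 // sqr_ge0.
elim: rs rsP {pE} => [|r rs IH] rsP.
  by rewrite big_nil !coef1 mul0r /= lexx.
have r0 : Im r <= 0 by apply: rsP; rewrite inE eqxx.
have {}IH := IH (fun x xrs => rsP x (@mem_behead _ (r :: rs) x xrs)).
rewrite big_cons; set q := \prod_(_ <- _) _ in IH *.
rewrite mulrBl !coefB !coefXM !coefCM /= sub0r.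
move: IH r0; case: r {rsP} => a b; move: (q`_1) (q`_0) => [c d] [e f] /= IH b0.
set Y := (_ + _ : R).
have -> : Y = b * (e ^+ 2 + f ^+ 2) + (a ^+ 2 + b ^+ 2) * (c * - f + d * e).
  by rewrite /Y; ring.
have h1 : b * (e ^+ 2 + f ^+ 2) <= 0 by rewrite mulr_le0_ge0 // addr_ge0 ?sqr_ge0.
have h2 : (a ^+ 2 + b ^+ 2) * (c * - f + d * e) <= 0.
  by rewrite mulr_ge0_le0 // addr_ge0 ?sqr_ge0.
by rewrite -[leRHS]addr0 lerD.
Qed.

Lemma Im_real_exp (x : R) k : Im ((x%:C%C) ^+ k) = 0.
Proof. by rewrite -rmorphXn. Qed.

Lemma Im_sum (rs : seq C) : Im (\sum_(z <- rs) z) = \sum_(z <- rs) Im z.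
Proof.
elim: rs => [|r rs IH]; first by rewrite !big_nil.
by rewrite !big_cons -IH; case: r; case: (\sum_(_ <- _) _).
Qed.

(* The roots of [X^k - c] add up to zero and none is real, so one of them lies
   in the upper half plane. *)
Lemma upper_root (k : nat) (c : C) : (1 < k)%N -> Im c != 0 ->
  exists2 z, 0 < Im z & z ^+ k = c.
Proof.
move=> k1 c0; pose p : {poly C} := 'X^k - c%:P.
have sp : size p = k.+1 by rewrite size_XnsubC // ltnW.
have [rs pE] := closed_field_poly_normal p.
have lp : lead_coef p = 1 by rewrite lead_coefXnsubC // ltnW.
rewrite lp scale1r in pE.
have srs : size rs = k.
  by apply: succn_inj; rewrite -(size_prod_XsubC rs id) -pE.
have rsP r : r \in rs -> r ^+ k = c.
  move=> rrs; have : root p r by rewrite pE root_prod_XsubC.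
  by rewrite rootE /p hornerD hornerN hornerC hornerXn subr_eq0 => /eqP.
have s0 : \sum_(z <- rs) z = 0.
  have k0 : k != 0%N by rewrite -lt0n ltnW.
  have := @coefPn_prod_XsubC _ rs; rewrite srs -pE => /(_ k0)/esym/eqP.
  rewrite eqr_oppLR coefB coefXn coefC => /eqP ->.
  case: k k1 {sp srs rsP p pE lp k0} => [|[|k]] //= _.
  by rewrite (ltn_eqF (ltnSn _)) subr0 oppr0.
have [/hasP[z zrs z0]|/hasPn rsN] := boolP (has (fun z => 0 < Im z) rs).
  by exists z => //; exact: rsP.
have allN z : z \in rs -> 0 <= - Im z.
  by move=> /rsN; rewrite -leNgt oppr_ge0.
have : \sum_(z <- rs) (- Im z) == 0.
  by rewrite sumrN -Im_sum s0 /= oppr0.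
rewrite big_seq psumr_eq0 // => /allP all0.
case: rs srs pE rsP s0 rsN allN all0 => [k0|r rs _ _ rsP _ _ _ all0].
  by rewrite -k0 in k1.
have rr : r \in r :: rs by rewrite inE eqxx.
have := all0 r rr; rewrite rr /= oppr_eq0 => /eqP Imr.
have := rsP r rr; case: r Imr {rr all0 rsP} => a b /= -> rE.
by move: c0; rewrite -rE Im_real_exp eqxx.
Qed.

Lemma poly_lim_Im_le0 p : (forall eps : R, 0 < eps -> Im p.[eps%:C%C] <= 0) ->
  Im p.[0] <= 0.
Proof.
move=> pP; rewrite leNgt; apply/negP => p0.
have [M M0 HM] := poly_lipschitz0 p.
suff /eqP : (Im p.[0])%:C%C = 0 :> C by rewrite fmorph_eq0 (gt_eqF p0).
apply: (@small_mul_eq0 _ _ M) => // [|eps eps0 eps1]; first by rewrite ler0c ltW.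
have epsE : eps = (Re eps)%:C%C by rewrite RRe_real // gtr0_real.
have eps0' : 0 < Re eps by move: eps0; rewrite ltcE => /andP[].
have := HM eps; rewrite gtr0_norm // => /(_ eps1); apply: le_trans.
have := pP _ eps0'; rewrite -epsE; move: p.[eps] p.[0] p0 => [a b] [c d] /= d0 b0.
rewrite normc_def lecR /= -[leLHS]gtr0_norm // -sqrtr_sqr ler_wsqrtr //.
rewrite [leRHS](_ : _ = (a - c) ^+ 2 + b ^+ 2 - 2 * (b * d) + d ^+ 2); last by ring.
rewrite lerDr subr_ge0; apply: (@le_trans _ _ 0).
  by rewrite mulr_ge0_le0 // mulr_le0_ge0 // ltW.
by rewrite addr_ge0 ?sqr_ge0.
Qed.

(* Near [0] the quotient [Q / D] behaves like [c t^(k - m.+1)]; if [k < m], its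
   argument sweeps a full turn as [t] crosses the upper half plane, so the
   imaginary part of [Q / D] cannot keep its sign. *)
Lemma pole_order (Q D : {poly R}) (m : nat) (u : {poly R}) :
    D = 'X^(m.+1) * u -> u.[0] != 0 ->
    (forall t : C, 0 < Im t ->
       Im ((map_poly (real_complex R) Q).[t] * ((map_poly (real_complex R) D).[t])^*%C) <= 0) ->
  forall k, (k < m)%N -> Q`_k = 0.
Proof.
move=> DE u0 QD; suff H k' : (k' <= m)%N -> exists Q', Q = 'X^k' * Q'.
  have [Q' ->] := H m (leqnn m).
  by move=> j jm; rewrite coefXnM jm.
elim: k' => [_|k' IH km]; first by exists Q; rewrite expr0 mul1r.
have [Q' QE] := IH (ltnW km).
suff Q'0 : Q'.[0] = 0.
  have /factor_theorem[Q'' Q''E] : root Q' 0 by apply/rootP.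
  exists Q''; rewrite QE Q''E subr0; rewrite exprSr; ring.
apply/eqP; apply: contraT => Q'0.
pose p := (m.+1 - k')%N; have p1 : (1 < p)%N by rewrite /p; lia.
(* On the ray through [om], where [om ^+ p] is [sgn] times the imaginary unit, the leading term of
   [Q] times the conjugate of [D] gets a positive imaginary part. *)
pose sgn : R := - (Q'.[0] * u.[0]).
have sgn0 : sgn != 0 by rewrite oppr_eq0 mulf_neq0.
have [om om0 omp] := @upper_root p (Complex 0 sgn) p1 sgn0.
pose rc := map_poly (real_complex R).
have cM (a b : C) : (a * b)^*%C = a^*%C * b^*%C by exact: rmorphM.
have cX (a : C) j : (a ^+ j)^*%C = (a^*%C) ^+ j by exact: rmorphXn.
(* At a real [e > 0] this is [Q] times the conjugate of [D] at [e * om], divided by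
   [e ^+ (k' + m.+1)]; being polynomial in [e], it passes to the limit 0. *)
pose P : {poly C} := (om ^+ k' * (om^*%C) ^+ m.+1)%:P *
  ((rc Q' \Po (om *: 'X)) * (rc u \Po ((om^*%C) *: 'X))).
have PE (e : R) : P.[e%:C%C] = om ^+ k' * (om^*%C) ^+ m.+1 *
   ((rc Q').[e%:C%C * om] * ((rc u).[e%:C%C * om])^*%C).
  rewrite /P hornerM hornerC hornerM !horner_comp !hornerZ !hornerX.
  congr (_ * (_ * _)); first by rewrite mulrC.
  have -> : (om^*%C) * e%:C%C = (e%:C%C * om)^*%C.
    by rewrite cM conjc_real mulrC.
  rewrite -[RHS](horner_map (@conjc R)); congr (_.[_]).
  by apply/polyP => j; rewrite !coef_map [RHS]conjc_real.
have : Im P.[0] <= 0.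
  apply: poly_lim_Im_le0 => e e0; rewrite PE.
  set t := e%:C%C * om.
  have t0 : 0 < Im t.
    rewrite /t; move: om0; case: (om) => a b /= b0.
    by rewrite mul0r addr0 mulr_gt0.
  have := QD t t0; rewrite QE DE !(rmorphM rc) /= !map_polyXn !hornerM !hornerXn -/rc.
  rewrite cM cX {1 3}/t !cM !exprMn conjc_real.
  set a := om ^+ k'; set b := (om^*%C) ^+ m.+1; set q := (rc Q').[_]; set v := conjc (rc u).[_].
  have -> : e%:C%C ^+ k' * a * q * (e%:C%C ^+ m.+1 * b * v) =
            (e ^+ (k' + m.+1))%:C%C * (a * b * (q * v)).
    by rewrite rmorphXn exprD; ring.
  case: (a * b * (q * v)) => c d /=; rewrite mul0r addr0.
  by rewrite pmulr_rle0 // exprn_gt0.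
have := PE 0; rewrite (rmorph0 (real_complex R)) mul0r => ->.
have rc0 (v : {poly R}) : (rc v).[0] = (v.[0])%:C%C.
  by have := horner_map (real_complex R) v 0; rewrite (rmorph0 (real_complex R)).
rewrite !rc0 conjc_real -rmorphM /=.
have -> : om ^+ k' * (om^*%C) ^+ m.+1 = (om * om^*%C) ^+ k' * (om ^+ p)^*%C.
  rewrite exprMn cX -mulrA -exprD; congr (_ * _ ^+ _); rewrite /p; lia.
rewrite omp.
have [n2 n2E n20] : exists2 n2 : R, om * om^*%C = n2%:C%C & 0 < n2.
  case: (om) om0 => a b /= b0; exists (a ^+ 2 + b ^+ 2).
    by apply/eqP; rewrite eq_complex /=; apply/andP; split; apply/eqP; ring.
  by rewrite ltr_wpDl ?sqr_ge0 // exprn_gt0.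
rewrite n2E -rmorphXn /=.
set N := n2 ^+ k'; have N0 : 0 < N by rewrite exprn_gt0.
rewrite leNgt => /negP[]; rewrite /=.
have -> : (N * 0 - 0 * - sgn) * 0 + (N * - sgn + 0 * 0) * (Q'.[0] * u.[0]) = N * (Q'.[0] * u.[0]) ^+ 2.
  by rewrite /sgn; ring.
by rewrite mulr_gt0 // exprn_even_gt0 //= mulf_neq0.
Qed.

End ComplexPolynomials.

(** * Nonvanishing on the upper half plane and deletion of a vertex *)

Section StableSets.
Variables (R : realType) (n : nat) (W : 'I_n -> 'I_n -> R).
Hypothesis W_sym : forall i j, W i j = W j i.
Hypothesis W_ge0 : forall i j, 0 <= W i j.
Local Notation C := (R[i])%type.
Local Notation Im := (@complex.Im R).
Local Notation Re := (@complex.Re R).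
Local Notation rc := (real_complex R).
Implicit Types (U : {set 'I_n}).

Definition upper (z : 'I_n -> C) := forall i, 0 < Im (z i).

Definition stable_on U := forall z, upper z -> forall u, u \in U ->
  tdet (fun i j => rc (W i j)) U u z != 0.

Lemma Im_gt0_neq0 (z : C) : 0 < Im z -> z != 0.
Proof. by apply: contraTneq => ->; rewrite ltxx. Qed.

Lemma stable_on_root U u0 : u0 \in U ->
    (forall z, upper z -> tdet (fun i j => rc (W i j)) U u0 z != 0) -> stable_on U.
Proof.
move=> u0U st z zH u uU; apply: contraNneq (st z zH) => detu.
have := tdet_root z (fun i j => congr1 rc (W_sym i j)) uU u0U.
by rewrite detu mulr0 => /eqP; rewrite mulf_eq0 (negPf (Im_gt0_neq0 (zH u))).
Qed.

(** Maximum principle: the set where a positive maximum is attained avoids [u] and, by harmonicity,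
    has no edge leaving it, against connectedness. *)
Lemma harmonic_le0 U u (psi : 'I_n -> R) : conn W U -> u \in U ->
    (forall t, t \notin U :\ u -> psi t = 0) ->
    (forall t, t \in U :\ u -> \sum_(s in U) W t s * (psi t - psi s) = 0) ->
  forall t, psi t <= 0.
Proof.
move=> Uc uU psi0 harm t; rewrite leNgt; apply/negP => psit.
case: (@Order.TotalTheory.arg_maxP _ _ _ t predT psi isT) => t0 _ t0max.
have psit0 : 0 < psi t0 by apply: lt_le_trans psit (t0max t isT).
have notin s : psi s = psi t0 -> s \in U :\ u.
  by move=> E; apply: contraTT psit0 => /psi0; rewrite E => ->; rewrite ltxx.
pose X := [set s in U | psi s == psi t0].
have [||| x [y [xX yU yX Wxy]]] := Uc.2 X.
- by apply/subsetP => s; rewrite inE => /andP[].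
- by apply/set0Pn; exists t0; rewrite inE eqxx andbT; have /setD1P[] := notin t0 erefl.
- apply: contraTneq uU => <-; rewrite inE negb_and; apply/orP; right.
  by apply/eqP => /notin; rewrite !inE eqxx.
have [xU /eqP xE] : x \in U /\ psi x == psi t0 by move: xX; rewrite inE => /andP.
have := harm x (notin x xE) => /eqP; rewrite psumr_eq0 => [/allP/(_ y)|s _].
  rewrite mem_index_enum yU => /(_ isT) /=; rewrite mulf_eq0 (negPf Wxy) /= subr_eq0 => /eqP E.
  by move: yX; rewrite inE yU -E xE eqxx.
by rewrite mulr_ge0 // subr_ge0 xE; exact: t0max.
Qed.

Lemma tdet_ones_neq0 U u : conn W U -> u \in U -> tdet W U u (fun=> 1) != 0.
Proof.
move=> Uc uU; rewrite /tdet -det_tr; apply/det0P => -[v v0 vM].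
pose psi t := v 0 t.
have row t : \sum_j lapmx W (U :\ u) U (fun=> 1) t j * psi j = 0.
  have := congr1 (fun N : 'rV_n => N 0 t) vM; rewrite mxE [RHS]mxE => E.
  by apply: etrans E; apply: eq_bigr => j _; rewrite [X in _ = _ * X]mxE mulrC.
have psi0 t : t \notin U :\ u -> psi t = 0.
  move=> tU; rewrite -[LHS](sum_delta t psi) -[RHS](row t).
  by apply: eq_bigr => j _; rewrite mxE (negPf tU).
have harm t : t \in U :\ u -> \sum_(s in U) W t s * (psi t - psi s) = 0.
  move=> tU; rewrite -[RHS](row t); under [RHS]eq_bigr do rewrite mxE tU.
  by rewrite lap_apply; under [RHS]eq_bigr do rewrite mulr1.
case/eqP: v0; apply/rowP => t; rewrite mxE; apply/eqP; rewrite eq_le.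
rewrite (harmonic_le0 Uc uU psi0 harm) /= -oppr_le0.
apply: (harmonic_le0 (psi := fun t => - psi t) Uc uU) => s sU.
  by rewrite psi0 ?oppr0.
apply: (@etrans _ _ (- \sum_(j in U) W s j * (psi s - psi j))).
  by rewrite -sumrN; apply: eq_bigr => j _; rewrite -mulrN opprB opprK addrC.
by rewrite harm // oppr0.
Qed.

Lemma Im_add (a b : C) : Im (a + b) = Im a + Im b.
Proof. by case: a; case: b. Qed.

Lemma Im_ge_norm (a : C) : - Re `|a| <= Im a.
Proof.
rewrite lerNl normc_def /=; case: a => a b /=; apply: le_trans (ler_norm _) _.
by rewrite normrN -sqrtr_sqr ler_wsqrtr // lerDr sqr_ge0.
Qed.

Lemma upper_nbhs (z e : 'I_n -> C) : upper z -> exists2 rho : C, 0 < rho &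
  forall t, `|t| <= rho -> upper (fun i => z i + t * e i).
Proof.
move=> zH; pose N := \sum_i Re `|e i| / Im (z i).
have term0 i : 0 <= Re `|e i| / Im (z i).
  rewrite divr_ge0 ?(ltW (zH i)) //.
  by have := normr_ge0 (e i); rewrite lecE => /andP[].
have N0 : 0 <= N by apply: sumr_ge0.
have N1 : 0 < 1 + N by rewrite ltr_wpDr.
exists (rc (1 + N)^-1); first by rewrite ltcR invr_gt0.
move=> t tN i; rewrite Im_add.
have tN' : Re `|t| <= (1 + N)^-1 by move: tN; rewrite lecE /= => /andP[].
have nM : Re `|t * e i| = Re `|t| * Re `|e i|.
  by rewrite normrM !normc_def /=; rewrite mulr0 subr0.
apply: lt_le_trans (_ : Im (z i) - Re `|t * e i| <= _); last first.
  by rewrite lerD2l Im_ge_norm.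
rewrite subr_gt0 nM.
have ei0 : 0 <= Re `|e i| by have := normr_ge0 (e i); rewrite lecE => /andP[].
apply: le_lt_trans (_ : (1 + N)^-1 * Re `|e i| < _); first by rewrite ler_wpM2r.
rewrite mulrC ltr_pdivrMr // -ltr_pdivrMl ?zH // mulrC.
apply: le_lt_trans (_ : N < _); last by rewrite ltrDr.
by rewrite /N (bigD1 i) //= lerDl; apply: sumr_ge0 => j _; exact: term0.
Qed.

(** Hurwitz as [x_v] tends to 0. To exclude an identically zero limit, the alleged zero [z] is
    joined by a line to the all-ones vector, where both factors of [tdet_del] are nonzero by
    connectedness. *)
Lemma stable_on_del U v : v \notin U -> conn W U -> conn W (v |: U) ->
  stable_on (v |: U) -> stable_on U.
Proof.
move=> vU Uc vUc st z zH u uU; apply/eqP => detz.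
have uv : u != v by apply: contraNneq vU => <-.
pose hp : {rmorphism R -> {poly {poly C}}} := polyC \o (polyC \o rc).
(* The inner variable is the value of [x_v], the outer one the parameter of the line. *)
pose x i : {poly {poly C}} :=
  if i == v then 'X%:P else (z i)%:P%:P + (1 - z i)%:P%:P * 'X.
pose g := tdet (fun i j => hp (W i j)) (v |: U) u x.
pose ev s t : {rmorphism {poly {poly C}} -> C} :=
  horner_eval t \o map_poly (horner_eval s).
have evE s t : (map_poly (horner_eval s) g).[t] =
   tdet (fun i j => rc (W i j)) (v |: U) u
        (fun i => if i == v then s else z i + t * (1 - z i)).
  rewrite -[LHS]/(ev s t g) tdet_morph; apply: tdet_ext => [i j _ _|i _].
    by rewrite /ev /hp /= map_polyC /= /horner_eval !hornerC.
  rewrite /ev /= /x; case: ifP => _.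
    by rewrite map_polyC /= /horner_eval hornerC hornerX.
  rewrite rmorphD rmorphM /= !map_polyC map_polyX /= /horner_eval.
  by rewrite hornerD hornerM !hornerC hornerX mulrC.
have evdel t : (map_poly (horner_eval 0) g).[t] =
    (\sum_(s in U) rc (W v s) * (z s + t * (1 - z s))) *
    tdet (fun i j => rc (W i j)) U u (fun i => z i + t * (1 - z i)).
  have ne i : i \in U -> i == v = false by apply: contraTF => /eqP ->.
  rewrite evE tdet_del ?eqxx //; congr (_ * _).
    by apply: eq_bigr => i /ne ->.
  by apply: tdet_ext => // i /ne ->.
have coefE m : (g`_m).[0] = (map_poly (horner_eval 0) g)`_m by rewrite coef_map.
have [rho rho0 rhoP] := upper_nbhs (fun i => 1 - z i) zH.
have g0 : map_poly (horner_eval 0) g = 0.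
  apply/polyP => m; rewrite -coefE coef0; apply: (hurwitz rho0).
    move=> s t s0 tr; rewrite evE; apply: st; last by rewrite inE uU orbT.
    by move=> i; case: ifP => // _; exact: rhoP.
  rewrite coefE -horner_coef0 evdel [X in _ * X](_ : _ = 0) ?mulr0 // -[RHS]detz.
  by apply: tdet_ext => // i _; rewrite mul0r addr0.
have := evdel 1; rewrite g0 horner0 => /esym/eqP; rewrite mulf_eq0.
have one i : z i + 1 * (1 - z i) = 1 by rewrite mul1r addrC subrK.
case/orP; last first.
  have -> : tdet (fun i j => rc (W i j)) U u (fun i => z i + 1 * (1 - z i)) =
            rc (tdet W U u (fun=> 1)).
    by rewrite tdet_morph; apply: tdet_ext => // i _; rewrite one rmorph1.
  by rewrite fmorph_eq0 (negPf (tdet_ones_neq0 Uc uU)).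
have -> : \sum_(s in U) rc (W v s) * (z s + 1 * (1 - z s)) = rc (\sum_(s in U) W v s).
  by rewrite rmorph_sum; apply: eq_bigr => s _; rewrite one mulr1.
rewrite fmorph_eq0 psumr_eq0 // => /allP W0.
have [||| a [b [+ + + Wab]]] := vUc.2 [set v].
- by rewrite sub1set setU11.
- by apply/set0Pn; exists v; rewrite inE.
- by apply: contraNneq uv => E; rewrite -in_set1 E inE uU orbT.
rewrite !inE => /eqP av /orP[->//|bU] _.
by have := W0 b (mem_index_enum _); rewrite bU /= -av (negPf Wab).
Qed.

End StableSets.
Lemma poly_injection_roots0 (R : idomainType) (p : {poly R}) (f : nat -> R) :
  injective f -> (forall i, p.[f i] = 0) -> p = 0.
Proof.
move=> f_inj pf; apply: (@roots_geq_poly_eq0 _ _ (map f (iota 0 (size p)))).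
- by apply/allP => _ /mapP[i _ ->]; apply/rootP.
- by rewrite map_inj_uniq ?iota_uniq.
- by rewrite size_map size_iota.
Qed.

Lemma dvdp_prod_XsubC (F : fieldType) (rs : seq F) (Q : {poly F}) :
    (forall r, ('X - r%:P) ^+ count_mem r rs %| Q) ->
  \prod_(r <- rs) ('X - r%:P) %| Q.
Proof.
elim: rs Q => [|r rs IH] Q H; first by rewrite big_nil dvd1p.
have := H r; rewrite /= eqxx add1n exprS => rQ.
have /dvdpP[Q' QE] : 'X - r%:P %| Q by apply: dvdp_trans rQ; rewrite dvdp_mulr.
rewrite big_cons QE [Q' * _]mulrC dvdp_mul2l ?polyXsubC_eq0 //; apply: IH => s.
have [<-|rs'] := eqVneq r s.
  by move: rQ; rewrite QE [Q' * _]mulrC dvdp_mul2l ?polyXsubC_eq0.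
have := H s; rewrite /= (negPf rs') add0n QE.
rewrite Gauss_dvdpl // coprimep_expl // coprimep_XsubC2 //.
by rewrite subr_eq0.
Qed.

Lemma coef_comp_scale (R : comNzRingType) (p : {poly R}) c k :
  (p \Po (c *: 'X))`_k = c ^+ k * p`_k.
Proof.
elim/poly_ind: p k => [|p a IH] k; first by rewrite comp_poly0 !coef0 mulr0.
rewrite comp_polyD comp_polyM comp_polyX comp_polyC !coefD !coefC.
rewrite -scalerAr coefZ !coefMX; case: k => [|k] /=.
  by rewrite mulr0 !add0r expr0 mul1r.
by rewrite IH !addr0 exprS mulrA.
Qed.

Lemma prod_lines (R : idomainType) (T : eqType) (ls : seq T) (a b : T -> R) :
    (forall l, l \in ls -> b l != 0) ->
  exists2 u : {poly R}, u.[0] != 0 &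
    \prod_(l <- ls) ((a l)%:P + b l *: 'X) = 'X^(count (fun l => a l == 0) ls) * u.
Proof.
elim: ls => [|l ls IH] bP.
  by exists 1; rewrite ?hornerC ?oner_neq0 // big_nil expr0 mulr1.
have [k kls|u u0 uE] := IH; first by apply: bP; rewrite inE kls orbT.
have bl : b l != 0 by apply: bP; rewrite inE eqxx.
rewrite big_cons uE /=; have [->|al] := eqVneq (a l) 0.
  exists ((b l)%:P * u); first by rewrite hornerM hornerC mulf_neq0.
  by rewrite add0r add1n exprS -mul_polyC; ring.
exists (((a l)%:P + b l *: 'X) * u); last by rewrite add0n; ring.
by rewrite hornerM hornerD hornerC hornerZ hornerX mulr0 addr0 mulf_neq0.
Qed.

Section BiDegree.
Variable R : idomainType.
Implicit Types P Q : {poly {poly R}}.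

(* The total degree in both variables is at most [m]. *)
Definition bideg (m : nat) Q := forall k, (size (Q`_k)%R <= m.+1 - k)%N.

Lemma bideg0 m : bideg m 0.
Proof. by move=> k; rewrite coef0 size_poly0. Qed.

Lemma bidegC m (c : {poly R}) : (size c <= m.+1)%N -> bideg m c%:P.
Proof. by move=> sc k; rewrite coefC; case: k => [|k] /=; rewrite ?subn0 ?size_poly0. Qed.

Lemma bidegX : bideg 1 'X.
Proof. by move=> k; rewrite coefX; case: k => [|[|k]] /=; rewrite ?size_poly0 ?size_poly1. Qed.

Lemma bidegN m Q : bideg m Q -> bideg m (- Q).
Proof. by move=> H k; rewrite coefN size_polyN. Qed.

Lemma bidegD m P Q : bideg m P -> bideg m Q -> bideg m (P + Q).
Proof.
move=> HP HQ k; rewrite coefD; apply: leq_trans (size_polyD _ _) _.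
by rewrite geq_max HP HQ.
Qed.

Lemma bideg_sum m (I : finType) (P : pred I) (F : I -> {poly {poly R}}) :
  (forall i, P i -> bideg m (F i)) -> bideg m (\sum_(i | P i) F i).
Proof. by move=> H; elim/big_rec: _ => [|i Q Pi]; [exact: bideg0 | apply: bidegD (H i Pi)]. Qed.

Lemma bidegM m m' P Q : bideg m P -> bideg m' Q -> bideg (m + m') (P * Q).
Proof.
move=> HP HQ k; rewrite coefM; apply: leq_trans (size_sum _ _ _) _.
apply/bigmax_leqP => i _; have [->|Pi] := eqVneq P`_i 0; first by rewrite mul0r size_poly0.
have [->|Qi] := eqVneq Q`_(k - i)%N 0; first by rewrite mulr0 size_poly0.
rewrite size_mul //; have := HP i; have := HQ (k - i)%N; have := ltn_ord i.
have : (0 < size (P`_i)%R)%N by rewrite lt0n size_poly_eq0.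
have : (0 < size (Q`_(k - i))%R)%N by rewrite lt0n size_poly_eq0.
by lia.
Qed.

Lemma bideg_prod (I : finType) (d : I -> nat) (F : I -> {poly {poly R}}) :
  (forall i, bideg (d i) (F i)) -> bideg (\sum_i d i) (\prod_i F i).
Proof.
move=> H; elim/big_ind2: _ => [|m P m' Q|i _]; last exact: H.
  by apply: bidegC; rewrite size_poly1.
exact: bidegM.
Qed.

End BiDegree.

(** * Attaching a vertex: the low coefficients in its variable *)

Section Attach.
Variables (R : realType) (n : nat) (W : 'I_n -> 'I_n -> R).
Hypothesis W_sym : forall i j, W i j = W j i.
Hypothesis W_ge0 : forall i j, 0 <= W i j.
Local Notation C := (R[i])%type.
Local Notation Im := (@complex.Im R).
Local Notation rc := (real_complex R).
Variables (U : {set 'I_n}) (v : 'I_n).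
Hypothesis vU : v \notin U.

(* The minor of [v |: U] as a polynomial in the variable of [v]: it is divisible by
   this variable, and its coefficients 1 and 2 carry the argument. *)
Definition attach (A : comNzRingType) (h : {rmorphism R -> A}) (z : 'I_n -> A) : {poly A} :=
  tdet (fun i j => (h (W i j))%:P) (v |: U) v (fun i => if i == v then 'X else (z i)%:P).

Definition form (A : comNzRingType) (h : {rmorphism R -> A}) (l : 'I_n -> R) (z : 'I_n -> A) :=
  \sum_(t in U) h (l t) * z t.

Lemma attach_eval (A : comNzRingType) (h : {rmorphism R -> A}) z s :
  (attach h z).[s] =
  tdet (fun i j => h (W i j)) (v |: U) v (fun i => if i == v then s else z i).
Proof.
rewrite -[LHS]/(horner_eval s (attach h z)) tdet_morph.
apply: tdet_ext => [i j _ _|i _]; rewrite /= /horner_eval ?hornerC //.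
by case: ifP; rewrite ?hornerX ?hornerC.
Qed.

Lemma attach_map (A B : comNzRingType) (h : {rmorphism R -> A}) (f : {rmorphism A -> B}) z :
  map_poly f (attach h z) = attach (f \o h) (fun i => f (z i)).
Proof.
rewrite tdet_morph; apply: tdet_ext => [i j _ _|i _]; rewrite /= ?map_polyC //.
by case: ifP; rewrite ?map_polyX ?map_polyC.
Qed.

Lemma attach_ext (A : comNzRingType) (h h' : {rmorphism R -> A}) z z' :
  h =1 h' -> (forall i, i \in U -> z i = z' i) -> attach h z = attach h' z'.
Proof.
move=> hh zz; apply: tdet_ext => [i j _ _|i]; rewrite ?hh //.
by rewrite in_setU1; case: ifP => //= _ iU; rewrite zz.
Qed.

Lemma coef_attach_ext (A : comNzRingType) (h h' : {rmorphism R -> A}) z z' k :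
  h =1 h' -> (forall i, i \in U -> z i = z' i) -> (attach h z)`_k = (attach h' z')`_k.
Proof. by move=> hh zz; rewrite (attach_ext hh zz). Qed.

Lemma coef0_attach (A : comNzRingType) (h : {rmorphism R -> A}) z : U != set0 ->
  (attach h z)`_0 = 0.
Proof.
case/set0Pn => k kU; rewrite -horner_coef0 attach_eval.
have ne i : i \in U -> i == v = false by apply: contraTF => /eqP ->.
apply: (@det_right_null _ _ _ (fun i => (i \in U)%:R) k); last by rewrite kU.
move=> t; have [tU|tU] := boolP (t \in U); last first.
  rewrite -[RHS](_ : (t \in U)%:R = 0 :> A); last by rewrite (negPf tU).
  rewrite -[RHS](sum_delta t (fun i => (i \in U)%:R)).
  apply: eq_bigr => j _; rewrite mxE !inE; case: ifP => // /andP[tv].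
  by rewrite (negPf tv) (negPf tU).
under eq_bigr do rewrite mxE !inE (ne t tU) tU /=.
rewrite lap_apply big_setU1 //= eqxx mulr0 mul0r add0r big1 // => i iU.
by rewrite tU iU subrr mulr0.
Qed.

Variables (K : R) (ls : seq {ffun 'I_n -> R}).
Hypothesis U_gt0 : U != set0.
Hypothesis K_neq0 : K != 0.
Hypothesis sls : (size ls).+2 = #|U|.
Hypothesis ls_ge0 : forall l t, l \in ls -> 0 <= l t.
Hypothesis ls_neq0 : forall l, l \in ls -> exists2 t, t \in U & l t != 0.
Hypothesis detE : forall (A : comNzRingType) (h : {rmorphism R -> A}) (x : 'I_n -> A) u,
  u \in U -> tdet (fun i j => h (W i j)) U u x =
             h K * x u * \prod_(l <- ls) \sum_(t in U) h (l t) * x t.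

(** Moving the root from [v] to [u] removes one factor [x_v]; the rest is evaluated at [x_v = 0] by
    [tdet_del]. *)
Lemma coef1_attach (A : idomainType) (h : {rmorphism R -> A}) z u : u \in U -> z u != 0 ->
  (attach h z)`_1 = h K * form h (W v) z * \prod_(l <- ls) form h l z.
Proof.
move=> uU zu; have uv : u == v = false by apply: contraTF uU => /eqP ->.
pose hp : {rmorphism R -> {poly A}} := polyC \o h.
have := @tdet_root _ _ (fun i j => hp (W i j)) (v |: U) (fun i => if i == v then 'X else (z i)%:P) u v
  (fun i j => congr1 hp (W_sym i j)).
rewrite !inE uU eqxx orbT uv => /(_ isT isT).
set G := tdet _ _ u _ => E.
have := congr1 (fun p : {poly A} => p`_1) E; rewrite coefCM mulrC coefXM /= => E1.
apply: (mulIf zu); rewrite E1 -horner_coef0.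
have -> : G.[0] = tdet (fun i j => h (W i j)) (v |: U) u (fun i => if i == v then 0 else z i).
  rewrite -[LHS]/(horner_eval 0 G) tdet_morph.
  apply: tdet_ext => [i j _ _|i _]; rewrite /= /horner_eval /hp /= ?hornerC //.
  by case: ifP; rewrite ?hornerX ?hornerC.
rewrite tdet_del ?eqxx //.
have ne i : i \in U -> i == v = false by apply: contraTF => /eqP ->.
have -> : \sum_(t in U) h (W v t) * (if t == v then 0 else z t) = form h (W v) z.
  by apply: eq_bigr => t /ne ->.
rewrite (@tdet_ext _ _ _ (fun i j => h (W i j)) U u _ z) // => [|i /ne -> //].
by rewrite detE //; ring.
Qed.

Hypothesis st : stable_on W (v |: U).

(** The factor [x_v] is divided out, so that [Im_coef_ratio] sees the coefficients 1 and 2 as 0 and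
    1. *)
Lemma Im_attach z : upper z ->
  Im ((attach rc z)`_2 * ((attach rc z)`_1)^*%C) <= 0.
Proof.
move=> zH; have /factor_theorem[p pE] : root (attach rc z) 0.
  by rewrite rootE horner_coef0 coef0_attach.
rewrite subr0 in pE; rewrite pE !coefMX /=; apply: Im_coef_ratio => s s0.
have : (attach rc z).[s] != 0.
  rewrite attach_eval; apply: st; last by rewrite setU11.
  by move=> i; case: ifP.
by rewrite pE hornerM mulf_eq0 negb_or => /andP[].
Qed.

Definition rform (l x : 'I_n -> R) := \sum_(t in U) l t * x t.

Definition along (y d : 'I_n -> R) : {poly R} :=
  (attach polyC (fun i => (y i)%:P + d i *: 'X))`_2.

Lemma map_along (A : comNzRingType) (f : {rmorphism {poly R} -> A}) y d :
  f (along y d) = (attach (f \o polyC) (fun i => f (y i)%:P + f (d i)%:P * f 'X))`_2.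
Proof.
have := congr1 (fun p : {poly A} => p`_2) (attach_map polyC f (fun i => (y i)%:P + d i *: 'X)).
rewrite coef_map => ->; apply: coef_attach_ext => // i _.
by rewrite rmorphD -mul_polyC rmorphM.
Qed.

Lemma rform_gt0 (l e : 'I_n -> R) : (forall t, 0 <= l t) ->
  (exists2 t, t \in U & l t != 0) -> (forall i, 0 < e i) -> 0 < rform l e.
Proof.
move=> l0 [t tU lt] e0; rewrite /rform (bigD1 t) //= ltr_wpDr //.
  by apply: sumr_ge0 => s _; rewrite mulr_ge0 // ltW.
by rewrite mulr_gt0 // lt_def lt l0.
Qed.

Hypothesis Wv_gt0 : exists2 t, t \in U & W v t != 0.

(** A positive direction sends the upper half plane to upper points, so [pole_order] applies; the
    order of [D1] exceeds the number of forms vanishing at [y] by one, as the form of [W v] vanishes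
    too. *)
Lemma along_pole y e k : (forall i, 0 < e i) -> rform (W v) y = 0 ->
  (k < count (fun l : {ffun 'I_n -> R} => rform l y == 0%R) ls)%N -> (along y e)`_k = 0.
Proof.
move=> e0 y0.
have [|u0 u00 uE] := @prod_lines _ _ ls (fun l : {ffun _} => rform l y) (fun l : {ffun _} => rform l e).
  by move=> l lls; rewrite gt_eqF // rform_gt0 // => [t|]; [exact: ls_ge0 | exact: ls_neq0].
set m := count _ _ in uE *.
have s0 : 0 < rform (W v) e by rewrite rform_gt0.
pose u := (K * rform (W v) e)%:P * u0.
move=> km; apply: (@pole_order _ _ ('X^(m.+1) * u) m u erefl _ _ k km).
  by rewrite hornerM hornerC mulf_neq0 // mulf_neq0 // gt_eqF.
move=> t t0.
pose z i : C := rc (y i) + rc (e i) * t.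
have zH : upper z.
  move=> j; rewrite /z Im_add /= add0r; case: (t) t0 => a b /= b0.
  by rewrite mul0r addr0 mulr_gt0.
have [r rU] := set0Pn _ U_gt0.
have QE : (map_poly rc (along y e)).[t] = (attach rc z)`_2.
  pose f : {rmorphism {poly R} -> C} := horner_eval t \o map_poly rc.
  rewrite -[LHS]/(f (along y e)) map_along; apply: coef_attach_ext => [a|i _]; rewrite /f /= map_polyC /horner_eval /= hornerC //.
  by rewrite map_polyC map_polyX hornerC hornerX.
have formE (l : 'I_n -> R) : form rc l z = rc (rform l y) + rc (rform l e) * t.
  rewrite /rform !rmorph_sum mulr_suml -big_split; apply: eq_bigr => s _.
  by rewrite /= !rmorphM /z; ring.
have DE : (map_poly rc ('X^(m.+1) * u)).[t] = (attach rc z)`_1.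
  rewrite (@coef1_attach _ rc z r rU (Im_gt0_neq0 (zH r))) formE y0 rmorph0 add0r.
  have -> : 'X^(m.+1) * u = (K * rform (W v) e)%:P * 'X *
     \prod_(l <- ls) ((rform l y)%:P + rform l e *: 'X).
    by rewrite uE /u exprS; ring.
  rewrite !(rmorphM (map_poly rc)) /= map_polyC map_polyX !hornerM hornerC hornerX.
  rewrite rmorph_prod horner_prod /= (rmorphM rc) -!mulrA; congr (_ * (_ * (_ * _))).
  apply: eq_bigr => l _; rewrite formE rmorphD /= -mul_polyC rmorphM /= !map_polyC map_polyX.
  by rewrite hornerD hornerM !hornerC hornerX.
by rewrite QE DE; exact: Im_attach.
Qed.

(** Polynomial dependence on the direction lets vanishing on positive directions spread to all
    directions. *)
Lemma along_coef_poly y d1 d2 k : exists P : {poly R}, forall lam,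
  P.[lam] = (along y (fun i => d1 i + lam * d2 i))`_k.
Proof.
pose h2 : {rmorphism R -> {poly {poly R}}} := polyC \o polyC.
pose z i : {poly {poly R}} := (y i)%:P%:P + ((d1 i)%:P + d2 i *: 'X)%:P * 'X.
exists (((attach h2 z)`_2)`_k) => lam.
have := congr1 (fun p : {poly {poly R}} => p`_2) (attach_map h2 (map_poly (horner_eval lam)) z).
rewrite coef_map /= => /(congr1 (fun p : {poly R} => p`_k)); rewrite coef_map => /= E.
apply: etrans E _; apply: (congr1 (fun q : {poly R} => q`_k)); apply: coef_attach_ext => [a|i _] /=.
  by rewrite map_polyC /= /horner_eval hornerC.
rewrite /z rmorphD rmorphM /= !map_polyC map_polyX /= /horner_eval hornerD !hornerC.
by rewrite hornerZ hornerX -mul_polyC [d2 i * _]mulrC.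
Qed.

Lemma along_scale y d c k : (along y (fun i => c * d i))`_k = c ^+ k * (along y d)`_k.
Proof.
rewrite -coef_comp_scale; apply: (congr1 (fun q : {poly R} => q`_k)).
rewrite -[RHS]/(comp_poly (c *: 'X) (along y d)) map_along; apply: coef_attach_ext => [a|i _] /=; first by rewrite comp_polyC.
by rewrite !comp_polyC comp_polyX mul_polyC scalerA mulrC.
Qed.

Lemma along_vanish y d k : rform (W v) y = 0 ->
  (k < count (fun l : {ffun 'I_n -> R} => rform l y == 0%R) ls)%N -> (along y d)`_k = 0.
Proof.
move=> y0 km.
have [P PE] := along_coef_poly y (fun=> 1) d k.
pose N := \sum_i `|d i|; have N0 : 0 <= N by apply: sumr_ge0.
(* The directions [1 + lam d] are positive for the infinitely many [lam = 1 / (N + j + 1)]. *)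
have P0 : P = 0.
  apply: (@poly_injection_roots0 _ _ (fun j => (N + j.+1%:R)^-1)) => [a b|j].
    by move/invr_inj/addrI/eqP; rewrite eqr_nat eqSS => /eqP.
  rewrite PE; apply: along_pole => // i; have dN : - d i <= N.
    apply: le_trans (ler_norm _) _; rewrite normrN /N (bigD1 i) //= lerDl.
    by apply: sumr_ge0.
  have Nj : 0 < N + j.+1%:R by rewrite ltr_wpDl.
  rewrite -(pmulr_rgt0 _ Nj) mulrDr mulr1 mulrA mulfV ?gt_eqF // mul1r.
  rewrite -ltrBlDr sub0r; apply: le_lt_trans dN _; by rewrite ltrDl.
(* The roles are swapped to reach [d] itself, the case [lam = 0] of [d + lam]; for other [lam] this
   direction is a multiple of [1 + d / lam]. *)
have [P2 P2E] := along_coef_poly y d (fun=> 1) k.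
suff P20 : P2 = 0.
  have := P2E 0; rewrite P20 horner0 => E; apply: etrans (esym E).
  apply: (congr1 (fun q : {poly R} => q`_k)).
  by apply: coef_attach_ext => // i _; rewrite mul0r addr0.
apply: (@poly_injection_roots0 _ _ (fun j => j.+1%:R)) => [a b /eqP|j].
  by rewrite eqr_nat eqSS => /eqP.
have := PE (j.+1%:R)^-1; rewrite P0 horner0 P2E => E.
have -> : along y (fun i => d i + j.+1%:R * 1) =
          along y (fun i => j.+1%:R * (1 + (j.+1%:R)^-1 * d i)).
  apply: coef_attach_ext => // i _; congr (_ + _ *: _).
  by rewrite mulrDr mulrA mulfV ?pnatr_eq0 // mul1r mulr1 addrC.
by rewrite along_scale -E mulr0.
Qed.

Lemma along_shift y d r : along y d \Po ('X + r%:P) = along (fun i => y i + r * d i) d.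
Proof.
rewrite -[LHS]/(comp_poly ('X + r%:P) (along y d)) map_along; apply: coef_attach_ext => [a|i _] /=; first by rewrite comp_polyC.
by rewrite !comp_polyC comp_polyX -mul_polyC polyCD polyCM; ring.
Qed.

(** Each of the [#|U|] rows that are not unit rows has degree at most one in [x_v] and the line
    parameter together. *)
Lemma bideg_attach y d :
  bideg #|U| (attach polyC (fun i => (y i)%:P + d i *: 'X)).
Proof.
rewrite /attach /tdet /determinant.
apply: bideg_sum => s _; rewrite -[#|U|]add0n; apply: bidegM.
  have one : bideg 0 (1 : {poly {poly R}}) by apply: bidegC; rewrite size_poly1.
  by case: (odd_perm s); rewrite ?expr1 ?expr0 //; exact: bidegN.
rewrite -sum1_card big_mkcond /=; apply: bideg_prod => t; rewrite mxE !inE.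
have nat0 (b : bool) : bideg 0 (b%:R : {poly {poly R}}).
  by case: b; [apply: bidegC; rewrite size_poly1 | exact: bideg0].
have xdeg u : bideg 1 (if u == v then 'X else ((y u)%:P + d u *: 'X)%:P : {poly {poly R}}).
  case: ifP => _; first exact: bidegX.
  apply: bidegC; apply: leq_trans (size_polyD _ _) _.
  rewrite geq_max (leq_trans (size_polyC_leq1 _)) //=.
  by apply: leq_trans (size_scale_leq _ _) _; rewrite size_polyX.
have wdeg u w : bideg 1 ((W u w)%:P%:P * (if w == v then 'X else ((y w)%:P + d w *: 'X)%:P)).
  by apply: (@bidegM _ 0 1); [apply: bidegC; exact: size_polyC_leq1 | exact: xdeg].
have [->|tv] := eqVneq t v; first by rewrite (negPf vU); exact: nat0.
case: (t \in U) => /=; last exact: nat0.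
rewrite /lap; apply: bidegD; last apply: bidegN.
  by apply: (@bidegM _ 0 1); [exact: nat0 | apply: bideg_sum => u _; exact: wdeg].
by apply: (@bidegM _ 0 1); [exact: nat0 | exact: wdeg].
Qed.

Lemma size_along y d : (size (along y d) <= (size ls).+1)%N.
Proof. by have := bideg_attach y d 2; rewrite -sls subSS subSS subn0. Qed.

Definition lines (y d : 'I_n -> R) : {poly R} :=
  \prod_(l <- ls) ((rform l y)%:P + rform l d *: 'X).

Lemma rformD l x y r : rform l (fun i => x i + r * y i) = rform l x + r * rform l y.
Proof.
rewrite /rform mulr_sumr -big_split; apply: eq_bigr => t _ /=; ring.
Qed.

(** At each root of [lines], [along] vanishes to at least the same order, by [along_vanish] at the
    shifted base point, which stays in the hyperplane; [size_along] leaves a constant quotient. *)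
Lemma along_prop y d : rform (W v) y = 0 -> rform (W v) d = 0 ->
    (forall l, l \in ls -> rform l y != 0) -> (forall l, l \in ls -> rform l d != 0) ->
  exists kap, along y d = kap *: lines y d.
Proof.
move=> y0 d0 ly ld.
pose root_of (l : {ffun 'I_n -> R}) := - rform l y / rform l d.
pose rs := map root_of ls.
have linesE : lines y d = (\prod_(l <- ls) rform l d) *: \prod_(r <- rs) ('X - r%:P).
  rewrite big_map -mul_polyC rmorph_prod -big_split /=; apply: eq_big_seq => l lls.
  rewrite /root_of mulNr polyCN opprK mulrDr -polyCM mulrCA mulfV ?ld // mulr1.
  by rewrite mul_polyC addrC.
have dvd : \prod_(r <- rs) ('X - r%:P) %| along y d.
  apply: dvdp_prod_XsubC => r.
  have cE : count_mem r rs =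
            count (fun l : {ffun 'I_n -> R} => rform l (fun i => y i + r * d i) == 0%R) ls.
    rewrite count_map; apply: eq_in_count => l lls /=.
    rewrite rformD /root_of addr_eq0 -(inj_eq (mulIf (ld l lls))) divfK ?ld //.
    by rewrite eqr_oppLR.
  pose Q := along (fun i => y i + r * d i) d.
  have QE : along y d = Q \Po ('X - r%:P).
    rewrite /Q -along_shift -comp_polyA comp_polyD comp_polyX comp_polyC subrK.
    by rewrite comp_polyXr.
  rewrite QE; set m := count_mem r rs.
  have /dvdpP[q ->] : 'X^m %| Q.
    apply/dvdpP; exists (\poly_(j < size Q) Q`_(j + m)).
    apply/polyP => j; rewrite coefMXn coef_poly; case: ltnP => jm.
      by apply: along_vanish; rewrite -?cE // rformD y0 d0 mulr0 addr0.
    rewrite subnK //; case: ltnP => // sj; rewrite nth_default //.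
    by apply: leq_trans sj _; rewrite leq_subr.
  rewrite comp_polyM (_ : 'X^m \Po _ = ('X - r%:P) ^+ m) ?dvdp_mull //.
  by rewrite -[LHS]/(comp_poly ('X - r%:P) 'X^m) rmorphXn /= comp_polyX.
have pd0 : \prod_(l <- ls) rform l d != 0.
  by rewrite prodf_seq_neq0; apply/allP => l lls; rewrite ld.
have [q qE] := dvdpP _ _ dvd.
have sq : (size q <= 1)%N.
  have [->|q0] := eqVneq q 0; first by rewrite size_poly0.
  have := size_along y d; rewrite qE size_Mmonic ?monic_prod_XsubC //.
  rewrite size_prod_XsubC size_map addnS /= -[(size ls).+1]add1n leq_add2r.
  by [].
have := size1_polyC sq => qC.
exists (q`_0 / \prod_(l <- ls) rform l d).
by rewrite linesE scalerA divfK // qE [q in LHS]qC mul_polyC.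
Qed.

End Attach.

(** * Potentials *)

Section Potential.
Variables (R : realFieldType) (n : nat) (W : 'I_n -> 'I_n -> R).
Hypothesis W_sym : forall i j, W i j = W j i.
Variable (U : {set 'I_n}).
Implicit Types (y d phi psi rho : 'I_n -> R).

Definition current y phi t := \sum_(s in U) W t s * y s * (phi t - phi s).

Lemma sum_antisym (F : 'I_n -> 'I_n -> R) : (forall s t, F s t = - F t s) ->
  \sum_(t in U) \sum_(s in U) F t s = 0.
Proof.
move=> FN; set S := \sum_(t in U) _.
have : S = - S.
  rewrite {1}/S exchange_big /= -sumrN; apply: eq_bigr => t _.
  by rewrite -sumrN; apply: eq_bigr.
by move=> E; apply/eqP; rewrite -[_ == _](mulrn_eq0 S 2) mulr2n {2}E subrr.
Qed.

(** The Laplacian is self-adjoint once row [t] carries its factor [y t]: the difference of the two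
    sides is an antisymmetric double sum. *)
Lemma current_adj y phi psi :
  \sum_(t in U) y t * psi t * current y phi t =
  \sum_(t in U) y t * phi t * current y psi t.
Proof.
apply/eqP; rewrite -subr_eq0 -sumrB; apply/eqP.
rewrite -[RHS](@sum_antisym (fun t s => W t s * y t * y s * (phi t * psi s - psi t * phi s))).
  apply: eq_bigr => t _; rewrite /current !mulr_sumr -sumrB.
  by apply: eq_bigr => s _; ring.
by move=> s t; rewrite W_sym; ring.
Qed.

Lemma current_left y phi : \sum_(t in U) y t * current y phi t = 0.
Proof.
have := current_adj y phi (fun=> 1); under eq_bigr do rewrite mulr1.
by move=> ->; rewrite big1 // => t _; rewrite /current big1 ?mulr0 // => s _; rewrite subrr mulr0.
Qed.

Lemma lapmx_current y phi t (Z : {set 'I_n}) : t \in Z ->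
  \sum_j lapmx W Z U y t j * phi j = current y phi t.
Proof. by move=> tZ; rewrite /current -lap_apply; apply: eq_bigr => j _; rewrite mxE tZ. Qed.

(** The invertible minor solves every equation but the one at [u], which follows because both sides
    have zero [y]-weighted sum. *)
Lemma current_solve y u rho : u \in U -> y u != 0 -> tdet W U u y != 0 ->
    \sum_(t in U) y t * rho t = 0 ->
  exists phi, forall t, t \in U -> current y phi t = rho t.
Proof.
move=> uU yu detU yrho; pose M := lapmx W (U :\ u) U y.
have Mu : M \in unitmx by rewrite unitmxE unitfE.
pose b : 'cV[R]_n := \col_t (if t \in U :\ u then rho t else 0).
pose phi t := (invmx M *m b) t 0.
have Mphi t : t \in U -> t != u -> current y phi t = rho t.
  move=> tU tu; have tUu : t \in U :\ u by rewrite !inE tu.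
  rewrite -(lapmx_current _ _ tUu); have := mulKVmx Mu b.
  move/(congr1 (fun N : 'cV_n => N t 0)); rewrite [RHS]mxE tUu => <-.
  by rewrite [RHS]mxE.
exists phi => t tU; have [->|tu] := eqVneq t u; last exact: Mphi.
apply: (mulfI yu); have := etrans (current_left y phi) (esym yrho).
rewrite (bigD1 u) //= [RHS](bigD1 u) //=.
rewrite (eq_bigr (fun t => y t * rho t)) => [|s /andP[sU su]]; last by rewrite Mphi.
by move/addIr.
Qed.

Lemma current_kernel y u psi : u \in U -> tdet W U u y != 0 ->
    (forall t, t \in U -> current y psi t = 0) ->
  forall t, t \in U -> psi t = psi u.
Proof.
move=> uU detU psi0; pose M := lapmx W (U :\ u) U y.
have Mu : M \in unitmx by rewrite unitmxE unitfE.
pose chi t := if t \in U then psi t - psi u else 0.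
pose c : 'cV[R]_n := \col_t chi t.
have Mc : M *m c = 0.
  apply/matrixP => t j; rewrite mxE [RHS]mxE.
  have [tUu|tUu] := boolP (t \in U :\ u).
    rewrite (eq_bigr (fun i => M t i * chi i)) => [|i _]; last by rewrite [c _ _]mxE.
    have [_ tU] := setD1P tUu; rewrite lapmx_current // -[RHS](psi0 t tU).
    by apply: eq_bigr => s sU; rewrite /chi tU sU opprB addrA subrK.
  rewrite (eq_bigr (fun i => (t == i)%:R * chi i)) => [|i _].
    rewrite sum_delta /chi; case: ifP => // tU; move: tUu; rewrite !inE tU andbT negbK.
    by move=> /eqP ->; rewrite subrr.
  by rewrite !mxE (negPf tUu).
have c0 : c = 0 by rewrite -[c](mulKmx Mu) Mc mulmx0.
move=> t tU; have := congr1 (fun N : 'cV_n => N t 0) c0.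
by rewrite !mxE /chi tU => /eqP; rewrite subr_eq0 => /eqP.
Qed.

(* The energy [sum beta y phi] of the potential [phi] driven by [beta] has
   derivative [- current y (phi ^ 2)] with respect to [y]. *)
Lemma current_square beta y d phi phi1 :
    (forall t, t \in U -> current y phi t = - beta t) ->
    (forall t, t \in U -> current y phi1 t = - current d phi t) ->
    \sum_(t in U) beta t * (d t * phi t + y t * phi1 t) = 0 ->
  \sum_(t in U) d t * current y (fun s => phi s ^+ 2) t = 0.
Proof.
move=> phiE phi1E.
have -> : \sum_(t in U) beta t * (d t * phi t + y t * phi1 t) =
   - (\sum_(t in U) d t * phi t * current y phi t) +
     \sum_(t in U) y t * phi t * current d phi t.
  transitivity (- (\sum_(t in U) d t * phi t * current y phi t) -
                \sum_(t in U) y t * phi1 t * current y phi t).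
    rewrite -!sumrN -big_split; apply: eq_bigr => t tU /=.
    by rewrite phiE //; ring.
  congr (_ + _); rewrite current_adj -sumrN; apply: eq_bigr => t tU.
  by rewrite phi1E //; ring.
have -> : \sum_(t in U) y t * phi t * current d phi t =
   \sum_(t in U) \sum_(s in U) W t s * d t * y s * (phi s * (phi s - phi t)).
  rewrite exchange_big /=; apply: eq_bigr => t _; rewrite mulr_sumr.
  by apply: eq_bigr => s _; rewrite (W_sym s t); ring.
rewrite -sumrN -big_split /= => E; apply/eqP; rewrite -oppr_eq0 -[X in _ == X]E -sumrN.
apply/eqP; apply: eq_bigr => t _; rewrite /current !mulr_sumr -!sumrN -big_split /=.
by apply: eq_bigr => s _; ring.
Qed.

End Potential.

(** * Stationarity of the energy *)

Section Stationary.
Variables (R : realType) (n : nat) (W : 'I_n -> 'I_n -> R).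
Hypothesis W_sym : forall i j, W i j = W j i.
Variables (U : {set 'I_n}) (v : 'I_n).
Hypothesis vU : v \notin U.
Variables (K : R) (ls : seq {ffun 'I_n -> R}).
Hypothesis U_gt0 : U != set0.
Hypothesis K_neq0 : K != 0.
Hypothesis detE : forall (A : comNzRingType) (h : {rmorphism R -> A}) (x : 'I_n -> A) u,
  u \in U -> tdet (fun i j => h (W i j)) U u x =
             h K * x u * \prod_(l <- ls) \sum_(t in U) h (l t) * x t.

(* The vector [1 + x_v phi] solves the Laplacian system of [v |: U] up to second
   order in [x_v], so [det_adj_apply] computes the coefficient of [x_v ^ 2] as the
   product of the forms in [ls] times the energy of [phi]. *)
Lemma energy_stationary y d phi0 phi1 kap :
    (forall t, t \in U -> current W U y phi0 t = - W v t) ->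
    (forall t, t \in U -> current W U y phi1 t = - current W U d phi0 t) ->
    along W U v y d = kap *: lines U ls y d -> (lines U ls y d)`_0 != 0 ->
  \sum_(t in U) W v t * (d t * phi0 t + y t * phi1 t) = 0.
Proof.
move=> phi0E phi1E alongE L0.
pose x i : {poly R} := (y i)%:P + d i *: 'X.
pose phi i : {poly R} := (phi0 i)%:P + phi1 i *: 'X.
pose xv i : {poly {poly R}} := if i == v then 'X else (x i)%:P.
pose M := lapmx (fun i j => (W i j)%:P%:P) ((v |: U) :\ v) (v |: U) xv.
pose P : {poly {poly R}} := attach W U v polyC x.
have PE : P = \det M by [].
have ne i : i \in U -> i == v = false by apply: contraTF => /eqP ->.
have [k kU] := set0Pn _ U_gt0.
(* The outer variable is [x_v], the inner one the line parameter; the entry at [v] is 0 because the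
   row of [v] is a unit row. *)
pose c i : {poly {poly R}} := if i \in U then 1 + 'X * (phi i)%:P else 0.
pose rho t : {poly R} := 'X^2 * (current W U d phi1 t)%:P.
pose g t : {poly R} := (W v t)%:P * phi t.
pose b t : {poly {poly R}} := if t \in U then 'X * (rho t)%:P + 'X^2 * (g t)%:P else 0.
(* The equations for [phi0] and [phi1] cancel the orders 0 and 1 in the line parameter. *)
have rhoE t : t \in U ->
    rho t = (W v t)%:P + \sum_(s in U) (W t s)%:P * x s * (phi t - phi s).
  move=> tU; have -> : \sum_(s in U) (W t s)%:P * x s * (phi t - phi s) =
      (current W U y phi0 t)%:P + (current W U y phi1 t + current W U d phi0 t)%:P * 'X
      + 'X^2 * (current W U d phi1 t)%:P.
    rewrite /current polyCD !rmorph_sum mulrDl !mulr_suml mulr_sumr -!big_split /=.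
    apply: eq_bigr => s _; rewrite /x /phi -!mul_polyC !polyCM !polyCB; ring.
  by rewrite phi0E // phi1E // addNr polyC0 mul0r addr0 polyCN addrA subrr add0r.
have Mc t : \sum_j M t j * c j = b t.
  have [tU|tU] := boolP (t \in U); last first.
    rewrite /b (negPf tU) -[RHS](_ : c t = 0); last by rewrite /c (negPf tU).
    rewrite -[RHS](sum_delta t c); apply: eq_bigr => j _.
    rewrite mxE !inE; case: ifP => // /andP[tv].
    by rewrite (negPf tv) (negPf tU).
  under eq_bigr do rewrite mxE !inE (ne t tU) tU /=.
  rewrite lap_apply big_setU1 //= /xv eqxx /b tU rhoE // /c (negPf vU) tU subr0.
  have -> : \sum_(s in U) (W t s)%:P%:P * (if s == v then 'X else (x s)%:P) *
       (1 + 'X * (phi t)%:P - (if s \in U then 1 + 'X * (phi s)%:P else 0)) =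
       'X * (\sum_(s in U) (W t s)%:P * x s * (phi t - phi s))%:P.
    rewrite rmorph_sum mulr_sumr; apply: eq_bigr => s sU.
    by rewrite (ne s sU) sU /= !polyCM polyCB; ring.
  rewrite (W_sym t v) /g; move: (phi t) (\sum_(s in U) _ : {poly R}) => f S.
  by rewrite polyCD !polyCM; ring.
(* At [x_v = 0] the matrix is the full Laplacian of [U], whose cofactors are minors by
   [lapmx_adj]. *)
have adj0 i : i \in U -> (\adj M k i)`_0 = K%:P * x i * lines U ls y d.
  move=> iU; have -> : (\adj M k i)`_0 = \adj (map_mx (horner_eval 0) M) k i.
    by rewrite -map_mx_adj [RHS]mxE /= /horner_eval horner_coef0.
  have -> : map_mx (horner_eval 0) M = lapmx (fun s j => (W s j)%:P) U U x.
    apply/matrixP => s j; rewrite !mxE !inE.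
    have [->|sv] := eqVneq s v.
      by rewrite (negPf vU) /=; rewrite rmorph_nat.
    rewrite /=; case: ifP => sU; last by rewrite rmorph_nat.
    rewrite /lap rmorphB !rmorphM !rmorph_nat rmorph_sum big_setU1 //= /horner_eval.
    rewrite /xv eqxx hornerM hornerX mulr0 add0r hornerC; congr (_ * _ - _).
      by apply: eq_bigr => a aU; rewrite (ne a aU) hornerM !hornerC.
    rewrite in_setU1; have [->|jv] := eqVneq j v; last by rewrite hornerC.
    by rewrite hornerX mulr0 mulr0 (negPf vU) mul0r.
  rewrite lapmx_adj // (detE polyC) //; congr (_ * _).
  apply: eq_bigr => l _; rewrite /rform /x rmorph_sum -mul_polyC rmorph_sum mulr_suml -big_split.
  by apply: eq_bigr => s _; rewrite /= -mul_polyC !polyCM; ring.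
have E := det_adj_apply k Mc; rewrite -PE in E.
have P0 : P`_0 = 0 by rewrite coef0_attach.
have cM1 (p q : {poly {poly R}}) : (p * q)`_1 = p`_0 * q`_1 + p`_1 * q`_0.
  by rewrite coefM !big_ord_recl big_ord0 addr0.
have cM2 (p q : {poly {poly R}}) :
    (p * q)`_2 = p`_0 * q`_2 + p`_1 * q`_1 + p`_2 * q`_0.
  by rewrite coefM !big_ord_recl big_ord0 addr0 addrA.
have b0 i : (b i)`_0 = 0.
  rewrite /b; case: ifP => _; rewrite ?coef0 //.
  by rewrite coefD coefXM coefXnM /= addr0.
have b1 i : i \in U -> (b i)`_1 = rho i.
  by move=> iU; rewrite /b iU coefD coefXM coefXnM /= coefC addr0.
have b2 i : i \in U -> (b i)`_2 = g i.
  by move=> iU; rewrite /b iU coefD coefXM coefXnM /= !coefC add0r.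
have c0 : (c k)`_0 = 1 by rewrite /c kU coefD coef1 coefXM addr0.
have c1 : (c k)`_1 = phi k by rewrite /c kU coefD coef1 coefXM /= coefC add0r.
have bN i : i \notin U -> b i = 0 by move=> /negPf iU; rewrite /b iU.
have sumU (F : 'I_n -> {poly R}) : (forall i, i \notin U -> F i = 0) ->
    \sum_i F i = \sum_(i in U) F i.
  move=> F0; rewrite (bigID (mem U)) /= [X in _ + X]big1 ?addr0 //.
pose Z1 := \sum_(i in U) (\adj M k i)`_0 * (current W U d phi1 i)%:P.
pose Z2 := \sum_(i in U) (\adj M k i)`_1 * (current W U d phi1 i)%:P.
have P1E : P`_1 = 'X^2 * Z1.
  have := congr1 (fun p : {poly {poly R}} => p`_1) E.
  rewrite cM1 P0 mul0r add0r c0 mulr1 => ->.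
  rewrite coef_sum sumU => [|i iU]; last by rewrite bN // mulr0 coef0.
  rewrite /Z1 mulr_sumr; apply: eq_bigr => i iU.
  by rewrite cM1 b0 mulr0 addr0 b1 // /rho; ring.
pose En : {poly R} := \sum_(i in U) (W v i)%:P * x i * phi i.
have P2E : P`_2 = 'X^2 * (Z2 - Z1 * phi k) + K%:P * lines U ls y d * En.
  have := congr1 (fun p : {poly {poly R}} => p`_2) E.
  rewrite cM2 P0 mul0r add0r c0 c1 mulr1 P1E => H.
  rewrite -[P`_2](addKr ('X^2 * Z1 * phi k)) H coef_sum.
  rewrite sumU => [|i iU]; last by rewrite bN // mulr0 coef0.
  have -> : \sum_(i in U) (\adj M k i * b i)`_2 = 'X^2 * Z2 + K%:P * lines U ls y d * En.
    rewrite /Z2 /En !mulr_sumr -big_split; apply: eq_bigr => i iU.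
    by rewrite cM2 b0 mulr0 addr0 b1 // b2 // adj0 // /rho /g /=; ring.
  by ring.
have EE : kap *: lines U ls y d = 'X^2 * (Z2 - Z1 * phi k) + K%:P * lines U ls y d * En.
  by rewrite -alongE -P2E.
have rM1 (p q : {poly R}) : (p * q)`_1 = p`_0 * q`_1 + p`_1 * q`_0.
  by rewrite coefM !big_ord_recl big_ord0 addr0.
have rM0 (p q : {poly R}) : (p * q)`_0 = p`_0 * q`_0.
  by rewrite coefM !big_ord_recl big_ord0 addr0.
set L := lines U ls y d in L0 EE *.
(* Modulo the square of the line parameter, [kap L = K L En]. As [L] has a nonzero constant term,
   [En] has no linear term, and that term is the sum in the goal. *)
have := congr1 (fun p : {poly R} => p`_0) EE.
rewrite coefZ coefD coefXnM /= add0r -mulrA coefCM rM0 => E0.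
have kapE : kap = K * En`_0.
  by apply: (mulIf L0); rewrite E0; ring.
have := congr1 (fun p : {poly R} => p`_1) EE.
rewrite coefZ coefD coefXnM /= add0r -mulrA coefCM rM1 kapE => E1.
have {E1} : K * L`_0 * En`_1 = 0.
  have -> : K * L`_0 * En`_1 = K * (L`_0 * En`_1 + L`_1 * En`_0) - K * En`_0 * L`_1 by ring.
  by rewrite -E1 subrr.
move/eqP; rewrite mulf_eq0 mulf_eq0 (negPf K_neq0) (negPf L0) /= => /eqP En1.
apply: etrans En1; rewrite /En coef_sum; apply: eq_bigr => i _.
rewrite -mulrA coefCM rM1 /x /phi !coefD !coefC !coefZ !coefX /=.
by congr (_ * _); ring.
Qed.

End Stationary.

(** * Generic points of a hyperplane *)

Section Generic.
Variables (R : realType) (n : nat) (U : {set 'I_n}) (beta : 'I_n -> R).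
Implicit Types (f : {ffun 'I_n -> R}).

Definition nonprop f := [exists t in U, exists u in U, f t * beta u != f u * beta t].

Lemma propE f t0 s : ~~ nonprop f -> t0 \in U -> beta t0 != 0 -> s \in U ->
  f s = f t0 / beta t0 * beta s.
Proof.
move=> fP t0U bt sU; apply: (mulIf bt); apply/eqP.
rewrite mulrAC divfK //; apply: contraR fP => H.
by apply/existsP; exists s; rewrite sU; apply/existsP; exists t0; rewrite t0U.
Qed.

(** These test vectors lie in the hyperplane of [beta] and detect whether [l] is proportional to
    [beta]. *)
Lemma rform_pair l t u : t \in U -> u \in U ->
  rform U l (fun s => (s == t)%:R * beta u - (s == u)%:R * beta t) =
  l t * beta u - l u * beta t.
Proof.
move=> tU uU; rewrite /rform; under eq_bigr do rewrite mulrBr.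
rewrite sumrB; congr (_ - _).
  rewrite (bigD1 t) //= eqxx mul1r big1 ?addr0 // => s /andP[_ /negPf->].
  by rewrite mul0r mulr0.
rewrite (bigD1 u) //= eqxx mul1r big1 ?addr0 // => s /andP[_ /negPf->].
by rewrite mul0r mulr0.
Qed.

Lemma large_scalar (as_ : seq R) : exists2 c, 0 < c & forall a, a \in as_ -> `|a| < c.
Proof.
exists (1 + \sum_(a <- as_) `|a|); first by rewrite ltr_wpDr // sumr_ge0.
by move=> a aas; rewrite ltr_pwDl // (big_rem a) //= lerDl sumr_ge0.
Qed.

Lemma shift_neq0 (fs : seq {ffun 'I_n -> R}) y d : exists2 c, 0 < c &
  forall f, f \in fs -> (rform U f y != 0) || (rform U f d != 0) ->
    rform U f (fun s => y s + c * d s) != 0.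
Proof.
have [c c0 cP] := large_scalar [seq rform U f y / rform U f d | f : {ffun 'I_n -> R} <- fs].
exists c => // f ffs; rewrite rformD.
have [->|fd _] := eqVneq (rform U f d) 0; first by rewrite orbF mulr0 addr0.
apply/eqP => /eqP; rewrite addr_eq0 => /eqP E.
have := cP _ (map_f _ ffs); rewrite E mulNr mulfK // normrN gtr0_norm //.
by rewrite ltxx.
Qed.

(** If the next form vanishes at the point, a large multiple of a test vector detecting that form is
    added; large multiples cannot cancel the values of the others. *)
Lemma generic_point (fs : seq {ffun 'I_n -> R}) : exists2 y, rform U beta y = 0 &
  forall f, f \in fs -> nonprop f -> rform U f y != 0.
Proof.
elim: fs => [|f fs [y y0 yP]].
  exists (fun=> 0); first by rewrite /rform big1 // => t _; rewrite mulr0.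
  by move=> f; rewrite in_nil.
have [ok|] := boolP (nonprop f ==> (rform U f y != 0)).
  by exists y => // g; rewrite inE => /orP[/eqP->|/yP//]; exact/implyP.
rewrite negb_imply negbK => /andP[/existsP[t /andP[tU /existsP[u /andP[uU ftu]]]] /eqP fy].
have [c c0 cP] := shift_neq0 (f :: fs) y (fun s => (s == t)%:R * beta u - (s == u)%:R * beta t).
exists (fun s => y s + c * ((s == t)%:R * beta u - (s == u)%:R * beta t)).
  by rewrite rformD y0 rform_pair // mulrC [X in X - _]mulrC subrr mul0r addr0.
move=> g gfs gP; apply: cP => //; move: gfs; rewrite inE => /orP[/eqP->|gfs].
  by rewrite rform_pair // subr_eq0 ftu orbT.
by rewrite yP.
Qed.

End Generic.

(** * Splits from rank-one cut matrices *)

Section SplitOfRank.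
Variables (R : realType) (n : nat) (W : 'I_n -> 'I_n -> R).
Hypothesis W_sym : forall i j, W i j = W j i.
Hypothesis W_ge0 : forall i j, 0 <= W i j.
Variables (U : {set 'I_n}) (beta : 'I_n -> R).
Hypothesis beta_ge0 : forall t, 0 <= beta t.

(** If a potential is [p] on [A] and [q] on the rest of [U], its current at [t] is [p - q] times
    this form at [y]. *)
Definition cut_row (A : {set 'I_n}) t : {ffun 'I_n -> R} :=
  [ffun s => if t \in A then (s \notin A)%:R * W t s else - ((s \in A)%:R * W t s)].

(* The linear form [rform U (cut_minor A t t')] vanishes at the generic point when
   [A] is a level set of the potential, hence it is proportional to [beta]. *)
Definition cut_minor (A : {set 'I_n}) t t' : {ffun 'I_n -> R} :=
  [ffun s => beta t' * cut_row A t s - beta t * cut_row A t' s].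

Lemma midsplit_of_minors (A : {set 'I_n}) t0 :
    conn W U -> A \subset U -> A != U -> t0 \in A -> beta t0 != 0 ->
    (forall t t', t \in U -> t' \in U -> ~~ nonprop U beta (cut_minor A t t')) ->
  midsplit W U beta.
Proof.
move=> Uc AU AnU t0A bt0 minors; have t0U := subsetP AU t0 t0A.
have A0 : A != set0 by apply/set0Pn; exists t0.
pose theta s := W t0 s / beta t0.
have rk t u : t \in A -> u \in U :\: A -> W t u = beta t * theta u.
  move=> tA /setDP[uU uA]; have tU := subsetP AU t tA.
  (* For two vertices of [A] the minor vanishes on [A], in particular at [t0], so its factor of
     proportionality to [beta] is 0. *)
  have := propE (minors t t0 tU t0U) t0U bt0 uU.
  rewrite !ffunE tA t0A uA /= !mul0r !mulr0 subrr !mul0r !mul1r => /eqP.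
  rewrite subr_eq0 => /eqP E; apply: (mulfI bt0); rewrite E /theta.
  by rewrite mulrCA [beta t0 * _]mulrC divfK.
have [a [b [aA bU bA Wab]]] := Uc.2 A AU A0 AnU.
have bB : b \in U :\: A by rewrite inE bA.
have thb : theta b != 0 by apply: contraNneq Wab => thb; rewrite rk // thb mulr0.
have thb0 : 0 <= theta b by rewrite /theta divr_ge0.
have prop u : u \in U :\: A -> beta u = beta b / theta b * theta u.
  (* A minor mixing the two sides is supported on both; comparing its entries at [b] and [t0] yields
     the proportionality. *)
  move=> /setDP[uU uA]; have := propE (minors u t0 uU t0U) t0U bt0 bU.
  rewrite !ffunE (negPf bA) (negPf uA) t0A /= !mul0r !mul1r oppr0 !mulr0 sub0r subr0.
  rewrite mulrN mulNr [beta t0 * _]mulrC mulfK // mulNr => /oppr_inj E.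
  apply: (mulIf thb); rewrite mulrAC divfK // /theta (W_sym t0 u).
  by rewrite mulrA E mulrCA mulrA mulrC.
exists A, theta, (beta b / theta b); split=> //.
by rewrite divr_ge0.
Qed.

End SplitOfRank.

(** * From stability to splits *)

Section StableMidsplit.
Variables (R : realType) (n : nat) (W : 'I_n -> 'I_n -> R).
Hypothesis W_sym : forall i j, W i j = W j i.
Hypothesis W_ge0 : forall i j, 0 <= W i j.

Lemma current_swap (U : {set 'I_n}) y d phi :
  \sum_(t in U) y t * current W U d phi t = - \sum_(t in U) d t * current W U y phi t.
Proof.
rewrite -sumrN; under eq_bigr do rewrite /current mulr_sumr.
rewrite exchange_big /=; apply: eq_bigr => t _; rewrite /current mulr_sumr -sumrN.
by apply: eq_bigr => s _; rewrite (W_sym s t); ring.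
Qed.

Lemma midsplit_scale (U : {set 'I_n}) (l : {ffun 'I_n -> R}) beta :
    ~~ nonprop U beta l -> (exists2 t, t \in U & l t != 0) ->
    (exists2 t, t \in U & beta t != 0) ->
  midsplit W U l -> midsplit W U beta.
Proof.
move=> lP [t0 t0U lt0] [t1 t1U bt1] [A [th [eta [AU A0 AnU eta0 [rk prop]]]]].
pose c := l t1 / beta t1.
have lE s : s \in U -> l s = c * beta s by exact: propE.
have c0 : c != 0 by apply: contraNneq lt0 => c0; rewrite lE // c0 mul0r.
exists A, (fun s => c * th s), (eta / c ^+ 2); split=> //.
  by rewrite divr_ge0 ?sqr_ge0.
split=> [t u tA uB|u uB]; first by rewrite rk // lE ?(subsetP AU) //; ring.
have /setDP[uU _] := uB; apply: (mulfI c0); rewrite -lE // prop //.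
by field.
Qed.

Lemma midsplit_of_stable (U : {set 'I_n}) v : v \notin U -> conn W U -> conn W (v |: U) ->
  stable_on W (v |: U) -> (1 < #|U|)%N -> reducible W U -> midsplit W U (W v).
Proof.
move=> vU Uc vUc st U1 redU; set beta := W v.
have [K [ls [K0 sls lsP detE]]] := reducible_factored W_sym W_ge0 redU U1.
have U0 := Uc.1.
have [t1 t1U bt1] : exists2 t, t \in U & beta t != 0.
  have [||| a [b [+ + + Wab]]] := vUc.2 [set v].
  - by rewrite sub1set setU11.
  - by apply/set0Pn; exists v; rewrite inE.
  - apply/eqP => E; case/set0Pn: U0 => t tU; have : t \in [set v].
      by rewrite E inE tU orbT.
    by rewrite inE => /eqP tv; rewrite -tv tU in vU.
  rewrite !inE => /eqP av /orP[/eqP->|bU]; first by rewrite eqxx.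
  by move=> _; exists b => //; rewrite /beta -av.
have ls_ge0 l t : l \in ls -> 0 <= l t by case/lsP.
have ls_neq0 l : l \in ls -> exists2 t, t \in U & l t != 0 by case/lsP.
(* A form proportional to [W v] already carries a split; it would also vanish on the whole
   hyperplane, where no generic point could avoid it. *)
have [/hasP[l lls lP]|/hasPn lsN] := boolP (has (fun l => ~~ nonprop U beta l) ls).
  have [_ ln0 lmid] := lsP l lls.
  by apply: midsplit_scale lP ln0 _ lmid; exists t1.
have [u0 u0U u01] : exists2 u, u \in U & u != t1.
  have : (0 < #|U :\ t1|)%N by move: U1; rewrite (cardsD1 t1) t1U.
  by case/card_gt0P => u; rewrite !inE => /andP[u1 uU]; exists u.
(* It belongs to the generic list to ensure [y u0 != 0], needed to solve the Laplacian system with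
   root [u0]. *)
pose del : {ffun 'I_n -> R} := [ffun s => (s == u0)%:R].
(* All subsets are listed, since the level set is known only after [y] is chosen. *)
pose minors := [seq cut_minor W beta q.1 q.2.1 q.2.2 | q : {set 'I_n} * ('I_n * 'I_n)].
have [y y0 yP] := generic_point U beta (del :: ls ++ minors).
have yu0 : y u0 != 0.
  have := yP del (mem_head _ _); rewrite /rform (bigD1 u0) //= ffunE eqxx mul1r.
  rewrite big1 ?addr0 => [|s /andP[_ /negPf su]]; last by rewrite ffunE su mul0r.
  apply; apply/existsP; exists u0; rewrite u0U; apply/existsP; exists t1.
  by rewrite t1U !ffunE eqxx [t1 == u0]eq_sym (negPf u01) mul1r mul0r.
have ly l : l \in ls -> rform U l y != 0.
  by move=> lls; apply: yP; [rewrite inE mem_cat lls orbT | rewrite -[nonprop _ _ _]negbK lsN].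
have detU : tdet W U u0 y != 0.
  have := detE R idfun y u0 u0U => /= ->; rewrite mulf_neq0 // ?mulf_neq0 //.
  by rewrite prodf_seq_neq0; apply/allP => l lls; rewrite ly.
have [phi phiE] : exists phi, forall t, t \in U -> current W U y phi t = - beta t.
  apply: (current_solve W_sym (u := u0)) => //.
  apply: (@etrans _ _ (- rform U beta y)); last by rewrite y0 oppr0.
  by rewrite /rform -sumrN; apply: eq_bigr => t _; ring.
pose sq t := phi t ^+ 2.
have orth d : rform U beta d = 0 -> \sum_(t in U) d t * current W U y sq t = 0.
  (* A multiple of [y] is added to [d] so that no form vanishes on the direction; its contribution
     to the conclusion is zero by [current_left]. *)
  move=> d0; have [c c0 cP] := shift_neq0 U ls d y.
  pose d' s := d s + c * y s.
  have d'0 : rform U beta d' = 0 by rewrite rformD d0 y0 mulr0 addr0.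
  have ld' l : l \in ls -> rform U l d' != 0.
    by move=> lls; apply: cP => //; rewrite ly // orbT.
  have [kap kapE] := along_prop W_sym W_ge0 vU U0 K0 sls ls_ge0 ls_neq0 detE st
     (ex_intro2 _ _ t1 t1U bt1) y0 d'0 ly ld'.
  have [phi1 phi1E] : exists phi1, forall t, t \in U ->
      current W U y phi1 t = - current W U d' phi t.
    apply: (current_solve W_sym (u := u0)) => //.
    under eq_bigr do rewrite mulrN; rewrite sumrN current_swap opprK.
    rewrite (eq_bigr (fun t => - (beta t * d' t))) => [|t tU].
      by rewrite sumrN -[\sum_(_ in _) _]/(rform U beta d') d'0 oppr0.
    by rewrite phiE //; ring.
  have L0 : (lines U ls y d')`_0 != 0.
    rewrite -horner_coef0 /lines horner_prod prodf_seq_neq0; apply/allP => l lls.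
    by rewrite hornerD hornerC hornerZ hornerX mulr0 addr0 ly.
  have E1 := energy_stationary W_sym vU U0 K0 detE phiE phi1E kapE L0.
  have := current_square W_sym phiE phi1E E1.
  rewrite /d'; under eq_bigr do rewrite mulrDl -mulrA.
  by rewrite big_split /= -mulr_sumr current_left // mulr0 addr0.
pose lam := current W U y sq t1 / beta t1.
have sqE t : t \in U -> current W U y sq t = lam * beta t.
  move=> tU; apply: (mulIf bt1); rewrite /lam mulrAC divfK //.
  apply/eqP; rewrite -subr_eq0; apply/eqP.
  rewrite -(@rform_pair _ _ U beta (current W U y sq) t t1) //.
  rewrite -[RHS](orth (fun s => (s == t)%:R * beta t1 - (s == t1)%:R * beta t)).
    by apply: eq_bigr => s _; rewrite mulrC.
  by rewrite rform_pair // mulrC subrr.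
pose q := - lam - phi t1.
have phiq t : t \in U -> phi t != phi t1 -> phi t = q.
  move=> tU tt1.
  (* A function with zero current is constant on [U], so two distinct values of [phi] sum to
     [- lam]. *)
  have chi0 s : s \in U -> current W U y (fun s => sq s + lam * phi s) s = 0.
    move=> sU; have := sqE s sU; rewrite /current => E1.
    have := phiE s sU; rewrite /current => E2.
    rewrite (eq_bigr (fun u => W s u * y u * (sq s - sq u) +
                               lam * (W s u * y u * (phi s - phi u)))) => [|u _]; last by ring.
    by rewrite big_split /= -mulr_sumr E1 E2 mulrN subrr.
  have E := current_kernel u0U detU chi0 tU.
  have := current_kernel u0U detU chi0 t1U; rewrite -E /sq => /eqP.
  rewrite eq_sym -subr_eq0.
  rewrite [X in X == 0](_ : _ = (phi t - phi t1) * (phi t + phi t1 + lam)); last by ring.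
  rewrite mulf_eq0 subr_eq0 (negPf tt1) /= -addrA addr_eq0 => /eqP ->.
  by rewrite /q opprD addrC.
pose A := [set t in U | phi t == phi t1].
have AU : A \subset U by apply/subsetP => t; rewrite inE => /andP[].
have t1A : t1 \in A by rewrite inE t1U eqxx.
have memA t : t \in U -> (t \in A) = (phi t == phi t1) by move=> tU; rewrite inE tU.
have rowE t : t \in U -> (phi t1 - q) * rform U (cut_row W A t) y = - beta t.
  move=> tU; rewrite -phiE // /rform mulr_sumr; apply: eq_bigr => s sU.
  rewrite ffunE !memA //.
  have [tE|/(phiq t tU) tE] := eqVneq (phi t) (phi t1);
    have [sE|/(phiq s sU) sE] := eqVneq (phi s) (phi t1); rewrite tE sE /=; ring.
have AnU : A != U.
  apply: contraNneq bt1 => AE; rewrite -oppr_eq0 -phiE // /current big1 // => s sU.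
  have : s \in A by rewrite AE.
  by rewrite inE => /andP[_ /eqP ->]; rewrite subrr mulr0.
have p_neq_q : phi t1 - q != 0.
  by apply: contraNneq bt1 => pq; have := rowE t1 t1U; rewrite pq mul0r => /esym/eqP; rewrite oppr_eq0.
apply: (midsplit_of_minors W_sym W_ge0 _ Uc AU AnU t1A bt1) => [t|t t' tU t'U].
  exact: W_ge0.
(* By [rowE] the minor vanishes at [y], which a nonproportional form of the generic list cannot
   do. *)
apply/negP => /(yP _); rewrite inE mem_cat.
have -> : cut_minor W beta A t t' \in minors.
  by apply/mapP; exists (A, (t, t')); rewrite ?mem_enum.
rewrite !orbT => /(_ isT)/negP; apply; apply/eqP/(mulfI p_neq_q); rewrite mulr0.
have -> : rform U (cut_minor W beta A t t') y =
    beta t' * rform U (cut_row W A t) y - beta t * rform U (cut_row W A t') y.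
  rewrite /rform !mulr_sumr -sumrB; apply: eq_bigr => s _.
  by rewrite [cut_minor _ _ _ _ _ _]ffunE; ring.
rewrite mulrBr !(mulrCA (phi t1 - q)) !rowE //.
by rewrite !mulrN opprK mulrC addNr.
Qed.

Lemma reducible_of_stable (U : {set 'I_n}) : conn W U -> stable_on W U -> reducible W U.
Proof.
apply: (reducible_of_midsplits W_sym W_ge0) => {}U v vU Uc vUc st.
  exact: stable_on_del vU Uc vUc st.
exact: midsplit_of_stable.
Qed.

End StableMidsplit.

(** * The class of stable graphs *)

Section AdjacencyWeights.
Variable R : realType.

Lemma edge_pair (G : sgraph) (e : {set G}) : e \in edges G ->
  exists x y, x != y /\ e = [set x; y].
Proof. by move/edges_card/eqP/cards2P. Qed.

Lemma edge_neq (G : sgraph) (x y : G) : [set x; y] \in edges G -> x != y.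
Proof. by move/edges_card; rewrite cards2; case: eqP. Qed.

Lemma adj_weight_diag (G : sgraph) (w : weighting R G) x : adj_weight w x x = 0.
Proof.
by rewrite /adj_weight; case: ifP => // /edge_neq; rewrite eqxx.
Qed.

Lemma positive_adj (G : sgraph) (w : weighting R G) :
  (forall x y, [set x; y] \in edges G -> 0 < adj_weight w x y) <-> positive_weighting w.
Proof.
split=> [H e eG|H x y xyG]; last by rewrite /adj_weight xyG H.
have [x [y [_ eE]]] := edge_pair eG; rewrite eE in eG *.
by have := H x y eG; rewrite /adj_weight eG.
Qed.

Lemma adj_weight_ge0 (G : sgraph) (w : weighting R G) : positive_weighting w ->
  forall x y, 0 <= adj_weight w x y.
Proof. by move=> w0 x y; rewrite /adj_weight; case: ifP => // /w0/ltW. Qed.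

Lemma adj_weight_neq0 (G : sgraph) (w : weighting R G) : positive_weighting w ->
  forall x y, (adj_weight w x y != 0) = ([set x; y] \in edges G).
Proof.
move=> w0 x y; rewrite /adj_weight; case: ifP; last by rewrite eqxx.
by move/w0/lt0r_neq0.
Qed.

Lemma iso_of_adj (G H : sgraph) (wG : weighting R G) (wH : weighting R H) (f : G -> H) :
    bijective f -> positive_weighting wG -> positive_weighting wH ->
    (forall x y, adj_weight wH (f x) (f y) = adj_weight wG x y) ->
  weighted_iso wG wH f.
Proof.
move=> fb wG0 wH0 fE.
have memE x y : ([set f x; f y] \in edges H) = ([set x; y] \in edges G).
  by rewrite -(adj_weight_neq0 wH0) fE adj_weight_neq0.
have imE x y : f @: [set x; y] = [set f x; f y] by rewrite imsetU1 imset_set1.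
have [g fK gK] := fb.
split=> //.
  apply/setP => e; apply/idP/imsetP => [eH|[e' e'G ->]].
    have [x [y [_ eE]]] := edge_pair eH; exists [set g x; g y].
      by rewrite -memE !gK -eE.
    by rewrite imE !gK.
  by have [x [y [_ eE]]] := edge_pair e'G; rewrite eE imE memE -eE.
move=> e eG; have [x [y [_ eE]]] := edge_pair eG; rewrite eE imE.
have := fE x y; rewrite /adj_weight memE -eE eG //.
Qed.

Lemma iso_adj (G H : sgraph) (wG : weighting R G) (wH : weighting R H) (f : G -> H) :
  weighted_iso wG wH f -> forall x y, adj_weight wH (f x) (f y) = adj_weight wG x y.
Proof.
case=> fb EH fw x y; have [g fK gK] := fb.
have imE : f @: [set x; y] = [set f x; f y] by rewrite imsetU1 imset_set1.
rewrite /adj_weight -imE EH mem_imset; last exact: imset_inj (can_inj fK).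
by case: ifP => // /fw.
Qed.

Lemma iso_positive (G H : sgraph) (wG : weighting R G) (wH : weighting R H) (f : G -> H) :
  weighted_iso wG wH f -> positive_weighting wG -> positive_weighting wH.
Proof.
by case=> _ EH fw wG0 e; rewrite EH => /imsetP[e' e'G ->]; rewrite fw // wG0.
Qed.

Lemma adj_rescale (H : sgraph) (w : weighting R H) v c x y :
  adj_weight (rescale_weight w v c) x y =
  if (x == v) || (y == v) then c * adj_weight w x y else adj_weight w x y.
Proof.
rewrite /adj_weight /rescale_weight !inE [v == x]eq_sym [v == y]eq_sym.
by case: ifP => //; case: ifP => //; rewrite mulr0.
Qed.

Section Copy.
Variables (H : sgraph) (w : weighting R H) (u : H) (twin : bool) (c : R).
Let cw := copy_weight w u twin c.

Lemma copy_edges_Some (x y : H) :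
  ([set Some x; Some y] \in copy_edges u twin) = ([set x; y] \in edges H).
Proof.
have E : [set Some x; Some y] = Some @: [set x; y] by rewrite imsetU1 imset_set1.
have N : None \notin [set Some x; Some y] by rewrite !inE.
rewrite /copy_edges !inE {1}E mem_imset; last exact: imset_inj Some_inj.
case: (_ \in edges H) => //=.
apply/negbTE; rewrite negb_or; apply/andP; split.
  by apply/imsetP => -[t _ E']; move: N; rewrite E' !inE.
by case: twin; rewrite !inE //; apply/eqP => E'; move: N; rewrite E' !inE.
Qed.

Lemma set_pair_None (t s : H) : ([set None; Some t] == [set None; Some s]) = (t == s).
Proof.
apply/eqP/eqP => [E|->//].
have : Some t \in [set None; Some s] by rewrite -E !inE eqxx orbT.
by rewrite !inE => /eqP[].
Qed.

Lemma copy_edges_None (t : H) :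
  ([set None; Some t] \in copy_edges u twin) =
  ([set u; t] \in edges H) || twin && (t == u).
Proof.
have N : None \in [set None; Some t] by rewrite !inE.
rewrite /copy_edges !inE -orbA; apply/or3P/orP => [[]|[]].
- by case/imsetP => e _ E; move: N; rewrite E => /imsetP[].
- by case/imsetP => s; rewrite inE => us /eqP; rewrite set_pair_None => /eqP->; left.
- by case: twin; rewrite !inE // set_pair_None => ->; right.
- by move=> ut; apply: Or32; apply/imsetP; exists t; rewrite ?inE.
by case: twin => //= /eqP ->; apply: Or33; rewrite inE.
Qed.

Lemma adj_copy_Some x y : adj_weight cw (Some x) (Some y) = adj_weight w x y.
Proof.
rewrite /adj_weight copy_edges_Some; case: ifP => // _.
rewrite /cw /copy_weight !inE /=; congr (w _).
by apply/setP => s; rewrite !inE.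
Qed.

Lemma adj_copy_None t : adj_weight cw None (Some t) =
  if t == u then (if twin then c else 0) else adj_weight w u t.
Proof.
rewrite /adj_weight copy_edges_None /cw /copy_weight !inE /=.
rewrite [Some u == _](inj_eq Some_inj) [u == t]eq_sym.
have [->|tu] := eqVneq t u.
  have -> : [set u; u] \in edges H = false.
    by apply/negbTE/negP => /edge_neq; rewrite eqxx.
  by rewrite andbT.
rewrite andbF orbF; case: ifP => // _; congr (w _).
by apply/setP => s; rewrite !inE.
Qed.

Lemma copy_positive : positive_weighting w -> 0 < c -> positive_weighting cw.
Proof.
move=> w0 c0; apply/positive_adj => -[x|] [y|].
- by rewrite adj_copy_Some /= copy_edges_Some; exact: ((positive_adj w).2 w0).
- rewrite setUC adj_weight_sym adj_copy_None /= copy_edges_None.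
  have [->|xu] := eqVneq x u.
    case/orP => [/edge_neq|]; first by rewrite eqxx.
    by rewrite andbT => ->.
  by rewrite andbF orbF; exact: ((positive_adj w).2 w0).
- rewrite adj_copy_None /= copy_edges_None.
  have [->|xu] := eqVneq y u.
    case/orP => [/edge_neq|]; first by rewrite eqxx.
    by rewrite andbT => ->.
  by rewrite andbF orbF; exact: ((positive_adj w).2 w0).
by move/edge_neq; rewrite eqxx.
Qed.

End Copy.

Section Glue.
Variables (H1 H2 : sgraph) (w1 : weighting R H1) (w2 : weighting R H2).
Variables (v1 : H1) (v2 : H2).
Let gw := glue_weight w1 w2 v1 v2.
Let GV := glue_graph v1 v2.
Let il : H1 -> GV := @glue_inl H1 H2 v2.
Let ir : H2 -> GV := @glue_inr H1 H2 v1 v2.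

Lemma glue_inr_root : ir v2 = il v1.
Proof. by rewrite /ir /glue_inr; case: insubP => // a; rewrite eqxx. Qed.

Lemma glue_inl_inr x y : il x = ir y -> x = v1 /\ y = v2.
Proof.
rewrite /il /ir /glue_inl /glue_inr; case: insubP => [a _ _ //|].
by move=> /negPn/eqP -> [->].
Qed.

Lemma glue_cases (g : GV) : (exists x, g = il x) \/ (exists2 y, y != v2 & g = ir y).
Proof.
case: g => [x|[y yv]]; first by left; exists x.
by right; exists y => //; rewrite /ir /glue_inr insubT.
Qed.

Lemma glue_pair_cross (x y : H1) (f : {set H2}) : x != y ->
  [set il x; il y] <> ir @: f.
Proof.
move=> xy E.
have /imsetP[a _ /glue_inl_inr[xv _]] : il x \in ir @: f by rewrite -E set21.
have /imsetP[b _ /glue_inl_inr[yv _]] : il y \in ir @: f by rewrite -E set22.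
by move: xy; rewrite xv yv eqxx.
Qed.

Lemma adj_glue_inl x y : adj_weight gw (il x) (il y) = adj_weight w1 x y.
Proof.
have E : [set il x; il y] = il @: [set x; y] by rewrite imsetU1 imset_set1.
have [->|xy] := eqVneq x y; first by rewrite !adj_weight_diag.
have ili : injective il by exact: glue_inl_inj.
have imE : (il @: [set x; y] \in [set il @: (f : {set H1}) | f in edges H1]) =
    ([set x; y] \in edges H1) by rewrite mem_imset //; exact: imset_inj.
rewrite /adj_weight /= /glue_edges inE.
have -> : ([set il x; il y] \in [set ir @: (f : {set H2}) | f in edges H2]) = false.
  by apply/negbTE/imsetP => -[f _ /(glue_pair_cross xy)].
rewrite orbF E imE; case: ifP => // xyE.
rewrite /gw /glue_weight imE xyE; congr (w1 _).
by apply/setP => s; rewrite inE mem_imset.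
Qed.

Lemma adj_glue_inr x y : adj_weight gw (ir x) (ir y) = adj_weight w2 x y.
Proof.
have E : [set ir x; ir y] = ir @: [set x; y] by rewrite imsetU1 imset_set1.
have [->|xy] := eqVneq x y; first by rewrite !adj_weight_diag.
have iri : injective ir by exact: glue_inr_inj.
have imE : (ir @: [set x; y] \in [set ir @: (f : {set H2}) | f in edges H2]) =
    ([set x; y] \in edges H2) by rewrite mem_imset //; exact: imset_inj.
have F : ([set ir x; ir y] \in [set il @: (f : {set H1}) | f in edges H1]) = false.
  apply/negbTE/imsetP => -[f _ Ef].
  have /imsetP[a _ /esym/glue_inl_inr[_ xv]] : ir x \in il @: f by rewrite -Ef set21.
  have /imsetP[b _ /esym/glue_inl_inr[_ yv]] : ir y \in il @: f by rewrite -Ef set22.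
  by move: xy; rewrite xv yv eqxx.
rewrite /adj_weight /= /glue_edges inE F /= E imE; case: ifP => // xyE.
rewrite /gw /glue_weight -E F E; congr (w2 _).
by apply/setP => s; rewrite inE mem_imset.
Qed.

Lemma adj_glue_cross x y : x != v1 -> y != v2 -> adj_weight gw (il x) (ir y) = 0.
Proof.
move=> xv yv; rewrite /adj_weight; case: ifP => //; rewrite /= /glue_edges inE.
case/orP => /imsetP[f _ E].
  have /imsetP[a _ /esym/glue_inl_inr[_ yE]] : ir y \in il @: f by rewrite -E set22.
  by rewrite yE eqxx in yv.
have /imsetP[a _ /glue_inl_inr[xE _]] : il x \in ir @: f by rewrite -E set21.
by rewrite xE eqxx in xv.
Qed.

Lemma glue_positive : positive_weighting w1 -> positive_weighting w2 -> positive_weighting gw.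
Proof.
move=> w10 w20 e; rewrite /= /glue_edges inE /gw /glue_weight.
case: ifP => [/imsetP[f fE ->] _|_ /= /imsetP[f fE ->]].
  suff -> : il @^-1: (il @: f) = f by exact: w10.
  by apply/setP => x; rewrite inE mem_imset //; exact: glue_inl_inj.
suff -> : ir @^-1: (ir @: f) = f by exact: w20.
by apply/setP => x; rewrite inE mem_imset //; exact: glue_inr_inj.
Qed.

End Glue.

Lemma rescale_positive (H : sgraph) (w : weighting R H) v c :
  positive_weighting w -> 0 < c -> positive_weighting (rescale_weight w v c).
Proof.
by move=> w0 c0 e eH; rewrite /rescale_weight; case: ifP; rewrite ?mulr_gt0 ?w0.
Qed.

End AdjacencyWeights.

(** * Realising reducible weights in the class *)

Section InducedGraphs.
Variables (R : realType) (V : finType) (W : V -> V -> R).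
Hypothesis W_sym : forall x y, W x y = W y x.
Hypothesis W_ge0 : forall x y, 0 <= W x y.
Implicit Types U : {set V}.

Definition induced_edges U : {set {set {x | x \in U}}} :=
  [set e | [exists x, exists y, [&& x != y, W (val x) (val y) != 0 & e == [set x; y]]]].

Lemma induced_edges_card U e : e \in induced_edges U -> #|e| = 2%N.
Proof.
by rewrite inE => /existsP[x /existsP[y /and3P[xy _ /eqP ->]]]; rewrite cards2 xy.
Qed.

Definition induced_graph U : sgraph := SGraph (@induced_edges_card U).

(** An edge is an unordered pair; the order picked is immaterial because [W] is symmetric. *)
Definition induced_weight U : weighting R (induced_graph U) :=
  fun e : {set {x | x \in U}} =>
    if [pick p | (p.1 != p.2) && (e == [set p.1; p.2])] is Some p
    then W (val p.1) (val p.2) else 0.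
Arguments induced_weight : clear implicits.

Lemma set2_eq (T : finType) (x y a b : T) : [set x; y] = [set a; b] -> a != b ->
  (a = x /\ b = y) \/ (a = y /\ b = x).
Proof.
move=> E ab.
have : a \in [set x; y] by rewrite E set21.
have : b \in [set x; y] by rewrite E set22.
rewrite !inE => /orP[]/eqP bE /orP[]/eqP aE; rewrite aE bE ?eqxx // in ab *;
  by [left | right].
Qed.

Lemma adj_induced U x y : adj_weight (induced_weight U) x y =
  if x == y then 0 else W (val x) (val y).
Proof.
have [->|xy] := eqVneq x y; first exact: adj_weight_diag.
have memE : ([set x; y] \in induced_edges U) = (W (val x) (val y) != 0).
  rewrite inE; apply/existsP/idP => [[a /existsP[b /and3P[ab Wab /eqP E]]]|Wxy].
    by case: (set2_eq E ab) Wab => -[-> ->] //; rewrite W_sym.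
  by exists x; apply/existsP; exists y; rewrite xy Wxy eqxx.
rewrite /adj_weight /= memE; case: eqP => [->//|_] /=.
rewrite /induced_weight; case: pickP => [[a b] /= /andP[ab /eqP E]|/(_ (x, y))].
  by case: (set2_eq E ab) => -[-> ->] //; rewrite W_sym.
by rewrite /= xy eqxx.
Qed.

Lemma induced_positive U : positive_weighting (induced_weight U).
Proof.
apply/positive_adj => x y xyU; rewrite lt_def; apply/andP; split; last first.
  by rewrite adj_induced; case: ifP.
move: (xyU); rewrite /= inE => /existsP[a /existsP[b /and3P[ab Wab /eqP E]]].
rewrite adj_induced (negPf (edge_neq xyU)).
by case: (set2_eq E ab) Wab => -[-> ->] //; rewrite W_sym.
Qed.

Section Extend.
Variables (U : {set V}) (a b : V) (mu : R).
Hypotheses (aU : a \notin U) (bU : b \in U) (mu0 : 0 <= mu) (d : dep W U a b mu).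
Let aV : {x | x \in a |: U} := Sub a (setU11 a U).
Let up (x : {x | x \in U}) : {x | x \in a |: U} := Sub (val x) (setU1r a (valP x)).
Let bS : {x | x \in U} := Sub b bU.

Lemma up_inj : injective up.
Proof. by move=> x y /(congr1 val) /= /val_inj. Qed.

Lemma up_neq x : up x != aV.
Proof. by apply: contraNneq aU => /(congr1 val) /= <-; exact: valP. Qed.

Lemma up_cases y : y = aV \/ exists x, y = up x.
Proof.
have := valP y; rewrite in_setU1 => /orP[/eqP ya|yU]; first by left; apply: val_inj.
by right; exists (Sub (val y) yU); apply: val_inj.
Qed.

Lemma adj_up x y : adj_weight (induced_weight (a |: U)) (up x) (up y) =
  adj_weight (induced_weight U) x y.
Proof. by rewrite !adj_induced (inj_eq up_inj). Qed.

Lemma dep_row (x : {x | x \in U}) : val x != b -> W a (val x) = mu * W b (val x).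
Proof.
move=> xb; rewrite W_sym d ?(valP x) //; first by rewrite W_sym.
by apply: contraNneq aU => <-; exact: valP.
Qed.

Lemma class_twin : 0 < mu -> stable_class (induced_weight U) ->
  stable_class (induced_weight (a |: U)).
Proof.
move=> mu_gt0 cU.
(* The weight of the twin edge is divided by [mu] in advance, since rescaling at the new vertex
   multiplies it; without such an edge, 1 is a positive placeholder. *)
pose twin := W a b != 0; pose c := if twin then W a b / mu else 1.
have c0 : 0 < c.
  by rewrite /c /twin; case: ifP => // Wab; rewrite divr_gt0 // lt_def Wab W_ge0.
pose w1 := copy_weight (induced_weight U) bS twin c.
pose w2 := rescale_weight w1 None mu.
have w2c : stable_class w2 by apply: class_rescale => //; apply: class_copy.
have w2p : positive_weighting w2.
  by apply: rescale_positive => //; apply: copy_positive => //; exact: induced_positive.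
pose f (o : option {x | x \in U}) := if o is Some x then up x else aV.
have f_bij : bijective f.
  apply: (Bijective (g := fun y => insub (val y))).
    move=> [x|] /=; first by rewrite valK.
    by rewrite insubF //; apply: negbTE.
  move=> y; case: (up_cases y) => [->|[x ->]] /=; last by rewrite valK.
  by rewrite insubF //; apply: negbTE.
apply: (@class_iso R (copy_graph (H := induced_graph U) bS twin) (induced_graph (a |: U)) w2 _ f) => //.
apply: iso_of_adj => //.
  exact: induced_positive.
have cross t : adj_weight (induced_weight (a |: U)) aV (up t) = adj_weight w2 None (Some t).
  rewrite adj_rescale eqxx /= adj_copy_None !adj_induced eq_sym (negPf (up_neq t)).
  rewrite -(inj_eq val_inj) /=; have [tb|tb] := eqVneq (val t) b.
    rewrite tb /c /twin; case: eqP => [->|_] /=; first by rewrite mulr0.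
    by rewrite mulrC divfK ?gt_eqF.
  have bt : (bS == t) = false.
    by apply/negbTE; apply: contraNneq tb => <-.
  by rewrite bt dep_row.
move=> [x|] [y|] /=.
- by rewrite adj_rescale /= adj_up adj_copy_Some.
- by rewrite adj_weight_sym cross adj_weight_sym.
- exact: cross.
by rewrite !adj_weight_diag.
Qed.

(** A pendant edge is a single edge glued at [b], and a single edge is the one-vertex graph copied
    with an adjacent twin. *)
Lemma class_pendant : mu = 0 -> 0 < W a b -> stable_class (induced_weight U) ->
  stable_class (induced_weight (a |: U)).
Proof.
move=> muE Wab cU.
pose w0 : weighting R single_graph := fun=> 1.
have w0p : positive_weighting w0 by move=> e; rewrite inE.
pose k2 := copy_weight w0 tt true (W a b).
have k2p : positive_weighting k2 by apply: copy_positive.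
have k2c : stable_class k2 by apply: class_copy => //; exact: class_single.
pose v2 : copy_graph (H := single_graph) tt true := Some tt.
pose w1 := glue_weight (induced_weight U) k2 bS v2.
have w1c : stable_class w1 by apply: class_glue.
have w1p : positive_weighting w1 by apply: glue_positive => //; exact: induced_positive.
pose f (g : {x | x \in U} + {x : option unit | x != Some tt}) :=
  if g is inl x then up x else aV.
pose None' : {x : option unit | x != Some tt} := Sub None isT.
have f_bij : bijective f.
  apply: (Bijective (g := fun y => if insub (val y) is Some x then inl x else inr None')).
    move=> [x|o] /=; first by rewrite valK.
    rewrite insubF; last exact: negbTE.
    by congr inr; apply: val_inj; case: o => -[[]|].
  move=> y; case: (up_cases y) => [->|[x ->]] /=; last by rewrite valK.
  by rewrite insubF //; apply: negbTE.
apply: (@class_iso R (glue_graph (H1 := induced_graph U) bS v2) (induced_graph (a |: U)) w1 _ f) => //.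
apply: iso_of_adj => //.
  exact: induced_positive.
have inrE (o : {x : option unit | x != Some tt}) :
    inr o = glue_inr (H1 := induced_graph U) (H2 := copy_graph (H := single_graph) tt true) bS v2 None.
  rewrite /glue_inr insubT; congr inr; apply: val_inj.
  by case: o => -[[]|].
have cross x o : adj_weight (induced_weight (a |: U)) (up x) aV = adj_weight w1 (inl x) (inr o).
  rewrite inrE -/(@glue_inl (induced_graph U) _ v2 x) adj_induced (negPf (up_neq x)) W_sym /=.
  have [xb|xb] := eqVneq (val x) b.
    have -> : x = bS by apply: val_inj.
    rewrite -(@glue_inr_root (induced_graph U) _ bS v2) adj_glue_inr adj_weight_sym adj_copy_None eqxx.
    by [].
  by rewrite dep_row // muE mul0r adj_glue_cross.
move=> [x|o] [y|o'] /=.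
- by rewrite adj_up -/(@glue_inl (induced_graph U) _ v2 x) -/(@glue_inl (induced_graph U) _ v2 y) adj_glue_inl.
- exact: cross.
- by rewrite adj_weight_sym (cross y o) adj_weight_sym.
by rewrite !inrE !adj_weight_diag.
Qed.

End Extend.

Lemma reducible_class U : reducible W U -> stable_class (induced_weight U).
Proof.
elim=> [r|{}U a b mu _ cU aU bU mu0 d [t tU Wta]].
  pose w0 : weighting R single_graph := fun=> 1.
  pose rS : {x | x \in [set r]} := Sub r (set11 r).
  have uniq (x : {x | x \in [set r]}) : x = rS.
    by apply: val_inj; have := valP x; rewrite inE => /eqP.
  apply: (@class_iso R single_graph (induced_graph [set r]) w0 _ (fun=> rS)); last exact: class_single.
  apply: iso_of_adj.
  - by exists (fun=> tt) => [[]|x] //; rewrite [x]uniq.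
  - by move=> e; rewrite inE.
  - exact: induced_positive.
  by move=> [] []; rewrite !adj_weight_diag.
have [mu1|mu1] := eqVneq mu 0; last by apply: (class_twin aU bU d) => //; rewrite lt_def mu1.
apply: (class_pendant aU bU d mu1) => //; rewrite lt_def W_ge0 andbT.
have [tb|tb] := eqVneq t b; first by rewrite W_sym -tb.
by move: Wta; rewrite d // ?mu1 ?mul0r ?eqxx //; apply: contraNneq aU => <-.
Qed.

End InducedGraphs.

(** * Stability under the operations of the class *)

Section StableOperations.
Variables (R : realType).
Local Notation Im := (@complex.Im R).
Local Notation rc := (real_complex R).

Lemma Im_scale (a : R) (z : R[i]) : Im (rc a * z) = a * Im z.
Proof. by case: z => x y /=; rewrite mul0r addr0. Qed.

Lemma Im_bigsum (I : finType) (P : pred I) (F : I -> R[i]) :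
  Im (\sum_(t | P t) F t) = \sum_(t | P t) Im (F t).
Proof. by apply: (big_morph Im (@Im_add R)). Qed.

Lemma stable_on_single n (W : 'I_n -> 'I_n -> R) u : stable_on W [set u].
Proof.
move=> z zH u'; rewrite inE => /eqP ->; rewrite /tdet setDv.
rewrite (_ : lapmx _ _ _ _ = 1%:M) ?det1 ?oner_neq0 //.
by apply/matrixP => t j; rewrite !mxE inE.
Qed.

Lemma stable_on_ext n (W W' : 'I_n -> 'I_n -> R) (U : {set 'I_n}) :
  (forall i j, W i j = W' i j) -> stable_on W U -> stable_on W' U.
Proof.
move=> E st z zH u uU; have := st z zH u uU.
by rewrite (@tdet_ext _ _ _ (fun i j => rc (W' i j)) U u z z) // => i j _ _; rewrite E.
Qed.

Lemma stable_on_inj m n (f : 'I_m -> 'I_n) (W : 'I_n -> 'I_n -> R) (U : {set 'I_m}) :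
  injective f -> stable_on (fun i j => W (f i) (f j)) U -> stable_on W (f @: U).
Proof.
move=> f_inj st z zH _ /imsetP[u uU ->]; rewrite tdet_inj //.
by apply: st => // i; exact: zH.
Qed.

(** Both factors of [tdet_step] are nonzero: the linear one has nonnegative coefficients, not all
    zero, and [x b + mu * x a] stays in the upper half plane. *)
Lemma stable_on_step n (W : 'I_n -> 'I_n -> R) (U : {set 'I_n}) a b mu :
    (forall i j, W i j = W j i) -> (forall i j, 0 <= W i j) ->
    a \notin U -> b \in U -> 0 <= mu -> dep W U a b mu ->
    (exists2 t, t \in U & W t a != 0) ->
  stable_on W U -> stable_on W (a |: U).
Proof.
move=> W_sym W_ge0 aU bU mu0 d [t0 t0U Wt0] st.
have tna t : t \in U -> t != a by apply: contraTneq => ->.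
(* When [b] is the only vertex of [U], no root is left for [tdet_step], and the minor is computed
   directly. *)
have [/existsP[r /andP[rU rb]]|none] := boolP [exists r in U, r != b].
  apply: (stable_on_root W_sym (u0 := r)) => [|z zH]; first by rewrite inE rU orbT.
  rewrite (@tdet_step _ _ _ U a b r (rc mu)) //; last first.
  - by move=> t tU tb; rewrite d ?tna // rmorphM.
  - by move=> i j; rewrite W_sym.
  have xH : 0 < Im (z b + rc mu * z a).
    by rewrite Im_add Im_scale ltr_wpDr ?zH // mulr_ge0 // ltW.
  rewrite mulf_neq0 //; last by apply: st => // t; case: ifP.
  apply: Im_gt0_neq0; rewrite Im_add !Im_scale Im_bigsum.
  have S0 t : 0 <= Im (rc (W b t) * z t) by rewrite Im_scale mulr_ge0 // ltW.
  have sum0 : 0 <= \sum_(t in U | t != b) Im (rc (W b t) * z t) by apply: sumr_ge0.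
  have [t0b|t0b] := eqVneq t0 b.
    rewrite ltr_wpDl ?mulr_ge0 // mulr_gt0 // lt_def W_ge0 andbT W_sym -t0b.
    exact: Wt0.
  rewrite ltr_pwDl //; last by rewrite mulr_ge0 // ltW.
  move: Wt0; rewrite d ?tna // mulf_eq0 negb_or => /andP[mun0 Wt0].
  rewrite mulr_gt0 ?lt_def ?mun0 //=.
  rewrite (bigD1 t0) ?t0U //= gt_eqF ?addr_ge0 ?sumr_ge0 //.
  rewrite ltr_pwDl ?sumr_ge0 // Im_scale mulr_gt0 ?zH // lt_def W_ge0 andbT W_sym.
  exact: Wt0.
have UE : U = [set b].
  apply/setP => t; rewrite inE; apply/idP/eqP => [tU|->//].
  by apply/eqP; move: none; rewrite negb_exists => /forallP/(_ t); rewrite tU negbK.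
have Wab : W a b != 0 by move: t0U Wt0; rewrite UE inE => /eqP ->; rewrite W_sym.
have ab : a != b by rewrite eq_sym tna.
apply: (stable_on_root W_sym (u0 := b)) => [|z zH]; first by rewrite inE bU orbT.
rewrite /tdet (@det_unit_rows_but _ _ a) => [|t j ta]; last first.
  by rewrite mxE UE !inE (negPf ta) /= andNb.
rewrite mxE UE !inE eqxx ab /= /lap setU11 eqxx big_setU1 ?inE //= big_set1.
rewrite !mul1r addrAC subrr add0r mulf_neq0 ?fmorph_eq0 //.
exact: Im_gt0_neq0.
Qed.

Lemma stable_on_glue n (W : 'I_n -> 'I_n -> R) (U1 U2 : {set 'I_n}) r :
    (forall i j, W i j = W j i) -> U1 :&: U2 = [set r] ->
    (forall t u, t \in U1 :\ r -> u \in U2 :\ r -> W t u = 0) ->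
  stable_on W U1 -> stable_on W U2 -> stable_on W (U1 :|: U2).
Proof.
move=> W_sym U12 W0 st1 st2.
have : r \in U1 :&: U2 by rewrite U12 inE.
rewrite inE => /andP[r1 r2].
apply: (stable_on_root W_sym (u0 := r)) => [|z zH]; first by rewrite inE r1.
rewrite tdet_glue // => [|t u t1 u2]; last by rewrite (W_sym u t) W0 // rmorph0.
by rewrite mulf_neq0 ?st1 ?st2.
Qed.

(** The factors [c i] split into a scaling of the rows and the substitution of [c i * x i] for
    [x i], which preserves the half plane. *)
Lemma stable_on_scale n (W : 'I_n -> 'I_n -> R) (U : {set 'I_n}) (c : 'I_n -> R) :
  (forall i, 0 < c i) -> stable_on W U -> stable_on (fun i j => c i * c j * W i j) U.
Proof.
move=> c0 st z zH u uU.
have -> : tdet (fun i j => rc (c i * c j * W i j)) U u z =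
   \det (diag_mx (\row_i (if i \in U :\ u then rc (c i) else 1))) *
   tdet (fun i j => rc (W i j)) U u (fun i => rc (c i) * z i).
  rewrite /tdet -det_mulmx; congr (\det _); apply/matrixP => t j.
  rewrite mul_diag_mx !mxE; case: ifP => _; last by rewrite mul1r.
  have E : \sum_(s in U) rc (c t * c s * W t s) * z s =
           rc (c t) * \sum_(s in U) rc (W t s) * (rc (c s) * z s).
    rewrite mulr_sumr; apply: eq_bigr => s _.
    by rewrite !(rmorphM rc); ring.
  by rewrite /lap E !(rmorphM rc); ring.
rewrite mulf_neq0 //; last by apply: st => // i; rewrite Im_scale mulr_gt0.
rewrite det_diag prodf_seq_neq0; apply/allP => i _; rewrite mxE /=.
by case: ifP => _; rewrite ?oner_neq0 // fmorph_eq0 gt_eqF.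
Qed.

Section ConnectedSets.
Variables (V : finType) (W : V -> V -> R).

Lemma conn_ext (W' : V -> V -> R) (U : {set V}) :
  (forall x y, (W x y != 0) = (W' x y != 0)) -> conn W U -> conn W' U.
Proof.
move=> E [U0 Uc]; split=> // X XU X0 XnU.
by have [x [y [xX yU yX Wxy]]] := Uc X XU X0 XnU; exists x, y; rewrite -E.
Qed.

Lemma conn_preim (T : finType) (f : T -> V) (U : {set T}) : injective f ->
  conn W (f @: U) -> conn (fun x y => W (f x) (f y)) U.
Proof.
move=> f_inj [fU0 fUc]; split=> [|X XU X0 XnU].
  by apply: contraNneq fU0 => ->; rewrite imset0.
have [||| _ [_ [/imsetP[x xX ->] /imsetP[y yU ->] fyX Wxy]]] := fUc (f @: X).
- exact: imsetS.
- by rewrite imset_eq0.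
- by apply: contra XnU => /eqP/(imset_inj f_inj)->.
by exists x, y; split=> //; apply: contra fyX; exact: imset_f.
Qed.

(** A set inside [U1] that avoids [r] can only be left through [U1]; a set containing [r] is
    replaced by its complement in [U1]. *)
Lemma conn_glue (U1 U2 : {set V}) r : (forall x y, W x y = W y x) ->
    U1 :&: U2 = [set r] ->
    (forall t u, t \in U1 :\ r -> u \in U2 :\ r -> W t u = 0) ->
  conn W (U1 :|: U2) -> conn W U1.
Proof.
move=> W_sym U12 W0 [_ Uc].
have : r \in U1 :&: U2 by rewrite U12 inE.
rewrite inE => /andP[r1 r2].
have side (X : {set V}) : X \subset U1 -> X != set0 -> r \notin X ->
    exists x y, [/\ x \in X, y \in U1, y \notin X & W x y != 0].
  move=> X1 X0 rX; have [||| x [y [xX + yX Wxy]]] := Uc X.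
  - by apply: subset_trans X1 _; exact: subsetUl.
  - by [].
  - by apply: contraNneq rX => ->; rewrite inE r1.
  have xr : x \in U1 :\ r.
    by rewrite !inE (subsetP X1) // andbT; apply: contraNneq rX => <-.
  rewrite inE => /orP[y1|y2]; first by exists x, y.
  have [yr|yr] := eqVneq y r; first by exists x, y; rewrite yr r1 -yr.
  by move: Wxy; rewrite W0 ?eqxx // !inE yr.
apply: (conn_flip W_sym) => [|X X1 X0 Xn1]; first by apply/set0Pn; exists r.
have [rX|rX] := boolP (r \in X); [right|left]; last exact: side.
have [||| x [y [xX yU yX Wxy]]] := side (U1 :\: X).
- exact: subsetDl.
- by rewrite setD_eq0; apply: contra Xn1 => U1X; rewrite eqEsubset X1.
- by rewrite inE rX.
by exists x, y; move: yX; rewrite in_setD yU andbT negbK.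
Qed.

End ConnectedSets.

Lemma conn_connect (G : sgraph) (w : weighting R G) : positive_weighting w ->
  connected_graph G -> conn (adj_weight w) [set: G].
Proof.
move=> w0 /andP[G0 /forallP Gc]; split=> [|X _ X0 XnT].
  by have /card_gt0P[x _] := G0; apply/set0Pn; exists x; rewrite inE.
have [/existsP[x /existsP[y /and3P[xX yX Wxy]]]|none] :=
    boolP [exists x, exists y, [&& x \in X, y \notin X & adj_weight w x y != 0]].
  by exists x, y; rewrite inE.
have closedX : closed (edge_rel (edges G)) (mem X).
  apply: intro_closed => [|x y exy xX].
    exact: (sym_connect_sym (edge_rel_sym _)).
  apply: contraR none => yX; apply/existsP; exists x; apply/existsP; exists y.
  by rewrite xX yX (adj_weight_neq0 w0).
have [x xX] := set0Pn _ X0.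
case/eqP: XnT; apply/setP => y; rewrite inE.
have /forallP/(_ y) xy := Gc x.
by rewrite -[y \in X](closed_connect closedX xy).
Qed.

Lemma ord_image (G : sgraph) : @enum_rank G @: [set: G] = [set: 'I_#|G|].
Proof. by apply/setP => i; rewrite inE; apply/imsetP; exists (enum_val i); rewrite ?enum_valK. Qed.

Lemma enum_val_image (G : sgraph) : @enum_val G G @: [set: 'I_#|G|] = [set: G].
Proof. by apply/setP => i; rewrite inE; apply/imsetP; exists (enum_rank i); rewrite ?enum_rankK. Qed.

Lemma stable_on_embed (H G : sgraph) (wH : weighting R H) (wG : weighting R G) (f : H -> G) :
    injective f -> (forall x y, adj_weight wG (f x) (f y) = adj_weight wH x y) ->
    stable_on (ord_weight wH) setT ->
  stable_on (ord_weight wG) (@enum_rank G @: (f @: [set: H])).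
Proof.
move=> f_inj fE st; pose g (i : 'I_#|H|) : 'I_#|G| := enum_rank (f (enum_val i)).
have -> : @enum_rank G @: (f @: [set: H]) = g @: [set: 'I_#|H|].
  by rewrite -enum_val_image -!imset_comp.
apply: stable_on_inj; first by move=> i j /enum_rank_inj/f_inj/enum_val_inj.
by apply: stable_on_ext st => i j; rewrite /ord_weight /g !enum_rankK fE.
Qed.

Lemma class_positive (G : sgraph) (w : weighting R G) : stable_class w -> positive_weighting w.
Proof.
elim=> {G w} [w e|H w u twin c _ w0 c0|H1 H2 w1 w2 v1 v2 _ w10 _ w20|H w v c _ w0 c0|].
- by rewrite inE.
- exact: copy_positive.
- exact: glue_positive.
- exact: rescale_positive.
by move=> G H wG wH f iso _; exact: iso_positive iso.
Qed.

(** The class contains disconnected graphs, so connectedness is carried as a hypothesis, which each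
    operation passes down to its constituents. *)
Lemma class_stable_on (G : sgraph) (w : weighting R G) : stable_class w ->
  conn (adj_weight w) [set: G] -> stable_on (ord_weight w) setT.
Proof.
elim=> {G w} [w _|H w u twin c cw IH c0|H1 H2 w1 w2 v1 v2 c1 IH1 c2 IH2|H w v c cw IH c0|].
- have -> : [set: 'I_#|single_graph|] = [set enum_rank tt].
    by apply/setP => k; rewrite !inE -[k]enum_valK; case: (enum_val k); rewrite eqxx.
  exact: stable_on_single.
- set cwt := copy_weight w u twin c => Gc.
  have w0 := class_positive cw; have cw0 := copy_positive (u := u) (twin := twin) w0 c0.
  have TE : [set: copy_graph u twin] :\ None = Some @: [set: H].
    apply/setP => -[x|]; rewrite !inE /=; first by rewrite mem_imset ?inE //; exact: Some_inj.
    by apply/esym/negbTE/imsetP => -[].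
  (* A copy is a twin with factor 1. *)
  have d : dep (adj_weight cwt) [set: copy_graph u twin] None (Some u) 1.
    move=> [t|] // _ _ tu'; have tu : t != u by apply: contraNneq tu' => ->.
    rewrite mul1r adj_copy_Some adj_weight_sym adj_copy_None (negPf tu).
    exact: adj_weight_sym.
  have Hc : conn (adj_weight w) [set: H].
    have := conn_del_dep (@adj_weight_sym _ _ _) Gc (in_setT None) (in_setT (Some u)) isT d.
    rewrite TE => /(conn_preim Some_inj); apply: conn_ext => x y.
    by rewrite adj_copy_Some.
  have st := stable_on_embed (wG := cwt) Some_inj (adj_copy_Some w u twin c) (IH Hc).
  have NT : @enum_rank (copy_graph u twin) None |: (@enum_rank (copy_graph u twin) @: (Some @: [set: H])) = setT.
    by rewrite -ord_image -imsetU1 -TE setD1K ?inE.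
  rewrite -NT; apply: (@stable_on_step _ _ _ _ (@enum_rank (copy_graph u twin) (Some u)) 1) st => //.
  - exact: ord_weight_sym.
  - by move=> i j; exact: adj_weight_ge0.
  - by rewrite mem_imset -?TE ?inE //; exact: enum_rank_inj.
  - by rewrite mem_imset -?TE ?inE //; exact: enum_rank_inj.
  - move=> _ /imsetP[t tT ->] tN tu; rewrite /ord_weight !enum_rankK d //.
      by apply: contraNneq tN => ->.
    by apply: contraNneq tu => ->.
  have [||| x [y [+ _ yX Wxy]]] := Gc.2 [set None].
  + exact: subsetT.
  + by apply/set0Pn; exists None; rewrite inE.
  + by apply/eqP => /setP/(_ (Some u)); rewrite !inE.
  rewrite inE => /eqP xN; exists (enum_rank y).
    by rewrite mem_imset -?TE ?inE ?andbT; [rewrite inE in yX | exact: enum_rank_inj].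
  by rewrite /ord_weight !enum_rankK adj_weight_sym -xN.
- set gw := glue_weight w1 w2 v1 v2 => Gc.
  pose GV := glue_graph v1 v2.
  pose il : H1 -> GV := @glue_inl H1 H2 v2.
  pose ir : H2 -> GV := @glue_inr H1 H2 v1 v2.
  have ili : injective il := @glue_inl_inj _ _ _.
  have iri : injective ir := @glue_inr_inj _ _ _ _.
  pose U1 := il @: [set: H1]; pose U2 := ir @: [set: H2].
  have rE : ir v2 = il v1 := glue_inr_root v1 v2.
  have U12 : U1 :&: U2 = [set il v1].
    apply/setP => g; rewrite !inE; apply/andP/eqP => [[/imsetP[x _ ->] /imsetP[y _]]|->].
      by move=> /glue_inl_inr[->].
    by split; apply/imsetP; [exists v1 | exists v2].
  have UT : U1 :|: U2 = setT.
    apply/setP => g; rewrite !inE; case: (glue_cases g) => [[x ->]|[y _ ->]].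
      by rewrite imset_f.
    by rewrite orbC imset_f.
  have W0 t u : t \in U1 :\ il v1 -> u \in U2 :\ il v1 -> adj_weight gw t u = 0.
    move=> /setD1P[+ /imsetP[x _ tE]] /setD1P[+ /imsetP[y _ uE]].
    rewrite tE uE -{2}rE (inj_eq ili) (inj_eq iri); exact: adj_glue_cross.
  have Gc' : conn (adj_weight gw) (U1 :|: U2) by rewrite UT.
  have H1c : conn (adj_weight w1) [set: H1].
    have := conn_glue (@adj_weight_sym _ _ _) U12 W0 Gc'.
    move=> /(conn_preim ili); apply: conn_ext => x y; by rewrite adj_glue_inl.
  have H2c : conn (adj_weight w2) [set: H2].
    rewrite setUC in Gc'; rewrite setIC in U12.
    have := conn_glue (@adj_weight_sym _ _ _) U12 _ Gc'.
    have W0' t u : t \in U2 :\ il v1 -> u \in U1 :\ il v1 -> adj_weight gw t u = 0.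
      by move=> t2 u1; rewrite adj_weight_sym W0.
    move=> /(_ W0')/(conn_preim iri); apply: conn_ext => x y; by rewrite adj_glue_inr.
  have st1 := stable_on_embed ili (adj_glue_inl w1 w2 v1 v2) (IH1 H1c).
  have st2 := stable_on_embed iri (adj_glue_inr w1 w2 v1 v2) (IH2 H2c).
  have -> : setT = (@enum_rank GV @: U1) :|: (@enum_rank GV @: U2).
    by rewrite -imsetU UT ord_image.
  have memr (g : GV) (S : {set GV}) : (enum_rank g \in @enum_rank GV @: S) = (g \in S).
    by rewrite mem_imset //; exact: enum_rank_inj.
  apply: (@stable_on_glue _ _ _ _ (@enum_rank GV (il v1))) st1 st2.
  + exact: ord_weight_sym.
  + rewrite -imsetI ?U12 ?imset_set1 // => x y _ _; exact: enum_rank_inj.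
  move=> t u; rewrite -[t]enum_valK -[u]enum_valK !in_setD1 !memr !(inj_eq enum_rank_inj).
  move=> t1 u2; rewrite /ord_weight !enum_rankK; apply: W0; by rewrite in_setD1.
- move=> Gc; have w0 := class_positive cw.
  have Hc : conn (adj_weight w) [set: H].
    apply: conn_ext Gc => x y; rewrite adj_rescale; case: ifP => // _.
    by rewrite mulf_eq0 (gt_eqF c0).
  pose d (i : 'I_#|H|) := if enum_val i == v then c else 1.
  have d0 i : 0 < d i by rewrite /d; case: ifP.
  apply: stable_on_ext (stable_on_scale d0 (IH Hc)) => i j.
  rewrite /ord_weight adj_rescale /d.
  have [iv|iv] := eqVneq (enum_val i) v; have [jv|jv] := eqVneq (enum_val j) v;
    rewrite ?mul1r ?mulr1 //=.
  by rewrite iv jv adj_weight_diag !mulr0.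
move=> G H wG wH f iso cG IH Hc; have [fb EH fw] := iso.
have [g fK gK] := fb; have f_inj := can_inj fK.
have fT : f @: [set: G] = setT.
  by apply/setP => y; rewrite inE; apply/imsetP; exists (g y); rewrite ?gK.
have Gc : conn (adj_weight wG) [set: G].
  move: Hc; rewrite -fT => /(conn_preim f_inj); apply: conn_ext => x y.
  by rewrite (iso_adj iso).
have := stable_on_embed f_inj (iso_adj iso) (IH Gc).
by rewrite fT ord_image.
Qed.

End StableOperations.

Lemma tree_poly_single (R : realType) (G : sgraph) (w : weighting R G) (x : 'I_#|G| -> R[i]) :
  #|G| = 1%N -> (map_mpoly (real_complex R) (tree_poly w)).@[x] = 1.
Proof.
move=> G1; have uniq (s t : G) : s = t.
  have /card_le1P G1' : (#|G| <= 1)%N by rewrite G1.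
  by have := G1' s isT t; rewrite inE => /esym/eqP ->.
have noedge (e : {set G}) : #|e| <> 2%N.
  by move=> e2; have := max_card (mem e); rewrite e2 G1.
have E0 : edges G = set0.
  by apply/setP => e; rewrite inE; apply/negbTE/negP => /edges_card/noedge.
rewrite tree_poly_eval (_ : spanning_trees G = [set set0]).
  rewrite big_set1 big_set0 mul1r big1 // => v _.
  rewrite (_ : edge_degree set0 v = 0%N) ?expr0 // /edge_degree.
  by apply: eq_card0 => e; rewrite !inE.
apply/setP => T; rewrite !inE E0 subset0; apply/andP/eqP => [[/eqP//]|->].
split=> //; apply/andP; split.
  apply/andP; split; first by rewrite G1.
  by apply/forallP => s; apply/forallP => t; rewrite (uniq s t) connect0.
apply/forallP => k; apply/forallP => c; apply/implyP => k2.
have k1 : (k <= 1)%N by rewrite -G1 -ltnS ltn_ord.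
by have := leq_trans k2 k1.
Qed.

Lemma weighted_stableE (R : realType) (G : sgraph) (w : weighting R G) :
  (1 < #|G|)%N -> weighted_stable w <-> stable_on (ord_weight w) setT.
Proof.
move=> G1; have [v _] : exists v : G, v \in G by apply/card_gt0P; apply: ltnW.
split=> st.
  apply: (stable_on_root (ord_weight_sym w) (u0 := enum_rank v)) => [|z zH]; first by rewrite inE.
  by rewrite -matrix_tree // mulf_neq0 ?st // Im_gt0_neq0.
move=> z zH; have := st z zH (enum_rank v) (in_setT _).
by rewrite -matrix_tree // mulf_eq0 negb_or => /andP[].
Qed.

Theorem theorem2 (R : realType) (G : sgraph) (w : weighting R G)
    (G_connected : connected_graph G) (w_positive : positive_weighting w) :
  weighted_stable w <-> stable_class w.
Proof.
have Gc := conn_connect w_positive G_connected.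
(* The matrix-tree identity requires two vertices; for one vertex the polynomial is 1 and the graph
   is the base case of the class. *)
have [G1|G1] := leqP #|G| 1.
  have G1' : #|G| = 1%N by apply/eqP; rewrite eqn_leq G1; have /andP[] := G_connected.
  have [v _] : exists v : G, v \in G by apply/card_gt0P; rewrite G1'.
  have uniq t : t = v.
    by apply/eqP; have /card_le1P/(_ v isT t) := G1; rewrite /= !inE => <-.
  split=> _; last by move=> z zH; rewrite tree_poly_single ?oner_neq0.
  apply: (@class_iso R single_graph G (fun=> 1) w (fun=> v)); last exact: class_single.
  apply: iso_of_adj => //.
    by exists (fun=> tt) => [[]|t]; rewrite // -[RHS]uniq.
  by move=> [] []; rewrite !adj_weight_diag.
rewrite weighted_stableE //; split=> [st|cw]; last exact: class_stable_on cw Gc.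
have oc : conn (ord_weight w) [set: 'I_#|G|].
  by apply: (conn_preim (f := @enum_val G G)); [exact: enum_val_inj | rewrite enum_val_image].
have osym := ord_weight_sym w.
have oge0 i j : 0 <= ord_weight w i j by exact: adj_weight_ge0.
have red := reducible_of_stable osym oge0 oc st.
pose f (x : {i : 'I_#|G| | i \in [set: 'I_#|G|]}) : G := enum_val (val x).
apply: (@class_iso R (induced_graph (ord_weight w) setT) G
          (@induced_weight _ _ (ord_weight w) setT) w f);
  last exact: reducible_class.
apply: iso_of_adj => //.
- exists (fun t => Sub (enum_rank t) (in_setT _)) => [x|t]; last by rewrite /f /= enum_rankK.
  by apply: val_inj; rewrite /= enum_valK.
- exact: induced_positive.
move=> x y; rewrite adj_induced //; case: eqP => [->|_ //]; exact: adj_weight_diag.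
Qed.
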